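(* Let $r\in[0,1]$ and let $\mathcal B_r=r\,\mathcal B_{in}+(1-r)\,\mathcal B_{av}:\widetilde{\mathcal H}^1_{in}\to\mathbb R$ be the regularized action functional on twisted loops. The functional $\mathcal B_r$ is invariant under the involution $\rho z(\tau)=z(1-\tau)$, whose fixed point set in $\widetilde{\mathcal H}^1_{in}$ is the set $\widehat{\mathcal H}^1_{in}$ of symmetric loops, and the critical points fixed by the involution are precisely the symmetric frozen planet orbits, in the following sense: under the Levi-Civita transformations $q_i(t)=z_i(\tau_{z_i}(t))^2$, $i=1,2$, with time changes satisfying $\frac{dt}{q_i(t)}=\frac{d\tau_{z_i}(t)}{\|z_i\|^2}$, critical points $(z_1,z_2)$ of $\mathcal B_r:\widehat{\mathcal H}^1_{in}\to\mathbb R$ are in 4-to-1 correspondence with symmetric generalized solutions $(q_1,q_2)$ of $$\ddot q_1=-\frac{2}{q_1^2}+\frac{r}{(q_1-q_2)^2}+\frac{1-r}{(\bar q_1-\bar q_2)^2},\qquad \ddot q_2=-\frac{2}{q_2^2}-\frac{r}{(q_1-q_2)^2}-\frac{1-r}{(\bar q_1-\bar q_2)^2}$$ with $q_1$ having an even and $q_2$ an odd number of zeroes (i.e. with symmetric frozen planet orbits).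
   Context: Notation: $S^1=\mathbb R/\mathbb Z$; $\|f\|^2=\int_0^1f^2d\tau$ (so $\|z^2\|^2=\int_0^1z^4d\tau$); $H^k=W^{k,2}$; $\bar q=\int_0^1q\,dt$. Twisted loops: $H^k_{twist}(S^1,\mathbb R^2)=\{z=(z_1,z_2)\in H^k(\mathbb R/2\mathbb Z,\mathbb R^2): z_1(\tau+1)=z_1(\tau),\ z_2(\tau+1)=-z_2(\tau)\text{ for all }\tau\}$. Symmetric loops: $H^k_{sym}(S^1,\mathbb R^2)=\{z\in H^k_{twist}(S^1,\mathbb R^2): z(\tau)=z(1-\tau)\text{ for all }\tau\}$. Time changes: for $z$ continuous with $z^2$ $1$-periodic and finitely many zeroes per period, let $t_z:S^1\to S^1$, $t_z(\tau)=\|z\|^{-2}\int_0^\tau z(\sigma)^2d\sigma$. This is a homeomorphism, and $\tau_z:=t_z^{-1}$. $\widetilde{\mathcal H}^1_{in}=\{(z_1,z_2)\in H^1_{twist}(S^1,\mathbb R^2): \|z_1\|>0,\ \|z_2\|>0,\ z_1^2(\tau)-z_2^2(\tau_{z_2}(t_{z_1}(\tau)))>0\text{ for all }\tau\in S^1\}$, and $\widehat{\mathcal H}^1_{in}$ is defined by the same conditions with $H^1_{sym}(S^1,\mathbb R^2)$ in place of $H^1_{twist}(S^1,\mathbb R^2)$. Functionals: $\mathcal Q(z_i)=2\|z_i\|^2\|z_i'\|^2+\frac2{\|z_i\|^2}$, $\mathcal I(z_1,z_2)=-\frac1{\|z_1\|^2}\int_0^1\frac{z_1(\tau)^2}{z_1^2(\tau)-z_2^2(\tau_{z_2}(t_{z_1}(\tau)))}d\tau$,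 $\mathcal A(z_1,z_2)=-\frac{\|z_1\|^2\|z_2\|^2}{\|z_1^2\|^2\|z_2\|^2-\|z_2^2\|^2\|z_1\|^2}$, $\mathcal B_{in}=\mathcal Q(z_1)+\mathcal Q(z_2)+\mathcal I$, $\mathcal B_{av}=\mathcal Q(z_1)+\mathcal Q(z_2)+\mathcal A$. A generalized solution here is a pair $(q_1,q_2)\in H^1(S^1,\mathbb R_{\ge0}\times\mathbb R_{\ge0})$ such that for $i=1,2$: $q_1(t)>q_2(t)$ for all $t\in S^1$; the zero sets $Z_i=q_i^{-1}(0)$ are finite (with parities as stated in the claim); the restricted maps $q_i:S^1\setminus Z_i\to\mathbb R_{\ge0}$ are smooth and satisfy the system; the energies $E_i=\frac{\dot q_i^2}2-\frac2{q_i}$ on $S^1\setminus Z_i$ extend to continuous functions $S^1\to\mathbb R$. It is symmetric if $q_i(t)=q_i(1-t)$ for all $t\in S^1$, $i=1,2$.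
   Formalization: ''Smooth on S^1∖Z_i'' is replaced by C^2 on S^1∖Z_i and smooth off Z_1∪Z_2; symmetric solutions with q_2(1/2)=0, which have no symmetric lift, are first shifted by half a period, so the 4-to-1 correspondence is with symmetric solutions having q_2(0)=0. *)

(* Defs.v *)
From HB Require Import structures.
From mathcomp Require Import all_boot all_order all_algebra.
From mathcomp Require Import all_classical all_reals all_analysis.
Set Implicit Arguments.
Unset Strict Implicit.
Unset Printing Implicit Defensive.
Import Order.TTheory GRing.Theory Num.Theory.
Import numFieldNormedType.Exports.
Local Open Scope classical_set_scope.
Local Open Scope ring_scope.

(* A function on the circle R/pZ is a p-periodic function R -> R; a map from
   a circle to the plane is the pair of its components. *)

Section Sobolev.
Context {R : realType}.
Implicit Types (p : R) (f g phi : R -> R).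

(* int_0^p f *)
Definition pint p f : R :=
  (\int[@lebesgue_measure R]_(x in `[0%R, p]) f x)%R.

Definition C1_test p phi : Prop :=
  [/\ periodic phi p, (forall x, derivable phi x 1) & continuous (derive1 phi)].

(* g is a square integrable weak derivative of f on R/pZ. *)
Definition weak_derivative p f g : Prop :=
  [/\ periodic g p,
      measurable_fun setT g,
      (@lebesgue_measure R).-integrable `[0, p] (fun x => (g x ^+ 2)%:E) &
      forall phi, C1_test p phi ->
        pint p (fun x => f x * derive1 phi x) = - pint p (fun x => g x * phi x)].

(* H^1(R/pZ) = W^{1,2}(R/pZ), each class being represented by its unique
   continuous element, so that pointwise values make sense. *)
Definition H1 p f : Prop :=
  [/\ continuous f, periodic f p & exists g, weak_derivative p f g].

(* A chosen weak derivative, unique up to equality almost everywhere; it is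
   only used under integrals. *)
Definition wderiv p f : R -> R :=
  xget (fun=> 0) [set g | weak_derivative p f g].

(* ||f||^2 and the mean of f over [0, 1] *)
Definition normsq f : R := pint 1 (fun x => f x ^+ 2).
Definition mean f : R := pint 1 f.

End Sobolev.

Section Loops.
Context {R : realType}.
Implicit Types (z v : (R -> R) * (R -> R)).

Definition H1_twist : set ((R -> R) * (R -> R)) := [set z |
  [/\ H1 2 z.1, H1 2 z.2,
      forall s, z.1 (s + 1) = z.1 s &
      forall s, z.2 (s + 1) = - z.2 s]].

Definition rho z : (R -> R) * (R -> R) :=
  (fun s => z.1 (1 - s), fun s => z.2 (1 - s)).

Definition H1_sym : set ((R -> R) * (R -> R)) := [set z |
  [/\ H1_twist z, forall s, z.1 s = z.1 (1 - s) &
      forall s, z.2 s = z.2 (1 - s)]].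

(* The integrals are over one period 1, half of the period 2 of a twisted
   loop; f^2 and (f')^2 are 1-periodic for each component f. *)
Definition H1_norm z : R :=
  Num.sqrt (normsq z.1 + normsq (wderiv 2 z.1) +
            normsq z.2 + normsq (wderiv 2 z.2)).

(* The lift R -> R of t_z. One of the two intervals is empty unless s = 0, so
   the difference is the oriented integral from 0 to s. *)
Definition timechange (f : R -> R) (s : R) : R :=
  ((\int[@lebesgue_measure R]_(x in `[0%R, s]) (f x ^+ 2))%R -
   (\int[@lebesgue_measure R]_(x in `[s, 0%R]) (f x ^+ 2))%R) / normsq f.

(* tau_z = t_z^{-1}. When f <> 0 vanishes on an interval, t_f is monotone and
   onto but not injective; f is then 0 on each non-degenerate fibre of t_f, so
   f (tau_f t) ^+ 2 does not depend on the chosen point of the fibre. *)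
Definition invtime (f : R -> R) (t : R) : R :=
  inf [set s | timechange f s = t].

Definition levi_civita z : (R -> R) * (R -> R) :=
  (fun t => z.1 (invtime z.1 t) ^+ 2, fun t => z.2 (invtime z.2 t) ^+ 2).

(* z_1(s)^2 - z_2(tau_{z_2}(t_{z_1}(s)))^2 *)
Definition gap z (s : R) : R :=
  z.1 s ^+ 2 - z.2 (invtime z.2 (timechange z.1 s)) ^+ 2.

Definition Htilde_in : set ((R -> R) * (R -> R)) := [set z |
  [/\ H1_twist z, 0 < normsq z.1, 0 < normsq z.2 & forall s, 0 < gap z s]].

Definition Hhat_in : set ((R -> R) * (R -> R)) := [set z |
  [/\ H1_sym z, 0 < normsq z.1, 0 < normsq z.2 & forall s, 0 < gap z s]].

Definition actQ (f : R -> R) : R :=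
  2 * normsq f * normsq (wderiv 2 f) + 2 / normsq f.

Definition actI z : R :=
  - (1 / normsq z.1) * pint 1 (fun s => z.1 s ^+ 2 / gap z s).

Definition actA z : R :=
  - (normsq z.1 * normsq z.2 /
     (normsq (fun s => z.1 s ^+ 2) * normsq z.2 -
      normsq (fun s => z.2 s ^+ 2) * normsq z.1)).

Definition B_in z : R := actQ z.1 + actQ z.2 + actI z.
Definition B_av z : R := actQ z.1 + actQ z.2 + actA z.
Definition B_act (r : R) z : R := r * B_in z + (1 - r) * B_av z.

(* z is a critical point of F : D -> R, for D an open subset of the linear
   space X with the H^1 norm: F is Frechet differentiable at z with zero
   differential. *)
Definition critical (X D : set ((R -> R) * (R -> R)))
    (F : (R -> R) * (R -> R) -> R) z : Prop :=
  D z /\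
  forall e : R, 0 < e -> exists2 d : R, 0 < d &
    forall v, X v -> D (z + v) -> H1_norm v < d ->
      `|F (z + v) - F z| <= e * H1_norm v.

End Loops.

Section Solutions.
Context {R : realType}.
Implicit Types (q : (R -> R) * (R -> R)) (f : R -> R).

Definition zeroes f : set R := `[0, 1[%classic `&` [set t | f t = 0].

Definition smooth_on (U : set R) f : Prop :=
  forall n t, U t -> derivable (derive1n n f) t 1.

Definition C2_on (U : set R) f : Prop :=
  forall t, U t ->
    [/\ derivable f t 1, derivable (derive1 f) t 1 &
       {for t, continuous (derive1n 2 f)}].

Definition energy_extends f : Prop :=
  exists e : R -> R, [/\ continuous e, periodic e 1 &
    forall t, f t != 0 -> e t = (derive1 f t) ^+ 2 / 2 - 2 / f t].

(* On the regularity: the force on q_1 involves q_2, which behaves like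
   |t - t0|^(2/3) at a zero t0, so for r > 0 no solution has q_1 of class
   C^oo at t0. Hence q_i is C^2 away from its own zeroes, which is what the
   equations need, and C^oo away from the zeroes of both components. *)
Definition generalized_solution (r : R) q : Prop :=
  [/\ [/\ H1 1 q.1, H1 1 q.2, (forall t, 0 <= q.1 t) & forall t, 0 <= q.2 t],
      (forall t, q.2 t < q.1 t),
      finite_set (zeroes q.1) /\ finite_set (zeroes q.2),
      [/\ C2_on [set t | q.1 t != 0] q.1,
          C2_on [set t | q.2 t != 0] q.2,
          smooth_on [set t | q.1 t != 0 /\ q.2 t != 0] q.1 &
          smooth_on [set t | q.1 t != 0 /\ q.2 t != 0] q.2] &
      [/\ (forall t, q.1 t != 0 -> derive1n 2 q.1 t =
             - (2 / q.1 t ^+ 2) + r / (q.1 t - q.2 t) ^+ 2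
             + (1 - r) / (mean q.1 - mean q.2) ^+ 2),
          (forall t, q.2 t != 0 -> derive1n 2 q.2 t =
             - (2 / q.2 t ^+ 2) - r / (q.1 t - q.2 t) ^+ 2
             - (1 - r) / (mean q.1 - mean q.2) ^+ 2),
          energy_extends q.1 & energy_extends q.2]].

Definition symmetric q : Prop :=
  (forall t, q.1 t = q.1 (1 - t)) /\ (forall t, q.2 t = q.2 (1 - t)).

Definition symmetric_frozen_planet (r : R) q : Prop :=
  [/\ generalized_solution r q, symmetric q,
      (exists2 n, ~~ odd n & (zeroes q.1 #= `I_n)%card) &
      (exists2 n, odd n & (zeroes q.2 #= `I_n)%card)].

(* The zeroes of q_2 are exchanged in pairs by t |-> 1 - t, except those at
   the two symmetric times 0 and 1/2; their number being odd, q_2 vanishes at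
   exactly one of these times. A loop z in H^1_sym has z_2 odd, hence
   z_2(0) = 0, and only yields solutions with q_2(0) = 0. The other symmetric
   solutions are brought to this form by a half-period time shift. *)
Definition collision_at_0 q : (R -> R) * (R -> R) :=
  if q.2 0 == 0 then q
  else (fun t => q.1 (t + 2^-1), fun t => q.2 (t + 2^-1)).

End Solutions.

(* Main.v *)
Require Import Defs.
From HB Require Import structures.
From mathcomp Require Import all_boot all_order all_algebra.
From mathcomp Require Import all_classical all_reals all_analysis.
From mathcomp Require Import measurable_realfun ring lra.
Import Order.TTheory GRing.Theory Num.Theory.
Import numFieldNormedType.Exports.
Local Open Scope classical_set_scope.
Local Open Scope ring_scope.

(** Why the correspondence holds.

    For a component f of a loop put N = normsq f, T = timechange f and
    q = lc f, its Levi-Civita transform, characterised by q (T s) = f s ^+ 2.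

    - Invariance.  The two interaction terms depend on a loop only through the
      transforms: they are - int (q1 - q2)^-1 and - (mean q1 - mean q2)^-1
      ([B_interaction]).  Reversing a loop reverses its transforms, and none of
      these quantities sees the direction of time ([rho_invariant]).

    - Differentiability.  T may have flat pieces, so q is not a smooth function
      of f.  It has however the modulus of continuity
      (q t - q t') ^+ 2 = o(`|t - t'|) ([osc_modulus]): a primitive of f f' over
      a short interval is controlled by the integral of f ^+ 2, which is the
      increment of T, times the small energy of f on that interval.  A variation
      of size nu moves T by O(nu), hence q by o(sqrt nu) uniformly, and the
      quadratic remainder of the interaction is o(nu).  The linear term is the
      variation of int (q K), where K is the force of the unperturbed loop;
      after an integration by parts in the loop parameter it is differentiable
      ([lc_integral_vary]).  So the action is Frechet differentiable
      ([B_frechet]) and critical points are the zeros of [Bdiff]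
      ([critical_Bdiff]).

    - Euler-Lagrange equation.  On a component the differential is
      4 N <f', v'> + <v, f c> with a continuous coefficient c.  For a symmetric
      loop c is even and periodic, so 4 N f minus a second primitive of f c is an
      admissible variation; testing with it gives 4 N f'' = f c
      ([component_equation]).  Conversely the equation annihilates all twisted
      variations, because the boundary terms at 0 and 1 cancel
      ([kepler_vform]).  This is the principle of symmetric criticality, whence
      [fixed_critical].

    - From critical points to orbits.  The coefficient c contains the work W of
      the force, and the equation can be written
      f'' = f (E + eps f ^+ 2 K) / (2 N ^+ 2) with E' the power of the force.
      Then 2 N ^+ 2 f' ^+ 2 - 2 - E f ^+ 2 is constant and has integral 0, hence
      vanishes ([kepler_of_equation]).  At a collision this reads
      f' ^+ 2 = N ^- 2: collisions are transversal, therefore isolated, T is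
      strictly increasing, and away from collisions q solves the Newton equation
      with energy E, which is continuous through collisions.  The involution
      t |-> 1 - t pairs the zeroes of q_2 except those at 0 and 1/2; z_2
      vanishes at 0 and cannot vanish at 1/2, where its derivative does
      ([critical_solution]).

    - From orbits to critical points.  Since q' is square integrable and
      q' ^+ 2 = 2 e + 4 / q, the function 1 / q is integrable
      ([Lloc_inv_orbit]); T is recovered as the inverse of its normalised
      primitive ([lift_time]).  The function +- sqrt (q o T), with a sign that
      changes at every collision, is C^1 through the collisions and satisfies
      the system above ([lift_kepler]).

    - Uniqueness.  Two C^1 functions with the same square and transversal zeroes
      differ by a constant sign ([square_root_unique]).  Applied to z and its
      reflection and translate this shows that the lift is symmetric and
      correctly twisted ([newton_lift]); applied to two lifts of q it shows that
      the critical points over q are (+- z_1, +- z_2) ([four_lifts]). *)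

Set Implicit Arguments.
Unset Strict Implicit.
Unset Printing Implicit Defensive.

(** * Limits and derivatives in epsilon-delta form *)

Section EpsilonDelta.
Context {R : realType}.
Implicit Types (f : R -> R) (x y l e d h : R).

Lemma contP f x : {for x, continuous f} <->
  forall e, 0 < e -> exists2 d : R, 0 < d & forall y, `|y - x| < d -> `|f y - f x| < e.
Proof.
split=> [/cvgrPdist_lt cf e /cf/nbhs_ballP[d /= d0 hd]|h].
  by exists d => // y yx; rewrite distrC; apply: hd; rewrite /ball /= distrC.
apply/cvgrPdist_lt => e /h[d d0 hd]; apply/nbhs_ballP; exists d => // y.
by rewrite /ball /= distrC => /hd; rewrite distrC.
Qed.

Lemma is_deriveP f x l : is_derive x 1 f l <->
  forall e, 0 < e -> exists2 d : R, 0 < d & forall h, `|h| < d ->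
    `|f (x + h) - f x - l * h| <= e * `|h|.
Proof.
have quot e h : h != 0 -> (`|l - h^-1 *: (f (h *: 1 + x) - f x)| <= e) =
    (`|f (x + h) - f x - l * h| <= e * `|h|).
  move=> h0; rewrite -[RHS](ler_pM2r (_ : 0 < `|h|^-1)) ?invr_gt0 ?normr_gt0 //.
  rewrite mulfK ?normr_eq0 // -normfV -normrM distrC; congr (`|_| <= _).
  by rewrite -[h *: 1]/(h * 1) mulr1 (addrC h) -[_ *: _]/(h^-1 * _); field.
split=> [df e e0|hf].
  have : h^-1 *: (f (h *: 1 + x) - f x) @[h --> 0^'] --> l.
    by have := @ex_derive _ _ _ _ _ _ _ df; have <- := @derive_val _ _ _ _ _ _ _ df.
  move=> /cvgrPdist_le/(_ _ e0)/nbhs_ballP[d /= d0 hd].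
  exists d => // h hd'; have [->|h0] := eqVneq h 0.
    by rewrite addr0 mulr0 !subrr normr0 mulr0.
  by rewrite -quot //; apply: hd => //; rewrite /ball /= sub0r normrN.
have cvl : h^-1 *: (f (h *: 1 + x) - f x) @[h --> 0^'] --> l.
  apply/cvgrPdist_le => e /hf[d d0 hd]; apply/nbhs_ballP; exists d => // h /=.
  by rewrite /ball /= sub0r normrN => hd' h0; rewrite quot //; exact: hd.
apply: DeriveDef; first by apply/cvg_ex; exists l.
by apply: cvg_lim => //; exact: Rhausdorff.
Qed.

Lemma between_norm a b y : Num.min a b <= y <= Num.max a b -> `|y - a| <= `|b - a|.
Proof.
have [ab|/ltW ba] := leP a b => /andP[ay yb].
  by rewrite !ger0_norm ?subr_ge0 ?lerD2r.
by rewrite !ler0_norm ?subr_le0 // lerN2 lerD2r.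
Qed.

End EpsilonDelta.

(** * The oriented Lebesgue integral *)

Section OrientedIntegral.
Context {R : realType}.
Local Notation mu := (@lebesgue_measure R).
Implicit Types (f g h : R -> R) (a b c x y k M e : R).

(** Unlike the integral over `[a, b], this satisfies Chasles' relation for all a, b, and
    [timechange] is defined by it. *)
Definition oint g a b : R :=
  (\int[mu]_(x in `[a, b]) g x)%R - (\int[mu]_(x in `[b, a]) g x)%R.

(** Locally integrable functions: the periodic data are integrated over all intervals. *)
Definition Lloc g := forall a b, mu.-integrable `[a, b] (EFin \o g).

Lemma int_itv_gt g a b : b < a -> (\int[mu]_(x in `[a, b]) g x)%R = 0.
Proof. by move=> ab; rewrite set_itv_ge ?Rintegral_set0 // -leNgt bnd_simp. Qed.

Lemma ointE g a b : a <= b -> oint g a b = (\int[mu]_(x in `[a, b]) g x)%R.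
Proof.
rewrite /oint le_eqVlt => /predU1P[->|ab]; last by rewrite (int_itv_gt _ ab) subr0.
by rewrite set_itv1 Rintegral_set1 subr0.
Qed.

Lemma oint_sym g a b : oint g a b = - oint g b a.
Proof. by rewrite /oint opprB. Qed.

Lemma oint_id g a : oint g a a = 0.
Proof. by rewrite /oint subrr. Qed.

Lemma pintE p g : 0 <= p -> pint p g = oint g 0 p.
Proof. by move=> p0; rewrite ointE. Qed.

Let chasles_le g a b c : Lloc g -> a <= b -> b <= c ->
  oint g a b + oint g b c = oint g a c.
Proof.
move=> ig ab bc; rewrite !ointE //; last exact: le_trans bc.
have := @Rintegral_itvB R g (BLeft a) (BRight c) b (ig a c).
rewrite !bnd_simp => /(_ ab bc) e.
have e2 : (\int[mu]_(x in `]b, c]) g x)%R = (\int[mu]_(x in `[b, c]) g x)%R.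
  rewrite -(@Rintegral_itv_obnd_cbnd R b (BRight c) g) //.
  by apply: integrableS (ig b c) => //; exact: subset_itv_oc_cc.
by rewrite -e2 -e addrC subrK.
Qed.

Let oint_base g a b d : Lloc g -> d <= a -> d <= b ->
  oint g a b = oint g d b - oint g d a.
Proof.
move=> ig da db; have [ab|/ltW ba] := leP a b.
  by rewrite -(chasles_le ig da ab) addrC addKr.
by rewrite (oint_sym g a b) -(chasles_le ig db ba); ring.
Qed.

Lemma oint_chasles g a b c : Lloc g -> oint g a b + oint g b c = oint g a c.
Proof.
move=> ig; pose d := Num.min a (Num.min b c).
have [da db dc] : [/\ d <= a, d <= b & d <= c].
  by rewrite /d !ge_min !lexx !orbT.
by rewrite (oint_base ig da db) (oint_base ig db dc) (oint_base ig da dc); ring.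
Qed.

Lemma Lloc_meas g : Lloc g -> measurable_fun setT g.
Proof.
move=> ig; have -> : [set: R] = \bigcup_(n : nat) `[- n%:R, n%:R]%classic.
  apply/esym; rewrite -subTset => x _.
  exists (Num.truncn `|x|).+1 => //=; rewrite in_itv /= -ler_norml ltW //.
  exact: truncnS_gt.
apply/measurable_fun_bigcup => // n.
by have /integrableP[/measurable_EFinP] := ig (- n%:R) n%:R.
Qed.

Lemma continuous_Lloc g : continuous g -> Lloc g.
Proof.
move=> cg a b; apply: continuous_compact_integrable; first exact: segment_compact.
by apply: continuous_subspaceT.
Qed.

Lemma LlocD f g : Lloc f -> Lloc g -> Lloc (fun x => f x + g x).
Proof.
move=> lf lg a b.
by have := @integrableD _ _ _ mu _ (measurable_itv `[a, b]) _ _ (lf a b) (lg a b).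
Qed.

Lemma LlocB f g : Lloc f -> Lloc g -> Lloc (fun x => f x - g x).
Proof.
move=> lf lg a b.
by have := @integrableB _ _ _ mu _ (measurable_itv `[a, b]) _ _ (lf a b) (lg a b).
Qed.

Lemma LlocZ k f : Lloc f -> Lloc (fun x => k * f x).
Proof. by move=> lf a b; apply: (integrableZl _ k (lf a b)). Qed.

Lemma LlocN f : Lloc f -> Lloc (fun x => - f x).
Proof. by move=> /(LlocZ (-1)); under eq_fun do rewrite mulN1r. Qed.

Lemma Lloc_abs f : Lloc f -> Lloc (fun x => `|f x|).
Proof. by move=> lf a b; have := integrable_abse (lf a b). Qed.

Lemma Lloc_le f g : measurable_fun setT f -> Lloc g ->
  (forall x, `|f x| <= g x) -> Lloc f.
Proof.
move=> mf lg fg a b; apply: (le_integrable _ _ _ (lg a b)) => //.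
  by apply/measurable_EFinP; exact: measurable_funTS.
by move=> x _ /=; rewrite lee_fin (le_trans (fg x)) // ler_norm.
Qed.

Lemma ointD f g a b : Lloc f -> Lloc g ->
  oint (fun x => f x + g x) a b = oint f a b + oint g a b.
Proof. by move=> lf lg; rewrite /oint !RintegralD //; ring. Qed.

Lemma ointB f g a b : Lloc f -> Lloc g ->
  oint (fun x => f x - g x) a b = oint f a b - oint g a b.
Proof. by move=> lf lg; rewrite /oint !RintegralB //; ring. Qed.

Lemma ointZ k f a b : Lloc f -> oint (fun x => k * f x) a b = k * oint f a b.
Proof. by move=> lf; rewrite /oint !RintegralZl //; ring. Qed.

Lemma ointN f a b : Lloc f -> oint (fun x => - f x) a b = - oint f a b.
Proof.
by move=> lf; rewrite -mulN1r -ointZ //; congr oint; apply/funext => x; rewrite mulN1r.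
Qed.

Lemma oint_cst k a b : oint (fun=> k) a b = k * (b - a).
Proof.
have cst_le x y : x <= y -> oint (fun=> k) x y = k * (y - x).
  move=> xy; rewrite ointE // Rintegral_cst //= lebesgue_measure_itv /= lte_fin.
  by move: xy; rewrite le_eqVlt => /predU1P[->|->]; rewrite ?ltxx ?subrr.
by have [/cst_le//|/ltW/cst_le e] := leP a b; rewrite oint_sym e; ring.
Qed.

Lemma le_oint f g a b : a <= b -> Lloc f -> Lloc g ->
  (forall x, a <= x <= b -> f x <= g x) -> oint f a b <= oint g a b.
Proof.
by move=> ab lf lg fg; rewrite !ointE //; apply: le_Rintegral => // x /=; rewrite in_itv /= => /fg.
Qed.

Lemma oint_ge0 f a b : a <= b -> (forall x, a <= x <= b -> 0 <= f x) ->
  0 <= oint f a b.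
Proof.
by move=> ab f0; rewrite ointE //; apply: Rintegral_ge0 => x /=; rewrite in_itv /= => /f0.
Qed.

Lemma le_norm_oint f a b : a <= b -> Lloc f ->
  `|oint f a b| <= oint (fun x => `|f x|) a b.
Proof. by move=> ab lf; rewrite !ointE //; apply: le_normr_Rintegral. Qed.

Lemma oint_bound f M a b : Lloc f ->
  (forall x, Num.min a b <= x <= Num.max a b -> `|f x| <= M) ->
  `|oint f a b| <= M * `|b - a|.
Proof.
move=> lf; wlog ab : a b / a <= b => [hw|].
  move=> fM; have [ab|/ltW ba] := leP a b; first exact: (hw a b).
  rewrite oint_sym normrN (distrC b a); apply: (hw b a) => // x.
  by rewrite minC maxC; exact: fM.
rewrite (min_idPl ab) (max_idPr ab) => fM.
rewrite (le_trans (le_norm_oint ab lf)) // ger0_norm ?subr_ge0 // -oint_cst.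
apply: le_oint => //; first exact: Lloc_abs.
by apply: continuous_Lloc => x; exact: cvg_cst.
Qed.

Lemma oint_continuous g a : Lloc g -> continuous (oint g a).
Proof.
move=> lg x; pose u := x - 1; pose v := x + 1.
have uv : u < v by rewrite /u /v; lra.
have xuv : x \in `]u, v[ by rewrite in_itv /= /u /v; apply/andP; split; lra.
have /(within_continuous_continuous uv)/(_ xuv)/contP h :=
  parameterized_integral_continuous (ltW uv) (lg u v).
apply/contP => e /h[d d0 {}h]; exists (Num.min d 1).
  by rewrite lt_min d0 ltr01.
move=> t; rewrite lt_min => /andP[td t1].
rewrite -(oint_chasles a u x lg) -(oint_chasles a u t lg) opprD addrACA subrr add0r.
have ut : u <= t by move: t1; rewrite ltr_norml /u => /andP[? _]; lra.
rewrite !ointE //; last by rewrite /u; lra.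
exact: h.
Qed.

Lemma oint_derive g a x : Lloc g -> {for x, continuous g} ->
  is_derive x 1 (oint g a) (g x).
Proof.
move=> lg /contP cx; apply/is_deriveP => e e0.
have [d d0 hd] := cx _ e0; exists d => // h hd'.
rewrite -(oint_chasles a x (x + h) lg) [oint g a x + _]addrC addrK.
have -> : g x * h = oint (fun=> g x) x (x + h) by rewrite oint_cst; ring.
have lc : Lloc (fun=> g x) by apply: continuous_Lloc => y; exact: cvg_cst.
rewrite -ointB //.
have {2}-> : h = (x + h) - x by ring.
apply: oint_bound; first exact: LlocB.
move=> y hy; apply/ltW/hd; apply: le_lt_trans hd'.
by have := between_norm hy; rewrite addrAC subrr add0r.
Qed.

Lemma oint_FTC f F a b : continuous f -> (forall x, is_derive x 1 F (f x)) ->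
  oint f a b = F b - F a.
Proof.
move=> cf dF.
have d0 x : is_derive x 1 (F - oint f a) 0.
  rewrite -[0](subrr (f x)); apply: is_deriveB.
  by apply: oint_derive; [exact: continuous_Lloc|exact: cf].
have := is_derive_0_is_cst b a d0.
by rewrite /= !fctE oint_id subr0 => e; lra.
Qed.

End OrientedIntegral.

Section Transport.
Context {R : realType}.
Local Notation mu := (@lebesgue_measure R).
Implicit Types (f g h : R -> R) (a b c x y k M e : R).

(** Real induction: with transitivity, a property of pairs that holds around every
    point propagates to [a, b], by the supremum of the points reached from a. *)
Lemma cousin (P : R -> R -> Prop) a b : a <= b ->
  (forall x y z, x <= y -> y <= z -> P x y -> P y z -> P x z) ->
  (forall x, exists2 d : R, 0 < d &
     forall u v, x - d < u -> u <= x -> x <= v -> v < x + d -> P u v) ->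
  P a b.
Proof.
move=> ab tr loc; pose E := [set y | a <= y <= b /\ P a y].
have Ea : E a.
  have [d d0 h] := loc a; split; first by rewrite lexx.
  by apply: h => //; lra.
have hE : has_sup E.
  by split; [exists a|exists b => y [/andP[]]].
have sb : sup E <= b by apply: ge_sup; [exists a|move=> y [/andP[]]].
have sa : a <= sup E by apply: ub_le_sup => //; case: hE.
have [d d0 h] := loc (sup E).
have [y [/andP[ay yb] Pay] sy] := sup_adherent d0 hE.
have ys : y <= sup E by apply: ub_le_sup; [case: hE|split => //; rewrite ay].
pose s' := Num.min b (sup E + d / 2).
have ss' : sup E <= s' by rewrite /s' le_min sb; lra.
have s'd : s' < sup E + d by rewrite /s' gt_min; apply/orP; right; lra.
have Pas' : P a s' by apply: (tr a y s') => //; [exact: le_trans ys ss'|exact: h].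
have : s' <= sup E.
  apply: ub_le_sup; [by case: hE|split => //].
  by rewrite (le_trans sa ss') /s' ge_min lexx.
rewrite /s' ge_min => /orP[bs|]; last by move=> ?; lra.
suff <- : s' = b by [].
by apply/le_anti; rewrite {1}/s' ge_min lexx (le_trans bs ss').
Qed.

(** Change of variable along a measure preserving map, used for t |-> - t and
    t |-> t + c. *)
Lemma transport (phi : R -> R) (D : set R) g :
  measurable_fun setT phi ->
  (forall A, measurable A -> mu (phi @^-1` A) = mu A) ->
  measurable D -> measurable_fun setT g -> mu.-integrable D (EFin \o g) ->
  mu.-integrable (phi @^-1` D) (EFin \o (g \o phi)) /\
  (\int[mu]_(x in phi @^-1` D) g (phi x))%R = (\int[mu]_(x in D) g x)%R.
Proof.
move=> mphi pres mD mg ig.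
have mg' : measurable_fun setT (EFin \o g) by apply/measurable_EFinP.
pose psi : measurableTypeR R -> measurableTypeR R := phi.
have mpsi : measurable_fun setT psi by exact: mphi.
pose nu : {measure set (measurableTypeR R) -> \bar R} :=
  measure_function_pushforward__canonical__measure_function_Measure mu mpsi.
have eqI (h : measurableTypeR R -> \bar R) :
    (\int[pushforward mu psi]_(x in D) h x = \int[mu]_(x in D) h x)%E.
  by have /= := @eq_measure_integral _ (measurableTypeR R) R D mu nu h; apply => B mB _; exact: pres.
have ig' : mu.-integrable (phi @^-1` D) (EFin \o (g \o phi)).
  apply/integrableP; split.
    apply/measurable_EFinP; apply: measurable_funTS.
    exact: measurableT_comp.
  have mgn : measurable_fun D (fun y : measurableTypeR R => `|(EFin \o g) y|)%E.
    by apply: measurable_funTS; exact: measurableT_comp.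
  have e := ge0_integral_pushforward mpsi mu mD mgn (fun _ _ => abse_ge0 _).
  by have /integrableP[_] := ig; rewrite -eqI e.
split => //; rewrite /Rintegral; congr fine.
have e := @integral_pushforward _ _ _ _ _ _ mpsi mu D _ mg' ig' mD.
by rewrite -[RHS]eqI e.
Qed.

Lemma lebesgue_opp A : measurable A -> mu ((-%R : R -> R) @^-1` A) = mu A.
Proof.
move=> mA; have mo : measurable_fun setT (-%R : measurableTypeR R -> measurableTypeR R) by exact: oppr_measurable.
pose X : {mfun measurableTypeR R >-> measurableTypeR R} := HB.pack (-%R : measurableTypeR R -> measurableTypeR R) (isMeasurableFun.Build _ _ _ _ _ mo).
have := @lebesgue_measure_unique R (pushforward mu X); move=> h; apply/esym/h => //.
move=> B [[a b] _ <-]; transitivity (mu `[-b, -a[%classic); last first.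
  rewrite /pushforward; congr (mu _).
  by apply/seteqP; split => x /=; rewrite !in_itv /=; lra.
by rewrite !lebesgue_measure_itv /= !lte_fin ltrN2; case: ifP => // _; congr (_%:E); lra.
Qed.

Lemma lebesgue_shift c A : measurable A -> mu ((fun x : R => x + c) @^-1` A) = mu A.
Proof.
move=> mA; have mo : measurable_fun setT (fun x : measurableTypeR R => (x + c : measurableTypeR R)) by apply: measurable_funD.
pose X : {mfun measurableTypeR R >-> measurableTypeR R} := HB.pack (fun x : measurableTypeR R => (x + c : measurableTypeR R)) (isMeasurableFun.Build _ _ _ _ _ mo).
have := @lebesgue_measure_unique R (pushforward mu X); move=> h; apply/esym/h => //.
move=> B [[a b] _ <-]; transitivity (mu `]a - c, b - c]%classic); last first.
  rewrite /pushforward; congr (mu _).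
  by apply/seteqP; split => x /=; rewrite !in_itv /=; lra.
by rewrite !lebesgue_measure_itv /= !lte_fin ltrD2r; case: ifP => // _; congr (_%:E); lra.
Qed.

Lemma Lloc_opp g : Lloc g -> Lloc (fun x => g (- x)).
Proof.
move=> lg a b; have := transport (phi := -%R) (@oppr_measurable R setT) lebesgue_opp (measurable_itv `[-b, -a]) (Lloc_meas lg) (lg _ _).
have -> : (-%R : R -> R) @^-1` `[-b, -a]%classic = `[a, b]%classic.
  by apply/seteqP; split => x /=; rewrite !in_itv /=; lra.
by case.
Qed.

Lemma oint_opp g a b : Lloc g -> oint (fun x => g (- x)) a b = oint g (- b) (- a).
Proof.
move=> lg; suff h u v : (\int[mu]_(x in `[u, v]) g (- x))%R = (\int[mu]_(x in `[-v, -u]) g x)%R.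
  by rewrite /oint !h.
have := transport (phi := -%R) (@oppr_measurable R setT) lebesgue_opp (measurable_itv `[-v, -u]) (Lloc_meas lg) (lg _ _).
have -> : (-%R : R -> R) @^-1` `[-v, -u]%classic = `[u, v]%classic.
  by apply/seteqP; split => x /=; rewrite !in_itv /=; lra.
by case.
Qed.

Lemma Lloc_shift c g : Lloc g -> Lloc (fun x => g (x + c)).
Proof.
move=> lg a b; have ms : measurable_fun setT (fun x : R => x + c) by apply: measurable_funD.
have := transport ms (@lebesgue_shift c) (measurable_itv `[a + c, b + c]) (Lloc_meas lg) (lg _ _).
have -> : (fun x : R => x + c) @^-1` `[a + c, b + c]%classic = `[a, b]%classic.
  by apply/seteqP; split => x /=; rewrite !in_itv /=; lra.
by case.
Qed.

Lemma oint_shift c g a b : Lloc g -> oint (fun x => g (x + c)) a b = oint g (a + c) (b + c).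
Proof.
move=> lg; have ms : measurable_fun setT (fun x : R => x + c) by apply: measurable_funD.
suff h u v : (\int[mu]_(x in `[u, v]) g (x + c))%R = (\int[mu]_(x in `[u + c, v + c]) g x)%R.
  by rewrite /oint !h.
have := transport ms (@lebesgue_shift c) (measurable_itv `[u + c, v + c]) (Lloc_meas lg) (lg _ _).
have -> : (fun x : R => x + c) @^-1` `[u + c, v + c]%classic = `[u, v]%classic.
  by apply/seteqP; split => x /=; rewrite !in_itv /=; lra.
by case.
Qed.

Lemma Lloc_refl c g : Lloc g -> Lloc (fun x => g (c - x)).
Proof. by move=> /(Lloc_shift c)/Lloc_opp; under eq_fun do rewrite addrC. Qed.

Lemma oint_refl c g a b : Lloc g -> oint (fun x => g (c - x)) a b = oint g (c - b) (c - a).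
Proof.
move=> lg; have := oint_opp a b (Lloc_shift c lg); rewrite oint_shift // ![- _ + c]addrC => <-.
by congr oint; apply/funext => x; rewrite addrC.
Qed.

Lemma oint_period p g a b : Lloc g -> (forall x, g (x + p) = g x) ->
  oint g a (a + p) = oint g b (b + p).
Proof.
move=> lg gp; have := oint_shift p a b lg; under eq_fun do rewrite gp.
rewrite -(oint_chasles a b (a + p) lg) => ->; rewrite -(oint_chasles b (a + p) (b + p) lg); ring.
Qed.


Lemma Lloc_locally g : Lloc g -> locally_integrable setT g.
Proof.
move=> lg; split; [exact: Lloc_meas|exact: openT|move=> K _ cK].
have [M [Mr hM]] := compact_bounded cK.
have KM : K `<=` `[- (M + 1), M + 1]%classic.
  by move=> x Kx /=; rewrite in_itv /= -ler_norml; apply: hM => //; lra.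
have mK : measurable K by apply: closed_measurable; exact: compact_closed.
have /integrableP[_] := lg (- (M + 1)) (M + 1).
apply: le_lt_trans; apply: ge0_subset_integral => //.
by apply/measurable_EFinP; apply: measurable_funTS; apply: measurableT_comp => //; exact: Lloc_meas.
Qed.

(** By Lebesgue differentiation. *)
Lemma Lloc_ae0 g a b : Lloc g -> (forall x y, oint g x y = 0) ->
  ae_eq mu (`[a, b]%classic : set R) g (cst 0).
Proof.
move=> lg g0; have := @FTC1 R g (BLeft (a - 1)) (fun y => lg _ y) (Lloc_locally lg).
apply: filterS; first exact: (ae_filter_ringOfSetsType mu).
move=> x + /=; rewrite in_itv /= => + /andP[ax xb].
have aax : ((a - 1)%:E < x%:E)%E by rewrite lte_fin; lra.
move=> /(_ aax)[_ <-].
have -> : (fun y => (\int[mu]_(t in `[(a - 1), y]) g t)%R) = cst 0.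
  apply/funext => y; have [ay|ya] := leP (a - 1) y; last exact: int_itv_gt.
  by rewrite -ointE.
by rewrite derive1_cst.
Qed.

Lemma oint_ae0 g h a b : Lloc g -> measurable_fun setT h ->
  (forall x y, oint g x y = 0) -> oint (fun x => g x * h x) a b = 0.
Proof.
move=> lg mh g0; have gg u v : (\int[mu]_(x in `[u, v]) (g x * h x))%R = 0.
  rewrite /Rintegral (ae_eq_integral (fun=> 0%E)) ?integral0 //.
    apply/measurable_EFinP; apply: measurable_funTS; apply: measurable_funM => //.
    exact: Lloc_meas.
  have := Lloc_ae0 u v lg g0.
  apply: (@filterS _ _ (ae_filter_ringOfSetsType mu)).
  by move=> x hx /hx /= ->; rewrite mul0r.
by rewrite /oint !gg subrr.
Qed.

Definition L2 g := measurable_fun setT g /\ Lloc (fun x => g x ^+ 2).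

Lemma continuous_meas g : continuous g -> measurable_fun setT g.
Proof. by move=> /continuous_Lloc/Lloc_meas. Qed.

Lemma contM f g : continuous f -> continuous g -> continuous (fun x => f x * g x).
Proof. by move=> cf cg x; apply: cvgM; [exact: cf|exact: cg]. Qed.

Lemma contD f g : continuous f -> continuous g -> continuous (fun x => f x + g x).
Proof. by move=> cf cg x; apply: cvgD; [exact: cf|exact: cg]. Qed.

Lemma contN f : continuous f -> continuous (fun x => - f x).
Proof. by move=> cf x; apply: cvgN; exact: cf. Qed.

Lemma contB f g : continuous f -> continuous g -> continuous (fun x => f x - g x).
Proof. by move=> cf cg; apply: contD => //; exact: contN. Qed.

Lemma cst_cont k : continuous (fun _ : R => k).
Proof. by move=> x; exact: cvg_cst. Qed.

Lemma id_cont : continuous (fun x : R => x).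
Proof. by move=> x; exact: cvg_id. Qed.

Lemma contZ k f : continuous f -> continuous (fun x => k * f x).
Proof. by move=> cf; apply: contM => //; exact: cst_cont. Qed.

Lemma cont_sqr f : continuous f -> continuous (fun x => f x ^+ 2).
Proof. by move=> cf; under eq_fun do rewrite expr2; exact: contM. Qed.

Lemma cont_comp f g : continuous f -> continuous g -> continuous (fun x => f (g x)).
Proof. by move=> cf cg x; apply: (@continuous_comp _ _ _ g f); [exact: cg|exact: cf]. Qed.

Lemma contV f : continuous f -> (forall x, f x != 0) -> continuous (fun x => (f x)^-1).
Proof. by move=> cf f0 x; apply: cvgV; [exact: f0|exact: cf]. Qed.

Lemma cont_bound f a b : continuous f -> exists2 M : R, 0 <= M & forall x, a <= x <= b -> `|f x| <= M.
Proof.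
move=> cf; have [ab|ba] := leP a b; last first.
  by exists 0 => // x /andP[ax xb]; have := le_lt_trans (le_trans ax xb) ba; rewrite ltxx.
have cn : continuous (fun x => `|f x|) by move=> x; apply: cvg_norm; exact: cf.
have [c _ hc] := EVT_max ab (continuous_subspaceT cn).
by exists `|f c| => // x xab; apply: hc; rewrite in_itv.
Qed.

Lemma Lloc_contM f g : continuous f -> Lloc g -> Lloc (fun x => f x * g x).
Proof.
move=> cf lg a b; have [M M0 hM] := cont_bound a b cf.
have mfg : measurable_fun setT (fun x => f x * g x).
  by apply: measurable_funM; [exact: continuous_meas|exact: Lloc_meas].
apply: (@le_integrable _ _ _ mu _ (measurable_itv `[a, b]) _ (EFin \o (fun x => M * g x))).
- by apply/measurable_EFinP; apply: measurable_funTS.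
- move=> x /=; rewrite in_itv /= => /hM fM; rewrite lee_fin !normrM (ger0_norm M0).
  by apply: ler_wpM2r.
- by apply: LlocZ.
Qed.

Lemma L2_cont f : continuous f -> L2 f.
Proof.
move=> cf; split; first exact: continuous_meas.
by apply: continuous_Lloc; exact: cont_sqr.
Qed.

Lemma L2M f g : L2 f -> L2 g -> Lloc (fun x => f x * g x).
Proof.
move=> [mf lf] [mg lg]; apply: (Lloc_le _ (LlocD lf lg)).
  exact: measurable_funM.
move=> x; rewrite normrM -[f x ^+ 2]real_normK ?num_real // -[g x ^+ 2]real_normK ?num_real //.
by have := sqr_ge0 (`|f x| - `|g x|); have := normr_ge0 (f x); have := normr_ge0 (g x); nra.
Qed.

Lemma L2_Lloc f : L2 f -> Lloc f.
Proof.
by move=> l2; have := L2M l2 (L2_cont (@cst_cont 1)); under eq_fun do rewrite mulr1.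
Qed.

Lemma L2D f g : L2 f -> L2 g -> L2 (fun x => f x + g x).
Proof.
move=> l2f l2g; split; first by apply: measurable_funD; [case: l2f|case: l2g].
have -> : (fun x => (f x + g x) ^+ 2) = (fun x => (f x ^+ 2 + 2 * (f x * g x)) + g x ^+ 2).
  by apply/funext => x; ring.
apply: LlocD; last by case: l2g.
by apply: LlocD; [case: l2f|apply: LlocZ; exact: L2M].
Qed.

Lemma L2_contM f g : continuous f -> L2 g -> L2 (fun x => f x * g x).
Proof.
move=> cf [mg lg]; split; first by apply: measurable_funM => //; exact: continuous_meas.
have -> : (fun x => (f x * g x) ^+ 2) = (fun x => f x ^+ 2 * g x ^+ 2).
  by apply/funext => x; ring.
by apply: Lloc_contM => //; exact: cont_sqr.
Qed.

Lemma L2Z k g : L2 g -> L2 (fun x => k * g x).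
Proof. by move=> lg; apply: L2_contM => //; exact: cst_cont. Qed.

Lemma L2B f g : L2 f -> L2 g -> L2 (fun x => f x - g x).
Proof.
by move=> lf /(L2Z (-1)); under eq_fun do rewrite mulN1r; exact: L2D.
Qed.

Lemma L2_refl c g : L2 g -> L2 (fun x => g (c - x)).
Proof.
move=> [mg lg]; split; last exact: (Lloc_refl c lg).
by apply: (@measurableT_comp _ _ _ _ _ _ g _ (fun x => c - x)) => //; apply: measurable_funB.
Qed.

Lemma quad_disc (A B C : R) : 0 <= A ->
  (forall t, 0 <= A * t ^+ 2 + 2 * B * t + C) -> B ^+ 2 <= A * C.
Proof.
rewrite le_eqVlt => /predU1P[<- h|A0 h].
  have [->|B0] := eqVneq B 0; first by rewrite expr0n mul0r.
  have := h (- (C + 1) / (2 * B)).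
  suff -> : 0 * (- (C + 1) / (2 * B)) ^+ 2 + 2 * B * (- (C + 1) / (2 * B)) + C = -1 by lra.
  by field.
have := h (- B / A); have -> : A * (- B / A) ^+ 2 + 2 * B * (- B / A) + C = (A * C - B ^+ 2) / A.
  by field; rewrite gt_eqF.
by rewrite pmulr_lge0 ?invr_gt0 // subr_ge0.
Qed.

(** The discriminant of t |-> int (t f + g) ^+ 2 is nonpositive. *)
Lemma CS f g a b : a <= b -> L2 f -> L2 g ->
  oint (fun x => f x * g x) a b ^+ 2 <= oint (fun x => f x ^+ 2) a b * oint (fun x => g x ^+ 2) a b.
Proof.
move=> ab l2f l2g; apply: quad_disc => [|t].
  by apply: oint_ge0 => // x _; exact: sqr_ge0.
have -> : oint (fun x => f x ^+ 2) a b * t ^+ 2 + 2 * oint (fun x => f x * g x) a b * t +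
   oint (fun x => g x ^+ 2) a b = oint (fun x => (t * f x + g x) ^+ 2) a b.
  have -> : (fun x => (t * f x + g x) ^+ 2) =
     (fun x => (t ^+ 2 * f x ^+ 2 + (2 * t) * (f x * g x)) + g x ^+ 2).
    by apply/funext => x; ring.
  rewrite ointD ?ointD ?ointZ; [ring|..].
  all: try (by case: l2f); try (by case: l2g); try exact: L2M.
  - by apply: LlocZ; case: l2f.
  - by apply: LlocZ; exact: L2M.
  - by apply: LlocD; apply: LlocZ; [case: l2f|exact: L2M].
by apply: oint_ge0 => // x _; exact: sqr_ge0.
Qed.

End Transport.

(** * Absolutely continuous functions with square integrable derivative *)

Section AbsolutelyContinuous.
Context {R : realType}.
Local Notation mu := (@lebesgue_measure R).
Implicit Types (f g h F G : R -> R) (a b c x y k M e p : R).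

(** f is an H^1_loc function with weak derivative g. *)
Definition abscont f g := L2 g /\ forall x y, f y - f x = oint g x y.

Lemma AC_cont f g : abscont f g -> continuous f.
Proof.
move=> [l2 fg]; have -> : f = (fun x => f 0 + oint g 0 x).
  by apply/funext => x; rewrite -fg addrC subrK.
by apply: contD; [exact: cst_cont|exact: oint_continuous (L2_Lloc l2)].
Qed.

Lemma derive_cont f g : (forall x, is_derive x 1 f (g x)) -> continuous f.
Proof.
move=> df x; apply: differentiable_continuous; apply/derivable1_diffP.
by have [] := df x.
Qed.

Lemma AC_C1 f g : continuous g -> (forall x, is_derive x 1 f (g x)) -> abscont f g.
Proof. by move=> cg df; split; [exact: L2_cont|move=> x y; rewrite (oint_FTC x y cg df)]. Qed.

Lemma AC_D f g F G : abscont f g -> abscont F G -> abscont (fun x => f x + F x) (fun x => g x + G x).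
Proof.
move=> [l2 fg] [L2' FG]; split; first exact: L2D.
by move=> x y; rewrite ointD -?fg -?FG; [ring|exact: L2_Lloc..].
Qed.

Lemma AC_Z k f g : abscont f g -> abscont (fun x => k * f x) (fun x => k * g x).
Proof.
by move=> [l2 fg]; split; [exact: L2Z|move=> x y; rewrite ointZ -?fg; [ring|exact: L2_Lloc]].
Qed.

Lemma AC_refl c f g : abscont f g -> abscont (fun x => f (c - x)) (fun x => - g (c - x)).
Proof.
move=> [l2 fg]; split.
  by have := L2Z (-1) (L2_refl c l2); under eq_fun do rewrite mulN1r.
move=> x y; have l := L2_Lloc l2.
by rewrite ointN ?oint_refl //; [rewrite -fg; ring|exact: Lloc_refl].
Qed.

Lemma oint_mono f a b u v : Lloc f -> (forall x, 0 <= f x) -> a <= u -> u <= v -> v <= b ->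
  oint f u v <= oint f a b.
Proof.
move=> lf f0 au uv vb; rewrite -(oint_chasles a u b lf) -(oint_chasles u v b lf).
have := oint_ge0 au (fun x _ => f0 x); have := oint_ge0 vb (fun x _ => f0 x); lra.
Qed.

Lemma AC_osc f g x y s : abscont f g -> x <= s -> s <= y ->
  `|f x - f s| <= oint (fun u => `|g u|) x y /\ `|f y - f s| <= oint (fun u => `|g u|) x y.
Proof.
move=> [l2 fg] xs sy; have l := L2_Lloc l2; have la := Lloc_abs l.
split; [rewrite distrC fg|rewrite fg]; apply: (le_trans (le_norm_oint _ l)) => //;
  by apply: oint_mono => // u; exact: normr_ge0.
Qed.

Lemma L2_abs g : L2 g -> L2 (fun x => `|g x|).
Proof.
move=> [mg lg]; split; first exact: measurableT_comp.
by under eq_fun do rewrite real_normK ?num_real //.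
Qed.

Lemma CS_abs g x y : x <= y -> L2 g ->
  oint (fun u => `|g u|) x y ^+ 2 <= (y - x) * oint (fun u => g u ^+ 2) x y.
Proof.
move=> xy l2; have := CS xy (L2_cont (@cst_cont R 1)) (L2_abs l2).
under [in X in X <= _]eq_fun do rewrite mul1r.
rewrite expr1n oint_cst mul1r.
suff -> : (fun u => `|g u| ^+ 2) = (fun u => g u ^+ 2) by [].
by apply/funext => u; rewrite real_normK ?num_real.
Qed.

(** The product rule for square integrable derivatives.  The increment of
    P = f F - int (f G + g F) over [x, y] is an integral of (f x - f s) G s + (F y - F s) g s,
    bounded by (y - x) times the integral of g ^+ 2 + G ^+ 2; so P has derivative 0
    everywhere, although f and F need not be differentiable. *)
Lemma AC_mul f g F G : abscont f g -> abscont F G ->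
  abscont (fun x => f x * F x) (fun x => f x * G x + g x * F x).
Proof.
move=> fg FG; have [l2 efg] := fg; have [L2' eFG] := FG.
have [cf cF] := (AC_cont fg, AC_cont FG).
have l2p : L2 (fun x => f x * G x + g x * F x).
  by apply: L2D; [exact: L2_contM|under eq_fun do rewrite mulrC; exact: L2_contM].
have lp := L2_Lloc l2p; split => //.
pose P x := f x * F x - oint (fun x => f x * G x + g x * F x) 0 x.
pose w x y := oint (fun u => g u ^+ 2 + G u ^+ 2) x y.
have lw : Lloc (fun u => g u ^+ 2 + G u ^+ 2) by apply: LlocD; [case: l2|case: L2'].
have key x y : x <= y -> `|P y - P x| <= (y - x) * w x y.
  move=> xy.
  have -> : P y - P x = oint (fun s => (f x - f s) * G s + (F y - F s) * g s) x y.
    rewrite /P -(oint_chasles 0 x y lp).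
    have -> : oint (fun s => (f x - f s) * G s + (F y - F s) * g s) x y =
       oint (fun s => (f x * G s + F y * g s) - (f s * G s + g s * F s)) x y.
      by congr oint; apply/funext => s; ring.
    have lG := L2_Lloc L2'; have lg := L2_Lloc l2.
    rewrite ointB //; last by apply: LlocD; exact: LlocZ.
    by rewrite (ointD _ _ (LlocZ (f x) lG) (LlocZ (F y) lg)) !ointZ // -efg -eFG; ring.
  pose A := oint (fun u => `|g u|) x y; pose B := oint (fun u => `|G u|) x y.
  have lag := Lloc_abs (L2_Lloc l2); have laG := Lloc_abs (L2_Lloc L2').
  have A0 : 0 <= A by apply: oint_ge0.
  have B0 : 0 <= B by apply: oint_ge0.
  have bnd : `|oint (fun s => (f x - f s) * G s + (F y - F s) * g s) x y| <= A * B + B * A.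
    have l1 : Lloc (fun s => (f x - f s) * G s + (F y - F s) * g s).
      by apply: LlocD; apply: Lloc_contM; try exact: L2_Lloc; apply: contB => //; exact: cst_cont.
    apply: (le_trans (le_norm_oint xy l1)).
    rewrite /A /B -[X in _ <= X + _]ointZ // -[X in _ <= _ + X]ointZ // -ointD; last 2 first.
      exact: LlocZ.
      exact: LlocZ.
    apply: le_oint => //; first exact: Lloc_abs.
      by apply: LlocD; exact: LlocZ.
    move=> s /andP[xs sy]; apply: (le_trans (ler_normD _ _)); rewrite !normrM.
    apply: lerD; apply: ler_wpM2r => //.
      by case: (AC_osc fg xs sy).
    by case: (AC_osc FG xs sy).
  apply: (le_trans bnd).
  have := CS_abs xy l2; have := CS_abs xy L2'; rewrite -/A -/B.
  rewrite /w ointD; [|by case: l2|by case: L2'].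
  by have := sqr_ge0 (A - B); nra.
have dP x : is_derive x 1 P 0.
  apply/is_deriveP => e e0.
  have [d d0 hd] := (contP _ x).1 (oint_continuous (a := x) lw (x := x)) e e0.
  exists d => // h hh; rewrite mul0r subr0.
  have hw : `|w x (x + h)| < e.
    by have := hd (x + h); rewrite oint_id subr0 addrAC subrr add0r; exact.
  have [h0|h0] := leP 0 h.
    rewrite (ger0_norm h0); apply: le_trans (key x (x + h) _) _; first lra.
    rewrite addrAC subrr add0r mulrC; apply: ler_wpM2r => //.
    exact: le_trans (ler_norm _) (ltW hw).
  rewrite (ltr0_norm h0) distrC; apply: le_trans (key (x + h) x _) _; first lra.
  rewrite opprD addrA subrr add0r mulrC; apply: ler_wpM2r; first lra.
  have {}hw : `|w (x + h) x| < e by move: hw; rewrite /w oint_sym normrN.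
  exact: le_trans (ler_norm _) (ltW hw).
move=> x y; have := is_derive_0_is_cst x y dP; rewrite /P -(oint_chasles 0 x y lp) => e; lra.
Qed.

Lemma AC_parts f g F G a b : abscont f g -> abscont F G ->
  oint (fun x => f x * G x) a b = f b * F b - f a * F a - oint (fun x => g x * F x) a b.
Proof.
move=> fg FG; have [_ ->] := AC_mul fg FG.
have [l2 _] := fg; have [L2' _] := FG.
have [cf cF] := (AC_cont fg, AC_cont FG).
rewrite ointD; [ring|exact: Lloc_contM (L2_Lloc _)|].
by under eq_fun do rewrite mulrC; exact: Lloc_contM (L2_Lloc _).
Qed.

(** The weak derivative is determined almost everywhere. *)
Lemma AC_uniq f g g' h a b : abscont f g -> abscont f g' -> L2 h ->
  oint (fun x => g x * h x) a b = oint (fun x => g' x * h x) a b.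
Proof.
move=> [l2 fg] [l2' fg'] lh; apply/eqP; rewrite -subr_eq0 -ointB; [|exact: L2M..].
have -> : (fun x => g x * h x - g' x * h x) = (fun x => (g x - g' x) * h x).
  by apply/funext => x; ring.
apply/eqP; apply: oint_ae0; [exact: L2_Lloc (L2B _ _)|by case: lh|].
by move=> x y; rewrite ointB -?fg -?fg' ?subrr //; exact: L2_Lloc.
Qed.

Lemma AC_uniq_sq f g g' a b : abscont f g -> abscont f g' ->
  oint (fun x => g x ^+ 2) a b = oint (fun x => g' x ^+ 2) a b.
Proof.
move=> fg fg'; under eq_fun do rewrite expr2; under [in RHS]eq_fun do rewrite expr2.
rewrite (AC_uniq a b fg fg'); last by case: fg.
by under eq_fun do rewrite mulrC; rewrite (AC_uniq a b fg fg') //; case: fg'.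
Qed.

Lemma oint_eq0 h a b x : continuous h -> (forall x, 0 <= h x) -> a < b -> a <= x <= b ->
  oint h a b = 0 -> h x = 0.
Proof.
move=> ch h0 ab /andP[ax xb] hab; apply/eqP; rewrite eq_le h0 andbT leNgt.
apply/negP => hx; have [d d0 hd] := (contP h x).1 (ch x) (h x / 2) ltac:(lra).
pose u := Num.max a (x - d / 2); pose v := Num.min b (x + d / 2).
have [au xu] : a <= u /\ x - d / 2 <= u by rewrite /u !le_max !lexx orbT.
have [vb vx] : v <= b /\ v <= x + d / 2 by rewrite /v !ge_min !lexx orbT.
have uv : u < v by rewrite /u /v lt_min !gt_max ab /=; apply/andP; split; [lra|apply/andP; split; lra].
have lh := continuous_Lloc ch.
have := oint_mono lh h0 au (ltW uv) vb; rewrite hab.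
have : oint (fun=> h x / 2) u v <= oint h u v.
  apply: le_oint; [exact: ltW|exact: continuous_Lloc (@cst_cont R _)|by []|].
  move=> y /andP[uy yv]; have yx : `|y - x| < d by rewrite ltr_norml; apply/andP; split; lra.
  by have := hd y yx; rewrite ltr_norml => /andP[]; lra.
rewrite oint_cst; have : 0 < h x / 2 * (v - u) by apply: mulr_gt0; lra.
lra.
Qed.

Lemma Lloc_periodic p g : 0 < p -> measurable_fun setT g -> periodic g p ->
  mu.-integrable `[0, p] (EFin \o g) -> Lloc g.
Proof.
move=> p0 mg gp ig.
have gpn (n : nat) x : g (x + p *+ n) = g x by rewrite periodicn.
have sh (c : R) : (forall x, g (x + c) = g x) -> mu.-integrable `[- c, p - c] (EFin \o g).
  move=> gc; have ms : measurable_fun setT (fun x : R => x + c) by apply: measurable_funD.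
  have [+ _] := transport ms (@lebesgue_shift R c) (measurable_itv `[0, p]) mg ig.
  have -> : (fun x : R => x + c) @^-1` `[0, p]%classic = `[- c, p - c]%classic.
    by apply/seteqP; split => x /=; rewrite !in_itv /=; lra.
  by congr (mu.-integrable _ _); apply/funext => x /=; rewrite gc.
have un u v w : u <= v -> v <= w -> mu.-integrable `[u, v] (EFin \o g) ->
    mu.-integrable `[v, w] (EFin \o g) -> mu.-integrable `[u, w] (EFin \o g).
  move=> uv vw i1 i2.
  have {}i2 : mu.-integrable `]v, w] (EFin \o g).
    by apply: integrableS i2 => //; exact: subset_itv_oc_cc.
  have -> : `[u, w]%classic = `[u, v]%classic `|` `]v, w]%classic.
    apply/seteqP; split => x /=; rewrite !in_itv /=.
      by move=> /andP[ux xw]; have [xv|vx] := leP x v; [left|right]; apply/andP.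
    by move=> [] /andP[h1 h2]; apply/andP; split => //; [exact: le_trans vw|exact: le_trans (ltW h1)].
  have mg' D : measurable_fun D (EFin \o g) by apply/measurable_EFinP; exact: measurable_funTS.
  apply/integrableP; split; first exact: mg'.
  have mga D : measurable_fun D (fun x => `|(EFin \o g) x|)%E.
    by apply: measurableT_comp => //; exact: mg'.
  have dj : [disjoint `[u, v]%classic & `]v, w]%classic].
    apply/disj_setPS => x /= []; rewrite !in_itv /= => /andP[_ xv] /andP[vx _].
    by move: (lt_le_trans vx xv); rewrite ltxx.
  rewrite ge0_integral_setU //; last exact: mga.
  by apply: lte_add_pinfty; [case/integrableP : i1|case/integrableP : i2].
have big (n : nat) : mu.-integrable `[- (p *+ n), p *+ n] (EFin \o g).
  elim: n => [|n IH]; first by rewrite mulr0n oppr0; apply: integrableS ig => //; apply: subset_itvl; rewrite bnd_simp; lra.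
  have pn : 0 <= p *+ n by apply: mulrn_wge0; lra.
  apply: (@un _ (p *+ n)); [rewrite mulrSr; lra|rewrite mulrSr; lra| |].
    apply: (@un _ (- (p *+ n))); [rewrite mulrSr; lra|lra| |exact: IH].
    have := sh (p *+ n.+1) (gpn _).
    by have -> : p - p *+ n.+1 = - (p *+ n) by rewrite mulrSr; ring.
  have := sh (- (p *+ n)) _; rewrite !opprK.
  have -> : p + p *+ n = p *+ n.+1 by rewrite mulrSr; ring.
  by apply => x; rewrite -(gpn n (x - p *+ n)) subrK.
move=> a b; pose n := (Num.truncn ((`|a| + `|b|) / p)).+1.
have hn : `|a| + `|b| < p *+ n.
  rewrite -mulr_natl -ltr_pdivrMr //; exact: truncnS_gt.
apply: integrableS (big n) => //; apply: subset_itvScc; rewrite bnd_simp.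
  by have := ler_norm (- a); rewrite normrN; have := normr_ge0 b; lra.
by have := ler_norm b; have := normr_ge0 a; lra.
Qed.

(** The lemma of du Bois-Reymond.  With F a primitive of g and m the mean of f - F,
    the function h = f - F - m has mean 0, so its primitive is an admissible test function
    and testing with it yields int h ^+ 2 = 0. *)
Lemma weak_derivative_AC p f g : 0 < p -> continuous f -> periodic f p ->
  weak_derivative p f g -> abscont f g.
Proof.
move=> p0 cf fp [gp mg ig wd].
have l2 : L2 g.
  split => //; apply: (Lloc_periodic p0) => //.
  - by under eq_fun do rewrite expr2; exact: measurable_funM.
  - by move=> x; rewrite gp.
have lg := L2_Lloc l2.
have p0' := ltW p0.
have wd' phi dphi : periodic phi p -> (forall x, is_derive x 1 phi (dphi x)) -> continuous dphi ->
    oint (fun x => f x * dphi x) 0 p = - oint (fun x => g x * phi x) 0 p.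
  move=> pp dp cdp; have e : derive1 phi = dphi.
    by apply/funext => x; rewrite derive1E; have [] := dp x.
  by rewrite -!pintE // -e; apply: wd; split => //; rewrite e.
have g0 : oint g 0 p = 0.
  have := wd' (fun=> 1) (fun=> 0) (fun _ => erefl) (fun x => is_derive_cst _ _ _) (@cst_cont R _).
  under eq_fun do rewrite mulr0; under [in RHS]eq_fun do rewrite mulr1.
  by rewrite oint_cst mul0r => /eqP; rewrite eq_sym oppr_eq0 => /eqP.
pose F := oint g 0.
have FAC : abscont F g by split => // x y; rewrite /F -(oint_chasles 0 x y lg) addrAC subrr add0r.
have Fp : periodic F p.
  move=> x; rewrite /F -(oint_chasles 0 x (x + p) lg) (oint_period x 0 lg gp) add0r g0.
  by rewrite addr0.
have cF := AC_cont FAC.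
pose m := oint (fun x => f x - F x) 0 p / p.
pose h x := f x - F x - m.
have cfF : continuous (fun x => f x - F x) by exact: contB.
have ch : continuous h by apply: contB => //; exact: cst_cont.
have lh := continuous_Lloc ch.
have h0 : oint h 0 p = 0.
  rewrite /h ointB; [|exact: continuous_Lloc..|exact: continuous_Lloc (@cst_cont R _)].
  by rewrite oint_cst /m subr0 mulfVK ?gt_eqF // subrr.
have hp : periodic h p by move=> x; rewrite /h fp Fp.
pose phi := oint h 0.
have dphi x : is_derive x 1 phi (h x) by apply: oint_derive => //; exact: ch.
have phip : periodic phi p.
  by move=> x; rewrite /phi -(oint_chasles 0 x (x + p) lh) (oint_period x 0 lh hp) add0r h0 addr0.
have e1 := wd' _ _ phip dphi ch.
have e2 := AC_parts 0 p FAC (AC_C1 ch dphi).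
have hh : oint (fun x => h x * h x) 0 p = 0.
  have -> : (fun x => h x * h x) = (fun x => (f x * h x - F x * h x) - m * h x).
    by apply/funext => x; rewrite /h; ring.
  have l1 : Lloc (fun x => f x * h x) by apply: continuous_Lloc; exact: contM.
  have l3 : Lloc (fun x => F x * h x) by apply: continuous_Lloc; exact: contM.
  rewrite ointB ?ointB ?ointZ //; last 2 first.
  - exact: LlocB.
  - exact: LlocZ.
  rewrite h0 e1 e2 /phi h0 !oint_id /F oint_id; ring.
have hz x : h x = 0.
  apply/eqP; rewrite -sqrf_eq0 expr2; apply/eqP.
  apply: (@oint_eq0 (fun x => h x * h x) x (x + p)); [exact: contM| |lra|lra|].
    by move=> y; rewrite -expr2 sqr_ge0.
  rewrite (oint_period x 0) ?add0r //; first exact: continuous_Lloc (contM _ _).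
  by move=> y; rewrite hp.
split => // x y; have := hz x; have := hz y; rewrite /h; have [_ <-] := FAC; lra.
Qed.

Lemma AC_weak_derivative p f g : 0 < p -> periodic f p -> periodic g p ->
  abscont f g -> weak_derivative p f g.
Proof.
move=> p0 fp gp fg; have [[mg l2] efg] := fg; split => // phi [pp dp cdp].
have dphi x : is_derive x 1 phi (derive1 phi x).
  by apply: DeriveDef => //; rewrite derive1E.
rewrite !pintE ?ltW // (AC_parts 0 p fg (AC_C1 cdp dphi)).
by rewrite -[p]add0r fp pp add0r subrr sub0r.
Qed.

Lemma wderivP p f : 0 < p -> H1 p f -> periodic (wderiv p f) p /\ abscont f (wderiv p f).
Proof.
move=> p0 [cf fp [g hg]]; have : [set g | weak_derivative p f g] (wderiv p f).
  exact: (@xgetI _ _ _ g).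
by move=> /= h; split; [case: h|exact: weak_derivative_AC h].
Qed.

Lemma AC_H1 p f g : 0 < p -> periodic f p -> periodic g p -> abscont f g -> H1 p f.
Proof.
move=> p0 fp gp fg; split => //; first exact: AC_cont fg.
by exists g; exact: AC_weak_derivative.
Qed.

End AbsolutelyContinuous.

(** * Derivation rules and uniform continuity on the circle *)

Section DerivativeRules.
Context {R : realType}.
Implicit Types (f g : R -> R) (x l m k d : R).

Lemma chain_rule f g x l m : is_derive (g x) 1 f l -> is_derive x 1 g m -> is_derive x 1 (fun y => f (g y)) (l * m).
Proof. move=> df dg; have := is_derive1_comp df dg. by []. Qed.
Lemma dD f g x l m : is_derive x 1 f l -> is_derive x 1 g m -> is_derive x 1 (fun y => f y + g y) (l + m).
Proof. by move=> df dg; apply: is_deriveD. Qed.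
Lemma dB f g x l m : is_derive x 1 f l -> is_derive x 1 g m -> is_derive x 1 (fun y => f y - g y) (l - m).
Proof. by move=> df dg; apply: is_deriveB. Qed.
Lemma dN f x l : is_derive x 1 f l -> is_derive x 1 (fun y => - f y) (- l).
Proof. by move=> df; apply: is_deriveN. Qed.
Lemma dM f g x l m : is_derive x 1 f l -> is_derive x 1 g m -> is_derive x 1 (fun y => f y * g y) (l * g x + f x * m).
Proof.
move=> df dg; have -> : l * g x + f x * m = f x * m + g x * l by ring.
exact: is_deriveM df dg.
Qed.
Lemma dC (k : R) x : is_derive x 1 (fun _ : R => k) 0.
Proof. exact: is_derive_cst. Qed.
Lemma dI x : is_derive x 1 (fun y : R => y) 1.
Proof. exact: is_derive_id. Qed.
Lemma dZ (k : R) f x l : is_derive x 1 f l -> is_derive x 1 (fun y => k * f y) (k * l).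
Proof. by move=> df; have := is_deriveZ k df. Qed.
Lemma dsq f x l : is_derive x 1 f l -> is_derive x 1 (fun y => f y ^+ 2) (2 * f x * l).
Proof.
move=> df; have := dM df df; under eq_fun do rewrite -expr2.
by have -> : l * f x + f x * l = 2 * f x * l by ring.
Qed.
Lemma dV f x l : f x != 0 -> is_derive x 1 f l -> is_derive x 1 (fun y => (f y)^-1) (- l / f x ^+ 2).
Proof.
move=> f0 df; have -> : - l / f x ^+ 2 = - (f x ^- 2) * l by ring.
exact: is_deriveV f0 df.
Qed.
Lemma eq_derive f x l m : l = m -> is_derive x 1 f l -> is_derive x 1 f m.
Proof. by move=> ->. Qed.
Lemma near_derive f g x l (d : R) : 0 < d -> (forall y, `|y - x| < d -> f y = g y) -> is_derive x 1 f l -> is_derive x 1 g l.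
Proof.
move=> d0 fg /is_deriveP h; apply/is_deriveP => e e0; have [d' d'0 hd] := h e e0.
exists (Num.min d d'); first by rewrite lt_min d0.
move=> t; rewrite lt_min => /andP[t1 t2]; rewrite -!fg ?hd ?subrr ?normr0 //.
by rewrite addrAC subrr add0r.
Qed.

End DerivativeRules.

Section UniformContinuity.
Context {R : realType}.
Implicit Types (f g h F G : R -> R) (a b c x y k M e d s t : R).

Lemma unif_cont f a b : continuous f -> a <= b ->
  forall e, 0 < e -> exists2 d : R, 0 < d & forall x y, a <= x <= b -> `|y - x| < d -> `|f y - f x| < e.
Proof.
move=> cf ab e e0.
pose P u v := exists2 d : R, 0 < d & forall x y, u <= x <= v -> `|y - x| < d -> `|f y - f x| < e.
apply: (cousin (P := P) ab) => [x y z xy yz [d d0 hd] [d' d0' hd']|x].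
  exists (Num.min d d'); first by rewrite lt_min d0.
  move=> s t /andP[xs sz]; rewrite lt_min => /andP[h1 h2].
  by have [sy|/ltW ys] := leP s y; [apply: hd|apply: hd'] => //; apply/andP.
have [d d0 hd] := (contP f x).1 (cf x) (e / 2) ltac:(lra).
exists (d / 2); first lra.
move=> u v h1 h2 h3 h4; exists (d / 2); first lra.
move=> s t /andP[us sv] ts.
have sx : `|s - x| < d / 2 by rewrite ltr_norml; apply/andP; split; lra.
have h5 := hd s ltac:(lra).
have h6 : `|f t - f x| < e / 2.
  by apply: hd; have := ler_normD (t - s) (s - x); rewrite addrA subrK; lra.
have -> : f t - f s = f t - f x - (f s - f x) by ring.
by have := ler_normB (f t - f x) (f s - f x); lra.
Qed.

Lemma per_nat f (n : nat) x : (forall x, f (x + 1) = f x) -> f (x + n%:R) = f x.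
Proof. by move=> fp; rewrite -[n%:R]mulr_natl mulr1; exact: (@periodicn _ _ f 1 fp). Qed.

Lemma per_int f (n : int) x : (forall x, f (x + 1) = f x) -> f (x + n%:~R) = f x.
Proof.
move=> fp; case: n => n; first exact: per_nat.
by rewrite NegzE mulrNz -(per_nat n.+1 _ fp) -pmulrn subrK.
Qed.

Lemma floor_frac x : 0 <= x - (Num.floor x)%:~R /\ x - (Num.floor x)%:~R < 1.
Proof. have := ge_floor x; have := floorD1_gt x; rewrite intrD1; lra. Qed.

Lemma per_reduce (P : R -> Prop) : (forall x, P (x + 1) <-> P x) ->
  (forall x, 0 <= x -> x < 1 -> P x) -> forall x, P x.
Proof.
move=> Pp P01 x; have [h0 h1] := floor_frac x.
pose f y := (`[< P y >] : nat)%:R : R.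
have fp y : f (y + 1) = f y by rewrite /f; congr (nat_of_bool _)%:R; apply/asbool_equiv_eq.
have := per_int (Num.floor x) (x - (Num.floor x)%:~R) fp; rewrite subrK /f.
have -> : `[< P (x - (Num.floor x)%:~R) >] = true by apply/asboolT; exact: P01.
by case: asboolP => // _ /eqP; rewrite eq_sym oner_eq0.
Qed.

Lemma per_unif f : continuous f -> (forall x, f (x + 1) = f x) ->
  forall e, 0 < e -> exists2 d : R, 0 < d & forall x y, `|y - x| < d -> `|f y - f x| < e.
Proof.
move=> cf fp e e0; have [d d0 hd] := unif_cont cf (ler01 : 0 <= 1 :> R) e0.
exists d => //; apply: per_reduce.
  move=> x; split => h y yx.
    rewrite -(fp y) -(fp x); apply: h; by have -> : y + 1 - (x + 1) = y - x by ring.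
  rewrite fp -[y](subrK 1) fp; apply: h.
  by have -> : y - 1 - x = y - (x + 1) by ring.
by move=> x x0 x1 y; apply: hd; rewrite x0 ltW.
Qed.

Lemma per_bound f : continuous f -> (forall x, f (x + 1) = f x) ->
  exists2 M : R, 0 < M & forall x, `|f x| <= M.
Proof.
move=> cf fp; have [M M0 hM] := cont_bound 0 1 cf; exists (M + 1); first lra.
apply: per_reduce; first by move=> x; rewrite fp.
by move=> x x0 x1; apply: le_trans (hM x _) _; rewrite ?x0 ?ltW //; lra.
Qed.

Lemma last_point f a b c : continuous f -> a <= b -> f a <= c -> c <= f b ->
  exists x, [/\ a <= x, x <= b, f x = c & forall y, x <= y <= b -> c <= f y].
Proof.
move=> cf ab fa fb; pose E := [set x | a <= x <= b /\ f x <= c].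
have Ea : E a by split; rewrite ?lexx.
have hE : has_sup E by split; [exists a|exists b => y [/andP[]]].
pose x := sup E.
have xb : x <= b by apply: ge_sup; [exists a|move=> y [/andP[]]].
have ax : a <= x by apply: ub_le_sup => //; case: hE.
have gt y : x < y -> y <= b -> c < f y.
  move=> xy yb; rewrite ltNge; apply/negP => fy.
  suff : y <= x by rewrite leNgt xy.
  by apply: ub_le_sup; [case: hE|split => //; rewrite yb (le_trans ax (ltW xy))].
have fx1 : f x <= c.
  rewrite leNgt; apply/negP => fx.
  have [d d0 hd] := (contP f x).1 (cf x) (f x - c) ltac:(lra).
  have [y [/andP[ay yb] fy] sy] := sup_adherent d0 hE.
  have yx : y <= x by apply: ub_le_sup; [case: hE|split => //; rewrite ay].
  have := hd y; rewrite !ltr_norml => /(_ _)/andP[|]; last by lra.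
  by move: sy; rewrite -/x => sy; apply/andP; split; lra.
have fx2 : c <= f x.
  have [xeb|] := eqVneq x b; first by rewrite xeb.
  rewrite eq_sym => bx; have {bx} xb' : x < b by rewrite lt_neqAle eq_sym bx.
  rewrite leNgt; apply/negP => fx.
  have [d d0 hd] := (contP f x).1 (cf x) (c - f x) ltac:(lra).
  pose y := Num.min b (x + d / 2).
  have yb : y <= b by rewrite ge_min lexx.
  have xy : x < y by rewrite lt_min xb' /=; lra.
  have yd : y <= x + d / 2 by rewrite ge_min lexx orbT.
  have := gt y xy yb; have := hd y; rewrite !ltr_norml => /(_ _)/andP[|]; last by lra.
  by apply/andP; split; lra.
exists x; split => //; first by apply/le_anti; rewrite fx1.
move=> y /andP[xy yb]; have [->|ne] := eqVneq y x; first by [].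
by apply/ltW/gt => //; rewrite lt_neqAle eq_sym ne.
Qed.

End UniformContinuity.

(** * Time changes and the modulus of continuity of the transform *)

Section TimeChange.
Context {R : realType}.
Implicit Types (f g h F G K : R -> R) (a b c x y k M e d s t u v : R).

Lemma normsqE f : normsq f = oint (fun x => f x ^+ 2) 0 1.
Proof. by rewrite /normsq pintE. Qed.

Lemma timechangeE f s : timechange f s = oint (fun x => f x ^+ 2) 0 s / normsq f.
Proof. by []. Qed.

(** What the time change needs: the square is periodic, f itself may be twisted. *)
Definition sqloop f := [/\ continuous f, forall s, f (s + 1) ^+ 2 = f s ^+ 2 & 0 < normsq f].

Section Loop.
Variable f : R -> R.
Hypothesis fl : sqloop f.
Let cf : continuous f := let: And3 h _ _ := fl in h.
Let fp : forall s, f (s + 1) ^+ 2 = f s ^+ 2 := let: And3 _ h _ := fl in h.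
Let N0 : 0 < normsq f := let: And3 _ _ h := fl in h.
Let lf : Lloc (fun x => f x ^+ 2) := continuous_Lloc (cont_sqr cf).
Let T := timechange f.
Let q t := f (invtime f t) ^+ 2.

Lemma timechange_sub s s' : T s' - T s = oint (fun x => f x ^+ 2) s s' / normsq f.
Proof. by rewrite /T !timechangeE -(oint_chasles 0 s s' lf); ring. Qed.

Lemma timechange_derive s : is_derive s 1 T (f s ^+ 2 / normsq f).
Proof.
have -> : T = (normsq f)^-1 *: oint (fun x => f x ^+ 2) 0.
  by apply/funext => x; rewrite /T timechangeE mulrC.
rewrite mulrC; apply: is_deriveZ; apply: oint_derive => //.
exact: (cont_sqr cf).
Qed.

Lemma timechange_cont : continuous T.
Proof. exact: derive_cont timechange_derive. Qed.

Lemma timechange0 : T 0 = 0.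
Proof. by rewrite /T timechangeE oint_id mul0r. Qed.

Lemma timechangeS s : T (s + 1) = T s + 1.
Proof.
rewrite -[LHS](subrK (T s)) timechange_sub (oint_period s 0 lf fp) add0r -normsqE.
by rewrite divff ?gt_eqF // addrC.
Qed.

Lemma timechange1 : T 1 = 1.
Proof. by rewrite -[1]add0r timechangeS timechange0. Qed.

Lemma timechange_mono s s' : s <= s' -> T s <= T s'.
Proof.
move=> ss; rewrite -subr_ge0 timechange_sub; apply: divr_ge0; last exact: ltW.
by apply: oint_ge0 => // x _; exact: sqr_ge0.
Qed.

Lemma timechange_near s : `|T s - s| <= 1.
Proof.
move: s; apply: per_reduce => [s|s s0 s1].
  by rewrite timechangeS; have -> : T s + 1 - (s + 1) = T s - s by ring.
have := timechange_mono s0; have := timechange_mono (ltW s1).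
by rewrite timechange0 timechange1 ler_norml => h1 h2; apply/andP; split; lra.
Qed.

Lemma timechange_onto t : exists s, T s = t.
Proof.
have h1 := timechange_near (t - 2); have h2 := timechange_near (t + 2).
have [//|||c _ <-] := @IVT R T (t - 2) (t + 2) t.
- lra.
- by apply: continuous_subspaceT; exact: timechange_cont.
- rewrite ge_min le_max; move: h1 h2; rewrite !ler_norml => /andP[_ h1] /andP[h2 _].
  by apply/andP; split; apply/orP; [left|right]; lra.
- by exists c.
Qed.

(** T is continuous and onto, so the infimum of a fibre belongs to it. *)
Lemma timechange_invtime t : T (invtime f t) = t.
Proof.
pose E := [set s | T s = t]; rewrite /invtime -/T -/E.
have hE : has_inf E.
  split; first by have [s hs] := timechange_onto t; exists s.
  exists (t - 1) => s /= hs; have := timechange_near s; rewrite hs ler_norml => /andP[h1 h2]; lra.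
apply/eqP/negPn/negP => ne; have e0 : 0 < `|T (inf E) - t| by rewrite normr_gt0 subr_eq0.
have [d d0 hd] := (contP T (inf E)).1 (timechange_cont (x := inf E)) _ e0.
have [s Es si] := inf_adherent d0 hE.
have is_ : inf E <= s by apply: ge_inf => //; case: hE.
have sd : `|s - inf E| < d by rewrite ger0_norm ?subr_ge0 //; lra.
by have := hd s sd; rewrite (Es : T s = t) distrC ltxx.
Qed.

(** On a nondegenerate fibre the integral of f ^+ 2 vanishes, hence so does f. *)
Lemma timechange_fibre s s' : T s = T s' -> f s ^+ 2 = f s' ^+ 2.
Proof.
wlog ss : s s' / s <= s' => [hw e|e].
  by have [/hw->//|/ltW/hw->//] := leP s s'.
have [->//|ne] := eqVneq s s'; have {ne} ss' : s < s' by rewrite lt_neqAle ne.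
have h0 : oint (fun x => f x ^+ 2) s s' = 0.
  have := timechange_sub s s'; rewrite e subrr => /esym/eqP.
  by rewrite mulf_eq0 invr_eq0 (gt_eqF N0) orbF => /eqP.
have fz x : s <= x <= s' -> f x ^+ 2 = 0.
  move=> hx; apply: (@oint_eq0 _ (fun x => f x ^+ 2) s s' x _ _ ss' hx h0); first exact: cont_sqr.
  by move=> y; exact: sqr_ge0.
by rewrite !fz ?lexx ?ss.
Qed.

Lemma q_timechange s : q (T s) = f s ^+ 2.
Proof. by apply: timechange_fibre; rewrite timechange_invtime. Qed.

Lemma q_periodic t : q (t + 1) = q t.
Proof.
have [s <-] := timechange_onto t.
by rewrite -timechangeS !q_timechange fp.
Qed.

(** The substitution t = T s in an integral of K. *)
Lemma q_substitution K a b : continuous K ->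
  oint (fun s => K (T s) * (f s ^+ 2 / normsq f)) a b = oint K (T a) (T b).
Proof.
move=> cK; have lK := continuous_Lloc cK.
have cg : continuous (fun s => K (T s) * (f s ^+ 2 / normsq f)).
  apply: contM; first exact: cont_comp timechange_cont.
  by apply: contM; [exact: cont_sqr|exact: cst_cont].
have dC s : is_derive s 1 (oint K 0 \o T) (K (T s) * (f s ^+ 2 / normsq f)).
  rewrite mulrC; have dT := timechange_derive s.
  have dK : is_derive (T s) 1 (oint K 0) (K (T s)) by apply: oint_derive => //; exact: cK.
  by rewrite mulrC; exact: chain_rule dK dT.
by rewrite (oint_FTC a b cg dC) /= -(oint_chasles 0 (T a) (T b) lK) [X in X - _]addrC addrK.
Qed.

End Loop.

Section Modulus.
Variables f g : R -> R.
Hypothesis fg : abscont f g.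

(** f ^+ 2 is at least a quarter of its final value c' = f s' ^+ 2 after the last
    time x where it equals max (f s ^+ 2, c' / 4).  So s' - x is at most h, and
    by Cauchy-Schwarz the increment of f ^+ 2 on [x, s'] is bounded by the integral of f ^+ 2
    and the energy w; it is comparable to the increment on [s, s']. *)
Lemma osc_core s s' (h w : R) : s <= s' -> 0 < h ->
  (forall x y, s <= x -> x <= y -> y <= s' -> y - x <= h -> oint (fun x => g x ^+ 2) x y <= w) ->
  f s ^+ 2 <= f s' ^+ 2 ->
  4 * oint (fun x => f x ^+ 2) s s' <= f s' ^+ 2 * h ->
  (f s' ^+ 2 - f s ^+ 2) ^+ 2 <= 8 * oint (fun x => f x ^+ 2) s s' * w.
Proof.
move=> ss h0 hw fss hA.
have cf := AC_cont fg; have c2 := cont_sqr cf.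
set A := oint _ s s' in hA *.
have lf := continuous_Lloc c2.
pose c := Num.max (f s ^+ 2) (f s' ^+ 2 / 4).
have m0 := sqr_ge0 (f s').
have c1 : f s ^+ 2 <= c by rewrite le_max lexx.
have c3 : f s' ^+ 2 / 4 <= c by rewrite le_max lexx orbT.
have c4 : c <= f s' ^+ 2 by rewrite ge_max fss /=; lra.
have [x [sx xs fx fgt]] := last_point c2 ss c1 c4.
have A0 : 0 <= A by apply: oint_ge0 => // y _; exact: sqr_ge0.
have w0 : 0 <= w.
  by have := hw s s (lexx s) (lexx s) ss; rewrite subrr oint_id; apply; exact: ltW.
have [m00|mn0] := eqVneq (f s' ^+ 2) 0.
  have -> : f s ^+ 2 = 0 by apply/le_anti; rewrite sqr_ge0 -m00 fss.
  rewrite m00 subrr expr0n /=; apply: mulr_ge0 => //; lra.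
have {mn0} mp : 0 < f s' ^+ 2 by rewrite lt_neqAle eq_sym mn0.
have xA : c * (s' - x) <= A.
  rewrite -oint_cst; apply: (@le_trans _ _ (oint (fun x => f x ^+ 2) x s')).
    apply: le_oint => //; exact: continuous_Lloc (@cst_cont R _).
  by apply: oint_mono => // y; exact: sqr_ge0.
have xh : s' - x <= h.
  rewrite -(ler_pM2l mp); apply: le_trans hA.
  have : 0 <= s' - x by lra.
  by move=> xx; nra.
have wx := hw x s' sx xs (lexx _) xh.
have e : f s' ^+ 2 - c = 2 * oint (fun y => f y * g y) x s'.
  have [l2 _] := AC_mul fg fg; have [_ /(_ x s')] := AC_mul fg fg.
  have lfg : Lloc (fun y => f y * g y) by apply: Lloc_contM => //; apply: L2_Lloc; case: fg.
  rewrite -fx !expr2 => ->; rewrite -ointZ //; congr oint; apply/funext => y; ring.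
have l2g : L2 g by case: fg.
have cs := CS xs (L2_cont cf) l2g.
have Ax : oint (fun x => f x ^+ 2) x s' <= A by apply: oint_mono => // y; exact: sqr_ge0.
have gx0 : 0 <= oint (fun x => g x ^+ 2) x s' by apply: oint_ge0 => // y _; exact: sqr_ge0.
have ax0 : 0 <= oint (fun x => f x ^+ 2) x s' by apply: oint_ge0 => // y _; exact: sqr_ge0.
have bnd : (f s' ^+ 2 - c) ^+ 2 <= 4 * (A * w).
  rewrite e exprMn; have -> : (2 : R) ^+ 2 = 4 by ring.
  apply: ler_wpM2l => //; apply: le_trans cs _; exact: ler_pM.
have sm : f s' ^+ 2 - f s ^+ 2 <= 4 / 3 * (f s' ^+ 2 - c).
  have fs0 := sqr_ge0 (f s).
  by rewrite /c; case: (leP (f s ^+ 2) (f s' ^+ 2 / 4)) => hm; lra.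
have sm0 : 0 <= f s' ^+ 2 - f s ^+ 2 by lra.
have : (f s' ^+ 2 - f s ^+ 2) ^+ 2 <= (4 / 3 * (f s' ^+ 2 - c)) ^+ 2.
  by rewrite ler_sqr ?nnegrE //; lra.
have : 0 <= A * w by exact: mulr_ge0.
by rewrite exprMn; nra.
Qed.

End Modulus.

Lemma L2_shift c g : L2 g -> L2 (fun x => g (x + c)).
Proof.
move=> [mg lg]; split; last exact: (Lloc_shift c lg).
by apply: (@measurableT_comp _ _ _ _ _ _ g _ (fun x => x + c)) => //; apply: measurable_funD.
Qed.

Lemma abscont_shift c f g : abscont f g -> abscont (fun x => f (x + c)) (fun x => g (x + c)).
Proof.
move=> [l2 fg]; split; first exact: L2_shift.
by move=> x y; rewrite oint_shift -?fg //; exact: L2_Lloc.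
Qed.

Definition twist (sg : R) f := forall s, f (s + 1) = sg * f s.

Section ModulusLoop.
Variables (f g : R -> R) (sg : R).
Hypothesis fg : abscont f g.
Hypothesis sg1 : sg ^+ 2 = 1.
Hypothesis fs : twist sg f.
Hypothesis N0 : 0 < normsq f.
Let T := timechange f.

Lemma twist_sqloop : sqloop f.
Proof. by split => //; [exact: AC_cont fg|move=> s; rewrite fs exprMn sg1 mul1r]. Qed.

Lemma deriv_sq_period a b : oint (fun x => g x ^+ 2) (a + 1) (b + 1) = oint (fun x => g x ^+ 2) a b.
Proof.
have ac : abscont f (fun x => sg * g (x + 1)).
  have := AC_Z sg (abscont_shift 1 fg); congr abscont.
  by apply/funext => x; rewrite fs mulrA -expr2 sg1 mul1r.
rewrite (AC_uniq_sq a b fg ac) -(oint_shift 1); last by case: fg => -[].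
by congr oint; apply/funext => x; rewrite exprMn sg1 mul1r.
Qed.

(** Uniform in the position of the interval, by periodicity of f' ^+ 2. *)
Lemma small_energy w : 0 < w -> exists2 h : R, 0 < h &
  forall x y, x <= y -> y - x <= h -> oint (fun x => g x ^+ 2) x y <= w.
Proof.
move=> w0; have l2 : Lloc (fun x => g x ^+ 2) by case: fg => -[].
(* subtracting its mean growth makes the primitive of g ^+ 2 periodic *)
pose D := oint (fun x => g x ^+ 2) 0 1.
pose G x := oint (fun x => g x ^+ 2) 0 x - D * x.
have cG : continuous G.
  apply: contB; first exact: oint_continuous.
  by apply: contZ; exact: id_cont.
have Gp x : G (x + 1) = G x.
  rewrite /G -(oint_chasles 0 1 (x + 1) l2) -/D; have := deriv_sq_period 0 x.
  by rewrite add0r => ->; ring.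
have D0 : 0 <= D by apply: oint_ge0 => // x _; exact: sqr_ge0.
have w2 : 0 < w / 2 by lra.
have [d d0 hd] := per_unif cG Gp w2.
exists (Num.min (d / 2) (w / (2 * (D + 1)))).
  by rewrite lt_min; apply/andP; split; [lra|apply: divr_gt0; lra].
move=> x y xy; rewrite le_min => /andP[h1 h2].
have yxd : `|y - x| < d by rewrite ger0_norm ?subr_ge0 //; lra.
have := hd x y yxd; rewrite /G -(oint_chasles 0 x y l2) => h.
have : D * (y - x) <= w / 2.
  have := h2; rewrite ler_pdivlMr; last lra.
  by move=> h3; nra.
by move: h => /ltr_normlW; lra.
Qed.

(** The key regularity of the transform: its increments are small compared with
    the square root of the increment of time, even near zeroes of f, where T is flat. *)
Lemma osc_modulus e : 0 < e -> exists2 d : R, 0 < d & forall s s', `|T s - T s'| < d ->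
  (f s ^+ 2 - f s' ^+ 2) ^+ 2 <= e * `|T s - T s'|.
Proof.
move=> e0; have Nf0 := N0; set N := normsq f in Nf0.
have w0 : 0 < e / (8 * N) by apply: divr_gt0 => //; lra.
have [h h0 hh] := small_energy w0.
have fl := twist_sqloop.
have l2 : Lloc (fun x => f x ^+ 2) by apply: continuous_Lloc; apply: cont_sqr; exact: AC_cont fg.
exists (e * h ^+ 2 / (16 * N ^+ 2)).
  by apply: divr_gt0; apply: mulr_gt0 => //; apply: exprn_gt0.
(* either the larger value is small, or the oscillation takes place on a short interval *)
have main A m k : 0 <= A -> 0 <= m -> 0 <= k -> k <= m -> A / N < e * h ^+ 2 / (16 * N ^+ 2) ->
    (4 * A <= m * h -> (m - k) ^+ 2 <= 8 * A * (e / (8 * N))) -> (m - k) ^+ 2 <= e * (A / N).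
  move=> A0 m0 fs0 fsm small core.
  have [mA|mA] := leP (m ^+ 2) (e * (A / N)).
    by apply: le_trans mA; rewrite ler_sqr ?nnegrE; lra.
  have -> : e * (A / N) = 8 * A * (e / (8 * N)) by field; rewrite gt_eqF.
  apply: core; rewrite -ler_sqr ?nnegrE; last 2 first.
  - lra.
  - by apply: mulr_ge0 => //; lra.
  have AN : 0 <= A / N by apply: divr_ge0 => //; exact: ltW.
  have -> : (4 * A) ^+ 2 = (16 * N ^+ 2) * (A / N) * (A / N) by field; rewrite gt_eqF.
  have N20 : 0 < 16 * N ^+ 2 by apply: mulr_gt0 => //; apply: exprn_gt0.
  move: small; rewrite ltr_pdivlMr // => small.
  apply: (@le_trans _ _ (e * h ^+ 2 * (A / N))); first by apply: ler_wpM2r => //; lra.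
  rewrite exprMn; have -> : e * h ^+ 2 * (A / N) = (e * (A / N)) * h ^+ 2 by ring.
  by apply: ler_wpM2r; [exact: sqr_ge0|exact: ltW].
have half s s' : s <= s' -> `|T s - T s'| < e * h ^+ 2 / (16 * N ^+ 2) ->
    (f s ^+ 2 - f s' ^+ 2) ^+ 2 <= e * `|T s - T s'|.
  move=> ss; have TA : `|T s - T s'| = oint (fun x => f x ^+ 2) s s' / N.
    by rewrite distrC ger0_norm ?subr_ge0 ?timechange_sub //; exact: timechange_mono.
  rewrite TA => small.
  have A0 : 0 <= oint (fun x => f x ^+ 2) s s' by apply: oint_ge0 => // x _; exact: sqr_ge0.
  have [le1|/ltW le1] := leP (f s ^+ 2) (f s' ^+ 2).
    rewrite -sqrrN opprB; apply: main => //; try exact: sqr_ge0.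
    by apply: (osc_core fg) => // x y _ xy _; exact: hh.
  apply: main => //; try exact: sqr_ge0.
  have := osc_core (AC_refl 0 fg) (s := - s') (s' := - s) (h := h) (w := e / (8 * N)).
  rewrite (oint_refl 0 (- s') (- s) l2) !sub0r !opprK lerN2; apply => //.
  move=> x y _ xy _ yxh; under eq_fun do rewrite sqrrN.
  have lg2 : Lloc (fun x => g x ^+ 2) by case: fg => -[].
  rewrite (oint_refl 0 x y lg2).
  by apply: hh; lra.
move=> s s'; have [ss|/ltW ss] := leP s s'; first exact: half.
by rewrite (distrC (T s)) -(opprB (f s' ^+ 2)) sqrrN; exact: half.
Qed.

Lemma q_cont : continuous (fun t => f (invtime f t) ^+ 2).
Proof.
have fl := twist_sqloop.
move=> t; apply/contP => e e0; have [d d0 hd] := osc_modulus (ltac:(lra) : 0 < (1 : R)).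
exists (Num.min d (e ^+ 2)); first by rewrite lt_min d0 /= exprn_gt0.
move=> t'; rewrite lt_min => /andP[h1 h2].
have := hd (invtime f t') (invtime f t); rewrite /T !timechange_invtime // mul1r => /(_ h1) h.
by rewrite -ltr_sqr ?nnegrE ?normr_ge0 ?(ltW e0) // real_normK ?num_real //; exact: le_lt_trans h2.
Qed.

End ModulusLoop.
End TimeChange.

(** * First variation of the time change and of the transform *)

Section Variation.
Context {R : realType}.
Implicit Types (f g h v w K : R -> R) (a b c x y k M e d s t nu : R).

(** A component of [levi_civita]. *)
Definition lc f t := f (invtime f t) ^+ 2.

(** A nonzero component with its weak derivative; sg is 1 for periodic and -1 for
    antiperiodic components. *)
Definition nloop sg f g := [/\ abscont f g, sg ^+ 2 = 1, twist sg f & 0 < normsq f].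

Lemma oint_mul_bound h X a b c : a <= b -> Lloc h -> continuous X ->
  (forall x, a <= x <= b -> `|X x| <= c) ->
  `|oint (fun x => h x * X x) a b| <= c * oint (fun x => `|h x|) a b.
Proof.
move=> ab lh cX Xc; have lhX : Lloc (fun x => h x * X x).
  by under eq_fun do rewrite mulrC; exact: Lloc_contM.
apply: (le_trans (le_norm_oint ab lhX)); rewrite -ointZ; last exact: Lloc_abs.
apply: le_oint => //; [exact: Lloc_abs|by apply: LlocZ; exact: Lloc_abs|].
by move=> x hx; rewrite normrM mulrC; apply: ler_wpM2r => //; exact: Xc.
Qed.

Lemma twist_abs sg f : sg ^+ 2 = 1 -> twist sg f -> forall s, `|f (s + 1)| = `|f s|.
Proof.
move=> sg1 fs s; rewrite fs normrM; suff -> : `|sg| = 1 by rewrite mul1r.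
by apply/eqP; rewrite -(@eqrXn2 _ 2) ?normr_ge0 // real_normK ?num_real // sg1 expr1n.
Qed.

Lemma twist_bound sg f : continuous f -> sg ^+ 2 = 1 -> twist sg f ->
  exists2 M : R, 0 < M & forall x, `|f x| <= M.
Proof.
move=> cf sg1 fs; have cn : continuous (fun x => `|f x|) by move=> x; apply: cvg_norm; exact: cf.
have [M M0 hM] := per_bound cn (twist_abs sg1 fs).
by exists M => // x; have := hM x; rewrite normr_id.
Qed.

Lemma twistD sg f g : twist sg f -> twist sg g -> twist sg (fun s => f s + g s).
Proof. by move=> fs gs s; rewrite fs gs mulrDr. Qed.

Variables (f g : R -> R) (sg : R).
Hypothesis fl : nloop sg f g.
Let fg : abscont f g := let: And4 h _ _ _ := fl in h.
Let sg1 : sg ^+ 2 = 1 := let: And4 _ h _ _ := fl in h.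
Let fs : twist sg f := let: And4 _ _ h _ := fl in h.
Let N0 : 0 < normsq f := let: And4 _ _ _ h := fl in h.
Let cf : continuous f := AC_cont fg.
Local Notation N := (normsq f).
Local Notation T := (timechange f).

(** The derivative of f |-> timechange f s in the direction v. *)
Definition dtime v s : R :=
  (2 * oint (fun x => f x * v x) 0 s - T s * (2 * oint (fun x => f x * v x) 0 1)) / N.

(** Variations measured in the uniform norm, with the same twist as the loop. *)
Definition small v nu := [/\ continuous v, twist sg v, 0 < nu & forall s, `|v s| <= nu].

Lemma vary_sq v s : continuous v -> oint (fun x => (f x + v x) ^+ 2) 0 s =
  oint (fun x => f x ^+ 2) 0 s + 2 * oint (fun x => f x * v x) 0 s + oint (fun x => v x ^+ 2) 0 s.
Proof.
move=> cv; have l1 : Lloc (fun x => f x ^+ 2) by apply: continuous_Lloc; exact: cont_sqr.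
have l2 : Lloc (fun x => v x ^+ 2) by apply: continuous_Lloc; exact: cont_sqr.
have l3 : Lloc (fun x => 2 * (f x * v x)) by apply: LlocZ; apply: continuous_Lloc; exact: contM.
rewrite -ointZ; last by apply: continuous_Lloc; exact: contM.
rewrite -(ointD 0 s l1 l3) -(ointD 0 s (LlocD l1 l3) l2).
by congr oint; apply/funext => x; ring.
Qed.

Lemma vary_bounds : exists C nu0 : R, [/\ 0 < C, 0 < nu0, nu0 <= 1 &
  forall v nu, small v nu -> nu <= nu0 ->
  [/\ N / 2 <= normsq (fun s => f s + v s),
      `|normsq (fun s => f s + v s) - N| <= C * nu,
      forall s, `|timechange (fun s => f s + v s) s - T s| <= C * nu &
      forall s, 0 <= s <= 1 ->
        `|timechange (fun s => f s + v s) s - T s - dtime v s| <= C * nu ^+ 2]].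
Proof.
have [M M0 hM] := twist_bound cf sg1 fs.
have fl' := twist_sqloop fg sg1 fs N0.
pose P := 2 * M + 1; have P0 : 0 < P by rewrite /P; lra.
have Nn := N0; set n := normsq f in Nn.
pose C := P + 4 * P / n + 4 / n + 8 * M * P / n ^+ 2.
have pn : 0 < 4 * P / n by apply: divr_gt0 => //; lra.
have pn1 : 0 < 4 / n by apply: divr_gt0 => //; lra.
have pn2 : 0 < 8 * M * P / n ^+ 2 by apply: divr_gt0; [apply: mulr_gt0 => //; lra|exact: exprn_gt0].
exists C, (Num.min 1 (n / (2 * P))); split.
- by rewrite /C; lra.
- by rewrite lt_min ltr01 /=; apply: divr_gt0 => //; lra.
- by rewrite ge_min lexx.
move=> v nu [cv vs nu0 hv]; rewrite le_min => /andP[nu1 nuP].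
set fv := fun s => f s + v s.
have cfv : continuous fv by apply: contD.
have lfv : Lloc (fun x => f x * v x) by apply: continuous_Lloc; exact: contM.
have lvv : Lloc (fun x => v x ^+ 2) by apply: continuous_Lloc; exact: cont_sqr.
have ha s : 0 <= s <= 1 -> `|2 * oint (fun x => f x * v x) 0 s| <= 2 * M * nu.
  move=> /andP[s0 s1]; rewrite normrM ger0_norm // -mulrA; apply: ler_wpM2l => //.
  have := oint_bound lfv (M := M * nu) (a := 0) (b := s).
  move=> /(_ _)/le_trans; apply.
    by move=> x _; rewrite normrM; apply: ler_pM.
  rewrite subr0 ger0_norm //; apply: ler_piMr => //; apply: mulr_ge0; lra.
have hb s : 0 <= s <= 1 -> `|oint (fun x => v x ^+ 2) 0 s| <= nu ^+ 2.
  move=> /andP[s0 s1]; have := oint_bound lvv (M := nu ^+ 2) (a := 0) (b := s).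
  move=> /(_ _)/le_trans; apply.
    by move=> x _; rewrite normrX; rewrite ler_sqr ?nnegrE //; lra.
  rewrite subr0 ger0_norm //; apply: ler_piMr => //; exact: sqr_ge0.
have nu2 : nu ^+ 2 <= nu by rewrite expr2; nra.
have hN : normsq fv = n + 2 * oint (fun x => f x * v x) 0 1 + oint (fun x => v x ^+ 2) 0 1.
  by rewrite normsqE vary_sq // -normsqE.
set a1 := 2 * oint (fun x => f x * v x) 0 1 in hN.
set b1 := oint (fun x => v x ^+ 2) 0 1 in hN.
have h01 : 0 <= (1 : R) <= 1 by rewrite ler01 lexx.
have ha1 : `|a1| <= 2 * M * nu by exact: ha.
have hb1 : `|b1| <= nu ^+ 2 by exact: hb.
have dN : `|normsq fv - n| <= P * nu.
  have -> : normsq fv - n = a1 + b1 by rewrite hN; ring.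
  by have := ler_normD a1 b1; rewrite /P; lra.
have nuP' : P * nu <= n / 2.
  by move: nuP; rewrite ler_pdivlMr; lra.
have Nv : n / 2 <= normsq fv by move: dN; rewrite ler_norml => /andP[]; lra.
have Nv0 : 0 < normsq fv by lra.
have iNv : (normsq fv)^-1 <= 2 / n.
  by rewrite -[2 / n]invf_div lef_pV2 ?posrE //; apply: divr_gt0; lra.
have iNv0 : 0 < (normsq fv)^-1 by rewrite invr_gt0.
have flv : sqloop fv.
  by split => // s; rewrite /fv fs vs -mulrDr exprMn sg1 mul1r.
have T01 s : 0 <= s <= 1 -> 0 <= T s /\ T s <= 1.
  move=> /andP[s0 s1]; have := timechange_mono fl' s1; have := timechange_mono fl' s0.
  by rewrite timechange0 timechange1.
have eT s : timechange fv s - T s = ((2 * oint (fun x => f x * v x) 0 s + oint (fun x => v x ^+ 2) 0 s)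
    - T s * (a1 + b1)) * (normsq fv)^-1.
  have -> : timechange fv s = (n * T s + 2 * oint (fun x => f x * v x) 0 s + oint (fun x => v x ^+ 2) 0 s) / normsq fv.
    by rewrite timechangeE vary_sq // /timechangeE (timechangeE f) -/n; congr (_ / _); field; rewrite gt_eqF.
  set A := oint _ 0 s; set B := oint _ 0 s.
  transitivity ((n * T s + 2 * A + B - T s * normsq fv) / normsq fv).
    by field; rewrite gt_eqF.
  by congr (_ / _); rewrite hN; ring.
split => //.
- by apply: le_trans dN _; apply: ler_wpM2r; [exact: ltW|rewrite /C; lra].
- suff h01s s : 0 <= s -> s < 1 -> `|timechange fv s - T s| <= C * nu.
    apply: per_reduce => [s|s s0 s1]; last exact: h01s.
    by rewrite !timechangeS //; have -> : timechange fv s + 1 - (T s + 1) = timechange fv s - T s by ring.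
  move=> s0 s1; have s01 : 0 <= s <= 1 by rewrite s0 ltW.
  have [Ts0 Ts1] := T01 s s01; have := ha s s01; have := hb s s01.
  rewrite eT; set A := 2 * oint _ 0 s; set B := oint _ 0 s => hB hA.
  have num : `|A + B - T s * (a1 + b1)| <= 2 * P * nu.
    have := ler_normB (A + B) (T s * (a1 + b1)); have := ler_normD A B; have := ler_normD a1 b1.
    rewrite (normrM (T s)) (ger0_norm Ts0) => h1 h2 h3.
    have : T s * `|a1 + b1| <= 1 * `|a1 + b1| by apply: ler_wpM2r.
    by rewrite /P; lra.
  rewrite normrM (gtr0_norm iNv0).
  apply: (@le_trans _ _ (2 * P * nu * (2 / n))); first by apply: ler_pM => //; exact: ltW.
  have -> : 2 * P * nu * (2 / n) = (4 * P / n) * nu by field; rewrite gt_eqF.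
  by apply: ler_wpM2r; [exact: ltW|rewrite /C; lra].
- move=> s s01; have [Ts0 Ts1] := T01 s s01; have := ha s s01; have := hb s s01.
  rewrite /dtime eT -/a1; set A := 2 * oint _ 0 s; set B := oint _ 0 s => hB hA.
  have -> : (A + B - T s * (a1 + b1)) * (normsq fv)^-1 - (A - T s * a1) / n =
     (B - T s * b1) * (normsq fv)^-1 + (A - T s * a1) * (n - normsq fv) * ((normsq fv)^-1 / n).
    by field; rewrite !gt_eqF.
  have X1 : `|B - T s * b1| <= 2 * nu ^+ 2.
    have := ler_normB B (T s * b1); rewrite (normrM (T s)) (ger0_norm Ts0).
    have : T s * `|b1| <= 1 * `|b1| by apply: ler_wpM2r.
    lra.
  have X2 : `|A - T s * a1| <= 4 * M * nu.
    have := ler_normB A (T s * a1); rewrite (normrM (T s)) (ger0_norm Ts0).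
    have : T s * `|a1| <= 1 * `|a1| by apply: ler_wpM2r.
    lra.
  have Y1 : `|(B - T s * b1) * (normsq fv)^-1| <= 2 * nu ^+ 2 * (2 / n).
    by rewrite normrM (gtr0_norm iNv0); apply: ler_pM => //; exact: ltW.
  have Y2 : `|(A - T s * a1) * (n - normsq fv) * ((normsq fv)^-1 / n)| <= 4 * M * nu * (P * nu) * (2 / n / n).
    rewrite !normrM (gtr0_norm iNv0) (ger0_norm (x := n^-1)) ?invr_ge0 ?(ltW Nn) //.
    apply: ler_pM.
    - by rewrite mulr_ge0.
    - by apply: divr_ge0; exact: ltW.
    - by apply: ler_pM => //; rewrite distrC.
    - by apply: ler_wpM2r => //; rewrite invr_ge0 ltW.
  apply: (le_trans (ler_normD _ _)); apply: (le_trans (lerD Y1 Y2)).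
  have -> : 2 * nu ^+ 2 * (2 / n) + 4 * M * nu * (P * nu) * (2 / n / n) =
     (4 / n + 8 * M * P / n ^+ 2) * nu ^+ 2 by field; rewrite gt_eqF.
  by apply: ler_wpM2r; [exact: sqr_ge0|rewrite /C; lra].
Qed.

(** T moves by O(nu) and the modulus of continuity of the transform turns this into
    an increment whose square is o(nu). *)
Lemma lc_vary e : 0 < e -> exists2 nu0 : R, 0 < nu0 & forall v nu, small v nu -> nu <= nu0 ->
  forall t, (lc (fun s => f s + v s) t - lc f t) ^+ 2 <= e * nu.
Proof.
move=> e0; have [C [n1 [C0 n10 n11 hC]]] := vary_bounds.
have [M M0 hM] := twist_bound cf sg1 fs.
have fl' := twist_sqloop fg sg1 fs N0.
have eta0 : 0 < e / (4 * C) by apply: divr_gt0 => //; lra.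
have [d d0 hd] := osc_modulus fg sg1 fs N0 eta0.
pose P := 2 * M + 1; have P0 : 0 < P by rewrite /P; lra.
have P20 : 0 < P ^+ 2 by exact: exprn_gt0.
exists (Num.min n1 (Num.min (d / (2 * C)) (e / (4 * P ^+ 2)))).
  rewrite !lt_min n10 /=; apply/andP; split; apply: divr_gt0 => //; lra.
move=> v nu sv; rewrite !le_min => /and3P[nun1 nud nue] t.
have [cv vs nu0 hv] := sv.
have [Nv _ hT _] := hC v nu sv nun1.
set fv := fun s => f s + v s in Nv hT *.
have cfv : continuous fv by apply: contD.
have flv : sqloop fv.
  split => //; last by have Nn := N0; lra.
  by move=> s; rewrite /fv fs vs -mulrDr exprMn sg1 mul1r.
have [s <-] := timechange_onto flv t.
rewrite /lc (q_timechange flv).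
pose s' := invtime f (timechange fv s).
have Ts' : T s' = timechange fv s by exact: timechange_invtime.
have dT : `|T s' - T s| <= C * nu by rewrite Ts'.
have dTd : `|T s' - T s| < d.
  apply: le_lt_trans dT _; move: nud; rewrite ler_pdivlMr; lra.
have osc := hd _ _ dTd.
rewrite -/s'; pose X := fv s ^+ 2 - f s ^+ 2; pose Y := f s ^+ 2 - f s' ^+ 2.
have -> : fv s ^+ 2 - f s' ^+ 2 = X + Y by rewrite /X /Y; ring.
have hX : X ^+ 2 <= P ^+ 2 * nu ^+ 2.
  rewrite -exprMn -real_normK ?num_real // ler_sqr ?nnegrE //; last by apply: mulr_ge0; lra.
  have -> : X = v s * (2 * f s + v s) by rewrite /X /fv; ring.
  rewrite normrM mulrC; apply: ler_pM => //.
  apply: (le_trans (ler_normD _ _)); rewrite normrM ger0_norm // /P.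
  have := hM s; have := hv s; lra.
have hY : Y ^+ 2 <= e / (4 * C) * (C * nu).
  have -> : Y ^+ 2 = (f s' ^+ 2 - f s ^+ 2) ^+ 2 by rewrite /Y -sqrrN opprB.
  by apply: le_trans osc _; apply: ler_wpM2l => //; exact: ltW.
have hY' : Y ^+ 2 <= e / 4 * nu.
  by move: hY; have -> // : e / (4 * C) * (C * nu) = e / 4 * nu by field; rewrite gt_eqF.
have hX' : X ^+ 2 <= e / 4 * nu.
  apply: le_trans hX _; move: nue; rewrite ler_pdivlMr; last lra.
  move=> h; rewrite expr2 mulrA; apply: ler_wpM2r; [exact: ltW|lra].
have := sqr_ge0 (X - Y); nra.
Qed.


(** The derivative of f |-> int (lc f * K) in the direction v: the first
    integral comes from the change of f, the second from the change of time, in which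
    f f' replaces the derivative of the transform. *)
Definition dlc K v : R :=
  oint (fun s => 2 * (f s * v s) * (K (T s) * (f s ^+ 2 / N))) 0 1 -
  oint (fun s => 2 * (f s * g s) * (K (T s) * dtime v s)) 0 1.

Lemma lc_cont : continuous (lc f).
Proof. exact: (q_cont fg sg1 fs N0). Qed.

Lemma lc_periodic t : lc f (t + 1) = lc f t.
Proof. exact: (q_periodic (twist_sqloop fg sg1 fs N0)). Qed.

Lemma lc_timechange s : lc f (T s) = f s ^+ 2.
Proof. exact: (q_timechange (twist_sqloop fg sg1 fs N0)). Qed.

Lemma lc_integral K a b : continuous K ->
  oint (fun t => lc f t * K t) (T a) (T b) =
  oint (fun s => f s ^+ 2 * (K (T s) * (f s ^+ 2 / N))) a b.
Proof.
move=> cK; have fl' := twist_sqloop fg sg1 fs N0.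
rewrite -(q_substitution fl' a b (K := fun t => lc f t * K t)); last first.
  by apply: contM => //; exact: lc_cont.
by congr oint; apply/funext => s; rewrite lc_timechange; ring.
Qed.

Lemma lc_mean : mean (lc f) = normsq (fun s => f s ^+ 2) / N.
Proof.
have fl' := twist_sqloop fg sg1 fs N0.
rewrite /mean pintE // -[X in oint _ _ X](timechange1 fl') -[X in oint _ X _](timechange0 f).
have -> : lc f = (fun t => lc f t * 1) by apply/funext => t; rewrite mulr1.
rewrite (lc_integral 0 1 (@cst_cont R 1)) (normsqE (fun s => f s ^+ 2)) [RHS]mulrC -ointZ.
  by congr oint; apply/funext => s; ring.
by apply: continuous_Lloc; do 2! apply: cont_sqr.
Qed.

End Variation.

Ltac pos := repeat first [done|apply: addr_ge0|apply: mulr_ge0|rewrite invr_ge0|apply: exprn_ge0|exact: ltW].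

Section VariationJ.
Context {R : realType}.
Implicit Types (f g h v w K : R -> R) (a b c x y k M e d s t nu : R).

Lemma dtime_cont f v : continuous f -> continuous v -> continuous (dtime f v).
Proof.
move=> cf cv; have cfv : Lloc (fun x => f x * v x) by apply: continuous_Lloc; exact: contM.
have cT : continuous (timechange f).
  have -> : timechange f = (fun s => oint (fun x => f x ^+ 2) 0 s * (normsq f)^-1) by [].
  apply: contM; last exact: cst_cont.
  by apply: oint_continuous; apply: continuous_Lloc; exact: cont_sqr.
apply: contM; last exact: cst_cont.
apply: contB; first by apply: contZ; exact: oint_continuous.
by apply: contM => //; exact: cst_cont.
Qed.

(** In the parameter s the integral of lc f * K is that of f ^+ 2 k with
    k = (K o T) T'.  Its increment contains f ^+ 2 times the increment of k, which is
    the derivative of Phi s = int_(T s)^(Tv s) K; integrating by parts moves the derivative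
    to f ^+ 2, and Phi = (K o T) dtime + o(nu) uniformly. *)
Lemma lc_integral_vary f g sg K : nloop sg f g -> continuous K -> (forall t, K (t + 1) = K t) ->
  forall e, 0 < e -> exists2 nu0 : R, 0 < nu0 & forall v w nu, abscont v w -> small sg v nu -> nu <= nu0 ->
  `|oint (fun t => lc (fun s => f s + v s) t * K t) 0 1 - oint (fun t => lc f t * K t) 0 1
     - dlc f g K v| <= e * nu.
Proof.
move=> fl cK Kp e e0; have [fg sg1 fs N0] := fl; have cf := AC_cont fg.
have [C [n1 [C0 n10 n11 hC]]] := vary_bounds fl.
have [M M0 hM] := twist_bound cf sg1 fs.
have [KM KM0 hK] := per_bound cK Kp.
have fl' := twist_sqloop fg sg1 fs N0.
have l2g : L2 g by case: fg.
have lG : Lloc (fun s => 2 * (f s * g s)) by apply: LlocZ; apply: Lloc_contM => //; exact: L2_Lloc.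
pose G := oint (fun s => `|2 * (f s * g s)|) 0 1.
have G0 : 0 <= G by apply: oint_ge0 => // s _; exact: normr_ge0.
have Nn := N0; set n := normsq f in Nn.
(* C2 nu bounds the relative change of T', and al, be collect the coefficients of
   the terms that are small by continuity of K and by nu, respectively *)
pose C2 := (2 * M + 1 + M ^+ 2 * C / n) * (2 / n).
have C20 : 0 < C2.
  have : 0 < M ^+ 2 * C / n by apply: divr_gt0 => //; apply: mulr_gt0 => //; exact: exprn_gt0.
  by move=> h; rewrite /C2; apply: mulr_gt0; [lra|apply: divr_gt0; lra].
pose al := 2 * M * (M ^+ 2 / n) + C * G.
have al0 : 0 <= al.
  by rewrite /al; pos.
pose be := 2 * M * (KM * C2) + KM * (M + 1) ^+ 2 * (2 / n) + KM * C * G.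
have be0 : 0 <= be.
  by rewrite /be; pos; lra.
pose e1 := e / (2 * (al + 1)).
have e10 : 0 < e1 by apply: divr_gt0 => //; lra.
have [d d0 hd] := per_unif cK Kp e10.
pose n2 := e / (2 * (be + 1)).
have n20 : 0 < n2 by apply: divr_gt0 => //; lra.
pose n3 := d / (2 * C).
have n30 : 0 < n3 by apply: divr_gt0 => //; lra.
exists (Num.min n1 (Num.min n2 n3)); first by rewrite !lt_min n10 n20.
move=> v w nu vw sv; rewrite !le_min => /and3P[nun1 nun2 nun3].
have [cv vs nu0 hv] := sv.
have [Nv dN dT ddT] := hC v nu sv nun1.
set fv := fun s => f s + v s in Nv dN dT ddT *.
set Nf := normsq fv in Nv dN.
have nu1 : nu <= 1 by lra.
rewrite -/n in Nv dN; have Nf0 : 0 < Nf by lra.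
have iNf : Nf^-1 <= 2 / n.
  by rewrite -[2 / n]invf_div lef_pV2 ?posrE //; apply: divr_gt0; lra.
have cfv : continuous fv by apply: contD.
have flv : nloop sg fv (fun s => g s + w s).
  by split => //; [exact: AC_D|exact: twistD].
have flv' : sqloop fv by case: flv => h1 h2 h3 h4; exact: (twist_sqloop h1 h2 h3 h4).
pose T := timechange f; pose Tv := timechange fv.
have cT : continuous T by exact: timechange_cont.
have cTv : continuous Tv by exact: timechange_cont.
pose k s := K (T s) * (f s ^+ 2 / n); pose kv s := K (Tv s) * (fv s ^+ 2 / Nf).
have ck : continuous k.
  by apply: contM; [exact: cont_comp|apply: contM; [exact: cont_sqr|exact: cst_cont]].
have ckv : continuous kv.
  by apply: contM; [exact: cont_comp|apply: contM; [exact: cont_sqr|exact: cst_cont]].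
have lK := continuous_Lloc cK.
have -> : oint (fun t => lc f t * K t) 0 1 = oint (fun s => f s ^+ 2 * k s) 0 1.
  by rewrite -(lc_integral fl 0 1 cK) timechange0 (timechange1 fl').
have -> : oint (fun t => lc fv t * K t) 0 1 = oint (fun s => fv s ^+ 2 * kv s) 0 1.
  by rewrite -(lc_integral flv 0 1 cK) timechange0 (timechange1 flv').
(* Phi vanishes at 0 and 1, so the integration by parts has no boundary term *)
pose Phi s := oint K (T s) (Tv s).
have dPhi s : is_derive s 1 Phi (kv s - k s).
  have -> : Phi = (fun s => oint K 0 (Tv s) - oint K 0 (T s)).
    by apply/funext => x; rewrite /Phi -(oint_chasles 0 (T x) (Tv x) lK); ring.
  have d1 : is_derive (Tv s) 1 (oint K 0) (K (Tv s)) by apply: oint_derive => //; exact: cK.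
  have d2 : is_derive (T s) 1 (oint K 0) (K (T s)) by apply: oint_derive => //; exact: cK.
  have d3 : is_derive s 1 Tv (fv s ^+ 2 / Nf) by exact: timechange_derive.
  have d4 : is_derive s 1 T (f s ^+ 2 / n) by exact: timechange_derive.
  exact: (dB (chain_rule d1 d3) (chain_rule d2 d4)).
have cPhi : continuous Phi by exact: derive_cont dPhi.
have f2 : abscont (fun s => f s ^+ 2) (fun s => 2 * (f s * g s)).
  by have := AC_mul fg fg; congr abscont; apply/funext => s; ring.
have parts := AC_parts 0 1 f2 (AC_C1 (contB ckv ck) dPhi).
have Phi0 : Phi 0 = 0 by rewrite /Phi /T /Tv !timechange0 oint_id.
have Phi1 : Phi 1 = 0 by rewrite /Phi /T /Tv (timechange1 fl') (timechange1 flv') oint_id.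
rewrite Phi0 Phi1 !mulr0 subrr sub0r in parts.
pose E s := 2 * (f s * v s) * (kv s - k s) + v s ^+ 2 * kv s.
pose X s := Phi s - K (T s) * dtime f v s.
have cX : continuous X.
  apply: contB => //; apply: contM; first exact: cont_comp.
  exact: dtime_cont.
have cfv2 : continuous (fun s => 2 * (f s * v s)) by apply: contZ; exact: contM.
have cE : continuous E.
  by apply: contD; apply: contM => //; [exact: contB|exact: cont_sqr].
have -> : oint (fun s => fv s ^+ 2 * kv s) 0 1 - oint (fun s => f s ^+ 2 * k s) 0 1 - dlc f g K v =
   oint E 0 1 - oint (fun s => 2 * (f s * g s) * X s) 0 1.
  have lfvk : Lloc (fun s => fv s ^+ 2 * kv s) by apply: continuous_Lloc; apply: contM => //; exact: cont_sqr.
  have lfk : Lloc (fun s => f s ^+ 2 * k s) by apply: continuous_Lloc; apply: contM => //; exact: cont_sqr.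
  have lf2k : Lloc (fun s => f s ^+ 2 * (kv s - k s)) by apply: continuous_Lloc; apply: contM; [exact: cont_sqr|exact: contB].
  have lvk : Lloc (fun s => 2 * (f s * v s) * k s) by apply: continuous_Lloc; exact: contM.
  have lgP : Lloc (fun s => 2 * (f s * g s) * Phi s) by under eq_fun do rewrite mulrC; exact: Lloc_contM.
  have lgd : Lloc (fun s => 2 * (f s * g s) * (K (T s) * dtime f v s)).
    under eq_fun do rewrite mulrC; apply: Lloc_contM => //; apply: contM; first exact: cont_comp.
    exact: dtime_cont.
  have lE := continuous_Lloc cE.
  have -> : (fun s => fv s ^+ 2 * kv s) = (fun s => (E s + 2 * (f s * v s) * k s + f s ^+ 2 * k s) + f s ^+ 2 * (kv s - k s)).
    by apply/funext => s; rewrite /E /fv; ring.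
  rewrite (ointD 0 1 (LlocD (LlocD lE lvk) lfk) lf2k) (ointD 0 1 (LlocD lE lvk) lfk) (ointD 0 1 lE lvk) parts.
  have -> : (fun s => 2 * (f s * g s) * X s) = (fun s => 2 * (f s * g s) * Phi s - 2 * (f s * g s) * (K (T s) * dtime f v s)).
    by apply/funext => s; rewrite /X; ring.
  by rewrite (ointB 0 1 lgP lgd) /dlc; ring.
have nu2 : 0 <= nu ^+ 2 by exact: sqr_ge0.
have dk s : 0 <= s <= 1 -> `|kv s - k s| <= KM * (C2 * nu) + e1 * (M ^+ 2 / n).
  move=> s01.
  have -> : kv s - k s = K (Tv s) * (fv s ^+ 2 / Nf - f s ^+ 2 / n) + (K (Tv s) - K (T s)) * (f s ^+ 2 / n).
    by rewrite /kv /k; ring.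
  apply: (le_trans (ler_normD _ _)); rewrite (normrM (K (Tv s))) (normrM (K (Tv s) - K (T s))); apply: lerD.
    apply: ler_pM => //.
    have -> : fv s ^+ 2 / Nf - f s ^+ 2 / n = (v s * (2 * f s + v s) - f s ^+ 2 * (Nf - n) / n) * Nf^-1.
      by rewrite /fv; field; rewrite !gt_eqF.
    have -> : C2 * nu = ((2 * M + 1 + M ^+ 2 * C / n) * nu) * (2 / n) by rewrite /C2; ring.
    rewrite normrM (gtr0_norm (_ : 0 < Nf^-1)) ?invr_gt0 //; apply: ler_pM => //.
      by rewrite invr_ge0 ltW.
    apply: (le_trans (ler_normB _ _)); rewrite [X in _ <= X]mulrDl; apply: lerD.
      rewrite normrM mulrC; apply: ler_pM => //.
      apply: (le_trans (ler_normD _ _)); rewrite normrM ger0_norm //.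
      by have := hM s; have := hv s; move: nu1; clear; lra.
    rewrite (normrM _ n^-1) (normrM (f s ^+ 2)) (ger0_norm (x := n^-1)) ?invr_ge0 ?(ltW Nn) //.
    have -> : M ^+ 2 * C / n * nu = M ^+ 2 * (C * nu) / n by ring.
    apply: ler_wpM2r; first by rewrite invr_ge0 ltW.
    apply: ler_pM => //; rewrite normrX ler_sqr ?nnegrE //; exact: ltW.
  apply: ler_pM => //.
    apply/ltW/hd; apply: le_lt_trans (dT s) _.
    by move: nun3; rewrite /n3 ler_pdivlMr ?mulr_gt0 //; move: (mulr_gt0 C0 nu0); clear; lra.
  rewrite normrM (ger0_norm (x := n^-1)) ?invr_ge0 ?(ltW Nn) //.
  apply: ler_wpM2r; first by rewrite invr_ge0 ltW.
  by rewrite normrX ler_sqr ?nnegrE //; exact: ltW.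
have hkv s : `|kv s| <= KM * ((M + 1) ^+ 2 * (2 / n)).
  rewrite normrM; apply: ler_pM => //; rewrite normrM (gtr0_norm (_ : 0 < Nf^-1)) ?invr_gt0 //.
  apply: ler_pM => //; first by rewrite invr_ge0 ltW.
  rewrite normrX ler_sqr ?nnegrE //; last by rewrite addr_ge0 // ltW.
  by apply: (le_trans (ler_normD _ _)); have := hM s; have := hv s; move: nu1; clear; lra.
have hE s : 0 <= s <= 1 -> `|E s| <= 2 * (M * nu) * (KM * (C2 * nu) + e1 * (M ^+ 2 / n)) + nu ^+ 2 * (KM * ((M + 1) ^+ 2 * (2 / n))).
  move=> s01; apply: (le_trans (ler_normD _ _)); rewrite [`|_ * kv s|]normrM normrX; apply: lerD.
    rewrite normrM; apply: ler_pM => //; last exact: dk.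
    by rewrite normrM normrM ger0_norm //; apply: ler_wpM2l => //; apply: ler_pM.
  apply: ler_pM => //.
  by rewrite ler_sqr ?nnegrE //; exact: ltW.
have hX s : 0 <= s <= 1 -> `|X s| <= e1 * (C * nu) + KM * (C * nu ^+ 2).
  move=> s01.
  have -> : X s = oint (fun t => K t - K (T s)) (T s) (Tv s) + K (T s) * (Tv s - T s - dtime f v s).
    rewrite (ointB (T s) (Tv s) lK); last exact: continuous_Lloc (@cst_cont R _).
    by rewrite oint_cst /X /Phi; ring.
  apply: (le_trans (ler_normD _ _)); apply: lerD; last first.
    by rewrite normrM; apply: ler_pM => //; exact: ddT.
  apply: (@le_trans _ _ (e1 * `|Tv s - T s|)); last first.
    by apply: ler_wpM2l; [exact: ltW|exact: dT].
  apply: oint_bound; first by apply: continuous_Lloc; apply: contB => //; exact: cst_cont.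
  move=> t ht; apply/ltW/hd; apply: le_lt_trans (between_norm ht) _.
  apply: le_lt_trans (dT s) _.
  by move: nun3; rewrite /n3 ler_pdivlMr ?mulr_gt0 //; move: (mulr_gt0 C0 nu0); clear; lra.
have bE : `|oint E 0 1| <= 2 * (M * nu) * (KM * (C2 * nu) + e1 * (M ^+ 2 / n)) + nu ^+ 2 * (KM * ((M + 1) ^+ 2 * (2 / n))).
  have := oint_bound (continuous_Lloc cE) (a := 0) (b := 1).
  rewrite (min_idPl (ler01 : 0 <= 1 :> R)) (max_idPr (ler01 : 0 <= 1 :> R)) subr0 normr1.
  by move=> /(_ _ hE); rewrite mulr1.
have bX := oint_mul_bound ler01 lG cX hX; rewrite -/G in bX.
apply: (le_trans (ler_normB _ _)); apply: (le_trans (lerD bE bX)).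
have -> : 2 * (M * nu) * (KM * (C2 * nu) + e1 * (M ^+ 2 / n)) + nu ^+ 2 * (KM * ((M + 1) ^+ 2 * (2 / n))) +
   (e1 * (C * nu) + KM * (C * nu ^+ 2)) * G = (e1 * al + be * nu) * nu.
  by rewrite /al /be; ring.
apply: ler_wpM2r; first exact: ltW.
have h1 : e1 * al <= e / 2.
  have -> : e / 2 = e1 * (al + 1) by rewrite /e1; field; rewrite gt_eqF // ltr_wpDl.
  by apply: ler_wpM2l; [exact: ltW|rewrite lerDl].
have h2 : be * nu <= e / 2.
  have -> : e / 2 = (be + 1) * n2 by rewrite /n2; field; rewrite gt_eqF // ltr_wpDl.
  by apply: ler_pM => //; [exact: ltW|rewrite lerDl].
by have := lerD h1 h2; clear; lra.
Qed.

End VariationJ.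

(** * The Sobolev norm and the action in terms of the transforms *)

Section Frechet.
Context {R : realType}.
Implicit Types (f g h v w K : R -> R) (a b c x y k M e d s t nu r : R) (z u : (R -> R) * (R -> R)).

Lemma abscont_diff v w a b : abscont v w -> 0 <= a -> a <= b -> b <= 1 ->
  (v b - v a) ^+ 2 <= normsq w.
Proof.
move=> [l2 vw] a0 ab b1; rewrite vw normsqE.
have lw2 : Lloc (fun x => w x ^+ 2) by case: l2.
have := CS ab (L2_cont (@cst_cont R 1)) l2; rewrite expr1n oint_cst mul1r.
under eq_fun do rewrite mul1r.
move=> /le_trans; apply; apply: (@le_trans _ _ (oint (fun x => w x ^+ 2) a b)).
  apply: ler_piMl; last by lra.
  by apply: oint_ge0 => // x _; exact: sqr_ge0.
by apply: oint_mono => // x; exact: sqr_ge0.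
Qed.

(** Averaging v s ^+ 2 <= 2 v y ^+ 2 + 2 (v s - v y) ^+ 2 over y in [0, 1]. *)
Lemma sobolev_sup sg v w : abscont v w -> sg ^+ 2 = 1 -> twist sg v ->
  forall s, v s ^+ 2 <= 2 * (normsq v + normsq w).
Proof.
move=> vw sg1 vs; apply: per_reduce => [s|s s0 s1]; first by rewrite vs exprMn sg1 mul1r.
have cv := AC_cont vw.
have lv2 : Lloc (fun x => v x ^+ 2) by apply: continuous_Lloc; exact: cont_sqr.
have pt (u : R) : 0 <= u <= 1 -> v s ^+ 2 <= 2 * v u ^+ 2 + 2 * normsq w.
  move=> /andP[u0 u1]; have : (v s - v u) ^+ 2 <= normsq w.
    have [us|/ltW su] := leP u s; first by apply: abscont_diff => //; exact: ltW.
    by rewrite -sqrrN opprB; apply: abscont_diff.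
  by have := sqr_ge0 (v s - 2 * v u); nra.
have -> : v s ^+ 2 = oint (fun=> v s ^+ 2) 0 1 by rewrite oint_cst; ring.
have -> : 2 * (normsq v + normsq w) = oint (fun u : R => 2 * v u ^+ 2 + 2 * normsq w) 0 1.
  rewrite ointD; [|exact: LlocZ|exact: continuous_Lloc (@cst_cont R _)].
  by rewrite ointZ // oint_cst -normsqE; ring.
apply: le_oint => //; first exact: continuous_Lloc (@cst_cont R _).
by apply: LlocD; [exact: LlocZ|exact: continuous_Lloc (@cst_cont R _)].
Qed.

Lemma twistP z : H1_twist z ->
  [/\ abscont z.1 (wderiv 2 z.1), abscont z.2 (wderiv 2 z.2), twist 1 z.1 & twist (-1) z.2].
Proof.
move=> [h1 h2 t1 t2]; have t0 : 0 < (2 : R) by [].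
have [_ a1] := wderivP t0 h1; have [_ a2] := wderivP t0 h2.
by split => // s; rewrite ?mul1r ?mulN1r.
Qed.

Lemma nloop1 z : H1_twist z -> 0 < normsq z.1 -> nloop 1 z.1 (wderiv 2 z.1).
Proof. by move=> /twistP[h1 _ h3 _] n0; split => //; rewrite expr1n. Qed.

Lemma nloop2 z : H1_twist z -> 0 < normsq z.2 -> nloop (-1) z.2 (wderiv 2 z.2).
Proof. by move=> /twistP[_ h1 _ h3] n0; split => //; rewrite sqrrN expr1n. Qed.

Lemma normsq_ge0 f : 0 <= normsq f.
Proof. by rewrite normsqE; apply: oint_ge0 => // x _; exact: sqr_ge0. Qed.

Lemma H1_norm_sq z : H1_norm z ^+ 2 = normsq z.1 + normsq (wderiv 2 z.1) +
   normsq z.2 + normsq (wderiv 2 z.2).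
Proof. by rewrite sqr_sqrtr // !addr_ge0 ?normsq_ge0. Qed.

Lemma H1_norm_ge0 z : 0 <= H1_norm z. Proof. exact: sqrtr_ge0. Qed.

Lemma H1_norm_le z nu : 2 * H1_norm z <= nu ->
  [/\ normsq z.1 <= nu ^+ 2, normsq (wderiv 2 z.1) <= nu ^+ 2, normsq z.2 <= nu ^+ 2 &
      normsq (wderiv 2 z.2) <= nu ^+ 2].
Proof.
have h0 := H1_norm_ge0 z; have e := H1_norm_sq z.
have n1 := normsq_ge0 z.1; have n2 := normsq_ge0 z.2.
have n3 := normsq_ge0 (wderiv 2 z.1); have n4 := normsq_ge0 (wderiv 2 z.2).
move: (normsq _) (normsq _) (normsq _) (normsq _) (H1_norm z) h0 e n1 n2 n3 n4 => A B C D h h0 e n1 n2 n3 n4 hnu.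
have hh : h ^+ 2 <= nu ^+ 2 by rewrite ler_sqr ?nnegrE; lra.
by split; lra.
Qed.

Lemma H1_norm_small u nu : H1_twist u -> 2 * H1_norm u <= nu -> 0 < nu ->
  small 1 u.1 nu /\ small (-1) u.2 nu.
Proof.
move=> tv hnu nu0; have [a1 a2 t1 t2] := twistP tv.
have m1 : (-1) ^+ 2 = 1 :> R by rewrite sqrrN expr1n.
have s1 := sobolev_sup a1 (expr1n _ 2) t1; have s2 := sobolev_sup a2 m1 t2.
have le_nu (x : R) : x ^+ 2 <= nu ^+ 2 -> `|x| <= nu.
  by move=> hx; rewrite -ler_sqr ?nnegrE ?normr_ge0 ?(ltW nu0) // real_normK ?num_real.
have h0 := H1_norm_ge0 u; have e := H1_norm_sq u.
have n1 := normsq_ge0 u.1; have n2 := normsq_ge0 u.2.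
have n3 := normsq_ge0 (wderiv 2 u.1); have n4 := normsq_ge0 (wderiv 2 u.2).
have [c1 c2] : continuous u.1 /\ continuous u.2 by split; [exact: AC_cont a1|exact: AC_cont a2].
move: (normsq _) (normsq _) (normsq _) (normsq _) (H1_norm u) h0 e hnu n1 n2 n3 n4 s1 s2 {a1 a2}.
move=> B D A C h h0 e hnu n1 n2 n3 n4 s1 s2.
have hh : 4 * h ^+ 2 <= nu ^+ 2.
  have -> : 4 * h ^+ 2 = (2 * h) ^+ 2 by ring.
  by rewrite ler_sqr ?nnegrE; lra.
split; split => // s; apply: le_nu; [have := s1 s|have := s2 s]; lra.
Qed.

Lemma twist_add z u : H1_twist z -> H1_twist u -> H1_twist (z + u).
Proof.
have H1D f g : H1 2 f -> H1 2 g -> H1 2 (fun s => f s + g s).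
  move=> hf hg; have t0 : 0 < (2 : R) by [].
  have [p1 a1] := wderivP t0 hf; have [p2 a2] := wderivP t0 hg.
  have [_ q1 _] := hf; have [_ q2 _] := hg.
  apply: (AC_H1 (g := fun s => wderiv 2 f s + wderiv 2 g s)) => //; last exact: AC_D.
    by move=> s; rewrite q1 q2.
  by move=> s; rewrite p1 p2.
move=> [h1 h2 t1 t2] [h1' h2' t1' t2']; split; [exact: H1D|exact: H1D| |].
  by move=> s /=; rewrite !fctE t1 t1'.
by move=> s /=; rewrite !fctE t2 t2' opprD.
Qed.

Lemma wderivD f g : H1 2 f -> H1 2 g ->
  normsq (wderiv 2 (fun s => f s + g s)) = normsq (fun s => wderiv 2 f s + wderiv 2 g s).
Proof.
move=> hf hg; have t0 : 0 < (2 : R) by [].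
have [p1 a1] := wderivP t0 hf; have [p2 a2] := wderivP t0 hg.
have [_ q1 _] := hf; have [_ q2 _] := hg.
have hfg : H1 2 (fun s => f s + g s).
  apply: (AC_H1 (g := fun s => wderiv 2 f s + wderiv 2 g s)) => //; last exact: AC_D.
    by move=> s; rewrite q1 q2.
  by move=> s; rewrite p1 p2.
have [_ a3] := wderivP t0 hfg.
by rewrite !normsqE; apply: AC_uniq_sq a3 _; exact: AC_D.
Qed.

Lemma gapE z s : sqloop z.1 -> gap z s = lc z.1 (timechange z.1 s) - lc z.2 (timechange z.1 s).
Proof. by move=> fl; rewrite /lc (q_timechange fl). Qed.

Lemma gap_gt0 z : sqloop z.1 -> (forall s, 0 < gap z s) <-> (forall t, lc z.2 t < lc z.1 t).
Proof.
move=> fl; split => [h t|h s]; last by rewrite gapE // subr_gt0.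
by have [s <-] := timechange_onto fl t; rewrite -subr_gt0 -gapE.
Qed.

(** The substitution t = T s. *)
Lemma actIE z : H1_twist z -> 0 < normsq z.1 -> 0 < normsq z.2 ->
  (forall t, lc z.2 t < lc z.1 t) ->
  actI z = - oint (fun t => (lc z.1 t - lc z.2 t)^-1) 0 1.
Proof.
move=> tz n1 n2 q12; have fl1 := nloop1 tz n1; have fl2 := nloop2 tz n2.
have fl : sqloop z.1 by case: fl1 => h1 h2 h3 h4; exact: (twist_sqloop h1 h2 h3 h4).
have cK : continuous (fun t => (lc z.1 t - lc z.2 t)^-1).
  apply: contV; first by apply: contB; [exact: (lc_cont fl1)|exact: (lc_cont fl2)].
  by move=> t; rewrite gt_eqF // subr_gt0.
have := q_substitution fl 0 1 cK; rewrite timechange0 (timechange1 fl) => <-.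
rewrite /actI pintE // mulNr; congr (- _).
rewrite -ointZ; last first.
  have -> : (fun s => z.1 s ^+ 2 / gap z s) = (fun s => z.1 s ^+ 2 * (fun t => (lc z.1 t - lc z.2 t)^-1) (timechange z.1 s)).
    by apply/funext => s; rewrite gapE.
  apply: continuous_Lloc; apply: contM; first by apply: cont_sqr; case: fl.
  by apply: (@cont_comp R (fun t => (lc z.1 t - lc z.2 t)^-1)) => //; exact: timechange_cont.
by congr oint; apply/funext => s; rewrite gapE //; ring.
Qed.

Lemma actAE z : H1_twist z -> 0 < normsq z.1 -> 0 < normsq z.2 ->
  actA z = - (mean (lc z.1) - mean (lc z.2))^-1.
Proof.
move=> tz n1 n2; rewrite (lc_mean (nloop1 tz n1)) (lc_mean (nloop2 tz n2)) /actA; congr (- _).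
have -> : normsq (fun s => z.1 s ^+ 2) / normsq z.1 - normsq (fun s => z.2 s ^+ 2) / normsq z.2 =
   (normsq (fun s => z.1 s ^+ 2) * normsq z.2 - normsq (fun s => z.2 s ^+ 2) * normsq z.1) /
   (normsq z.1 * normsq z.2) by field; rewrite !gt_eqF.
by rewrite invf_div.
Qed.

End Frechet.

(** * Frechet differential of the action *)

Section ActionDifferential.
Context {R : realType}.
Implicit Types (f g h v w K : R -> R) (a b c x y k M e d s t nu r : R) (z u : (R -> R) * (R -> R)).

Lemma quot_expand (N x : R) : 0 < N -> N / 2 <= N + x ->
  `|2 / (N + x) - 2 / N + 2 * x / N ^+ 2| <= 4 * x ^+ 2 / N ^+ 3.
Proof.
move=> N0 Nx; have Nx0 : 0 < N + x by lra.
have -> : 2 / (N + x) - 2 / N + 2 * x / N ^+ 2 = 2 * x ^+ 2 / N ^+ 2 / (N + x).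
  by field; rewrite !gt_eqF.
have p : 0 <= 2 * x ^+ 2 / N ^+ 2.
  by apply: divr_ge0; [apply: mulr_ge0 => //; exact: sqr_ge0|exact: sqr_ge0].
rewrite ger0_norm; last by apply: divr_ge0 => //; exact: ltW.
have -> : 4 * x ^+ 2 / N ^+ 3 = 2 * x ^+ 2 / N ^+ 2 * (2 / N) by field; rewrite gt_eqF.
apply: ler_wpM2l => //.
by rewrite -[2 / N]invf_div lef_pV2 ?posrE //; apply: divr_gt0; lra.
Qed.

(** Expansion of 2 N D + 2 / N when N and D get the increments 2 a + b and 2 c + d,
    where a, c are the first order and b, d the second order parts. *)
Lemma kinetic_expand (N D A : R) : 0 < N -> 0 <= D -> 0 <= A ->
  exists2 C : R, 0 <= C & forall a b c d nu, 0 < nu -> nu <= 1 ->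
   `|a| <= A * nu -> `|c| <= A * nu -> 0 <= b <= nu ^+ 2 -> 0 <= d <= nu ^+ 2 ->
   N / 2 <= N + 2 * a + b ->
   `|2 * (N + 2 * a + b) * (D + 2 * c + d) + 2 / (N + 2 * a + b) - (2 * N * D + 2 / N)
     - (4 * N * c + (4 * D - 4 / N ^+ 2) * a)| <= C * nu ^+ 2.
Proof.
move=> N0 D0 A0; have N2 : 0 < N ^+ 2 by exact: exprn_gt0.
have N3 : 0 < N ^+ 3 by exact: exprn_gt0.
exists (2 * (N + 4 * A ^+ 2 + 2 * A + D + 2 * A + 1) + 4 * (2 * A + 1) ^+ 2 / N ^+ 3 + 2 / N ^+ 2).
  by rewrite !addr_ge0 // ?mulr_ge0 ?addr_ge0 ?mulr_ge0 ?sqr_ge0 ?invr_ge0 ?(ltW N2) ?(ltW N3) ?(ltW N0).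
move=> a b c d nu nu0 nu1 ha hc /andP[b0 bn] /andP[d0 dn] Nab.
have nn : nu ^+ 2 <= nu by rewrite expr2; apply: ler_piMl; lra.
have nn0 : 0 <= nu ^+ 2 by exact: sqr_ge0.
pose x := 2 * a + b.
have Nx : N / 2 <= N + x by rewrite /x; lra.
have -> : 2 * (N + 2 * a + b) * (D + 2 * c + d) + 2 / (N + 2 * a + b) - (2 * N * D + 2 / N)
     - (4 * N * c + (4 * D - 4 / N ^+ 2) * a) =
   2 * (N * d + 4 * (a * c) + 2 * (a * d) + b * D + 2 * (b * c) + b * d) +
   (2 / (N + x) - 2 / N + 2 * x / N ^+ 2) - 2 * b / N ^+ 2.
  have -> : N + x = N + 2 * a + b by rewrite /x; ring.
  by rewrite /x; field; apply/andP; split; rewrite gt_eqF //; lra.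
have hx : `|x| <= (2 * A + 1) * nu.
  rewrite /x; apply: (le_trans (ler_normD _ _)); rewrite normrM (ger0_norm b0) ger0_norm //; lra.
have hx2 : x ^+ 2 <= (2 * A + 1) ^+ 2 * nu ^+ 2.
  rewrite -exprMn -(real_normK (num_real x)) ler_sqr ?nnegrE //.
  by apply: mulr_ge0; lra.
have q := quot_expand N0 Nx.
have q' : 4 * x ^+ 2 / N ^+ 3 <= 4 * (2 * A + 1) ^+ 2 / N ^+ 3 * nu ^+ 2.
  have -> : 4 * (2 * A + 1) ^+ 2 / N ^+ 3 * nu ^+ 2 = 4 * ((2 * A + 1) ^+ 2 * nu ^+ 2) / N ^+ 3 by ring.
  by apply: ler_wpM2r; [rewrite invr_ge0 ltW|apply: ler_wpM2l].
have h1 : `|2 * b / N ^+ 2| <= 2 / N ^+ 2 * nu ^+ 2.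
  rewrite ger0_norm; last by apply: divr_ge0; [exact: mulr_ge0|exact: ltW].
  have -> : 2 / N ^+ 2 * nu ^+ 2 = 2 * nu ^+ 2 / N ^+ 2 by ring.
  by apply: ler_wpM2r; [rewrite invr_ge0 ltW|apply: ler_wpM2l].
have an : A * nu <= A by apply: ler_piMr.
have hac : `|a * c| <= A ^+ 2 * nu ^+ 2.
  by rewrite normrM -exprMn expr2; apply: ler_pM.
have had : `|a * d| <= A * nu ^+ 2.
  by rewrite normrM (ger0_norm d0); apply: ler_pM => //; exact: le_trans an.
have hbc : `|b * c| <= A * nu ^+ 2.
  by rewrite mulrC normrM (ger0_norm b0); apply: ler_pM => //; exact: le_trans an.
have hbd : `|b * d| <= nu ^+ 2.
  rewrite normrM (ger0_norm d0) (ger0_norm b0) -[X in _ <= X]mul1r; apply: ler_pM => //; lra.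
have hNd : `|N * d| <= N * nu ^+ 2.
  by rewrite normrM (gtr0_norm N0) (ger0_norm d0); apply: ler_wpM2l => //; exact: ltW.
have hbD : `|b * D| <= D * nu ^+ 2.
  by rewrite mulrC normrM (ger0_norm D0) (ger0_norm b0); apply: ler_wpM2l.
have t1 := le_trans q q'.
rewrite ![(_ + 2 / N ^+ 2) * _]mulrDl [(_ + 4 * _ / _) * _]mulrDl.
move: (2 / (N + x) - 2 / N + 2 * x / N ^+ 2) (4 * (2 * A + 1) ^+ 2 / N ^+ 3 * nu ^+ 2) (2 * b / N ^+ 2) (2 / N ^+ 2 * nu ^+ 2) t1 h1 => X1 X2 X3 X4 t1 h1.
move: (a * c) (a * d) (b * c) (b * d) (N * d) (b * D) hac had hbc hbd hNd hbD => Y1 Y2 Y3 Y4 Y5 Y6 hac had hbc hbd hNd hbD.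
move: t1 h1 hac had hbc hbd hNd hbD; rewrite !ler_norml; clear.
move=> /andP[? ?] /andP[? ?] /andP[? ?] /andP[? ?] /andP[? ?] /andP[? ?] /andP[? ?] /andP[? ?].
by apply/andP; split; lra.
Qed.

(** The differential of [actQ] at f. *)
Definition dQ f v : R :=
  4 * normsq f * oint (fun s => wderiv 2 f s * wderiv 2 v s) 0 1 +
  (4 * normsq (wderiv 2 f) - 4 / normsq f ^+ 2) * oint (fun s => f s * v s) 0 1.

Lemma CS_normsq f g : L2 f -> L2 g -> `|oint (fun s => f s * g s) 0 1| <= Num.sqrt (normsq f) * Num.sqrt (normsq g).
Proof.
move=> lf lg; rewrite -sqrtrM ?normsq_ge0 // -sqrtr_sqr; apply: ler_wsqrtr.
by rewrite !normsqE; apply: CS.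
Qed.

Lemma actQ_vary f : H1 2 f -> 0 < normsq f -> exists2 C : R, 0 <= C & forall v nu,
  H1 2 v -> 0 < nu -> nu <= 1 -> normsq v <= nu ^+ 2 -> normsq (wderiv 2 v) <= nu ^+ 2 ->
  normsq f / 2 <= normsq (fun s => f s + v s) ->
  `|actQ (fun s => f s + v s) - actQ f - dQ f v| <= C * nu ^+ 2.
Proof.
move=> hf N0; have t0 : 0 < (2 : R) by [].
have [_ af] := wderivP t0 hf.
pose A := Num.sqrt (normsq f) + Num.sqrt (normsq (wderiv 2 f)).
have A0 : 0 <= A by rewrite addr_ge0 // sqrtr_ge0.
have [C C0 hC] := kinetic_expand N0 (normsq_ge0 (wderiv 2 f)) A0.
exists C => // v nu hv nu0 nu1 v1 w1 Nv.
have [_ av] := wderivP t0 hv.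
have l2f : L2 f by apply: L2_cont; exact: AC_cont af.
have l2v : L2 v by apply: L2_cont; exact: AC_cont av.
have [l2g _] := af; have [l2w _] := av.
have expand (p q : R -> R) : L2 p -> L2 q ->
    normsq (fun s => p s + q s) = normsq p + 2 * oint (fun s => p s * q s) 0 1 + normsq q.
  move=> lp lq; rewrite !normsqE -ointZ; last exact: L2M.
  have i1 : Lloc (fun s => p s ^+ 2) by case: lp.
  have i2 : Lloc (fun s => q s ^+ 2) by case: lq.
  have i3 : Lloc (fun s => 2 * (p s * q s)) by apply: LlocZ; exact: L2M.
  rewrite -(ointD 0 1 i1 i3) -(ointD 0 1 (LlocD i1 i3) i2).
  by congr oint; apply/funext => s; ring.
have rt (X : R) : X <= nu ^+ 2 -> Num.sqrt X <= nu.
  by move=> hX; rewrite -(ger0_norm (ltW nu0)) -sqrtr_sqr; exact: ler_wsqrtr.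
have sn (p : R -> R) : 0 <= Num.sqrt (normsq p) by exact: sqrtr_ge0.
rewrite /actQ (wderivD hf hv) (expand _ _ l2f l2v) (expand _ _ l2g l2w).
rewrite (expand _ _ l2f l2v) in Nv.
apply: hC => //.
- apply: (le_trans (CS_normsq l2f l2v)); apply: ler_pM => //; last exact: rt.
  by rewrite /A lerDl.
- apply: (le_trans (CS_normsq l2g l2w)); apply: ler_pM => //; last exact: rt.
  by rewrite /A lerDr.
- by rewrite normsq_ge0.
- by rewrite normsq_ge0.
Qed.

(** The repulsion between the two electrons, equal in size for both. *)
Definition Kforce r z t : R :=
  r / (lc z.1 t - lc z.2 t) ^+ 2 + (1 - r) / (mean (lc z.1) - mean (lc z.2)) ^+ 2.

(** The forces enter with opposite signs, since the interaction depends on q_1 - q_2. *)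
Definition Bdiff r z u : R := dQ z.1 u.1 + dQ z.2 u.2 +
  dlc z.1 (wderiv 2 z.1) (Kforce r z) u.1 - dlc z.2 (wderiv 2 z.2) (Kforce r z) u.2.

Lemma inv_expand (p q m : R) : 0 < m -> m <= p -> m / 2 <= q ->
  `|- q^-1 + p^-1 - (q - p) / p ^+ 2| <= 2 / m ^+ 3 * (q - p) ^+ 2.
Proof.
move=> m0 mp mq; have p0 : 0 < p by lra.
have q0 : 0 < q by lra.
have -> : - q^-1 + p^-1 - (q - p) / p ^+ 2 = - ((q - p) ^+ 2 * (p ^+ 2 * q)^-1).
  by field; rewrite !gt_eqF.
rewrite normrN ger0_norm; last first.
  by rewrite mulr_ge0 ?sqr_ge0 // invr_ge0 mulr_ge0 ?sqr_ge0 // ltW.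
rewrite mulrC; apply: ler_wpM2r; first exact: sqr_ge0.
have -> : 2 / m ^+ 3 = (m ^+ 2 * (m / 2))^-1 by field; rewrite gt_eqF.
rewrite lef_pV2 ?posrE; first last.
- by rewrite mulr_gt0 ?exprn_gt0 //; lra.
- by rewrite mulr_gt0 ?exprn_gt0.
by apply: ler_pM; rewrite ?sqr_ge0 ?ler_sqr ?nnegrE //; lra.
Qed.

End ActionDifferential.

Section TotalDifferential.
Context {R : realType}.
Implicit Types (f g h v w K : R -> R) (a b c x y k M e d s t nu r : R) (z u : (R -> R) * (R -> R)).

Lemma Htilde_nloops z : Htilde_in z ->
  [/\ H1_twist z, nloop 1 z.1 (wderiv 2 z.1), nloop (-1) z.2 (wderiv 2 z.2) &
      forall t, lc z.2 t < lc z.1 t].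
Proof.
move=> [tz n1 n2 g0]; have fl1 := nloop1 tz n1; split => //; first exact: nloop2.
by apply/gap_gt0 => //; case: fl1 => h1 h2 h3 h4; exact: (twist_sqloop h1 h2 h3 h4).
Qed.

Lemma Htilde_gapP z : H1_twist z -> 0 < normsq z.1 -> 0 < normsq z.2 ->
  (forall t, lc z.2 t < lc z.1 t) -> Htilde_in z.
Proof.
move=> tz n1 n2 q12; split => //; apply/gap_gt0 => //.
by have [h1 h2 h3 h4] := nloop1 tz n1; exact: (twist_sqloop h1 h2 h3 h4).
Qed.

Lemma gap_min z : Htilde_in z -> exists2 m : R, 0 < m & forall t, m <= lc z.1 t - lc z.2 t.
Proof.
move=> /Htilde_nloops[tz fl1 fl2 q12].
have p0 t : 0 < lc z.1 t - lc z.2 t by rewrite subr_gt0.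
have cp : continuous (fun t => (lc z.1 t - lc z.2 t)^-1).
  apply: contV; first by apply: contB; [exact: (lc_cont fl1)|exact: (lc_cont fl2)].
  by move=> t; rewrite gt_eqF.
have pp t : (lc z.1 (t + 1) - lc z.2 (t + 1))^-1 = (lc z.1 t - lc z.2 t)^-1.
  by rewrite (lc_periodic fl1) (lc_periodic fl2).
have [M M0 hM] := per_bound cp pp.
exists M^-1; first by rewrite invr_gt0.
move=> t; have := hM t; rewrite gtr0_norm ?invr_gt0 // => h.
by rewrite -[leRHS]invrK lef_pV2 ?posrE ?invr_gt0.
Qed.

Lemma Htilde_vary z e : Htilde_in z -> 0 < e ->
  exists nu0 : R, [/\ 0 < nu0, nu0 <= 1 & forall u nu, H1_twist u -> 2 * H1_norm u <= nu ->
     0 < nu -> nu <= nu0 ->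
   [/\ normsq z.1 / 2 <= normsq (z + u).1, normsq z.2 / 2 <= normsq (z + u).2 &
    forall t, ((lc (z + u).1 t - lc (z + u).2 t) - (lc z.1 t - lc z.2 t)) ^+ 2 <= e * nu]].
Proof.
move=> /Htilde_nloops[tz fl1 fl2 q12] e0.
have [C1 [n1 [C10 n10 n11 h1]]] := vary_bounds fl1.
have [C2 [n2 [C20 n20 n21 h2]]] := vary_bounds fl2.
have e40 : 0 < e / 4 by lra.
have [n3 n30 h3] := lc_vary fl1 e40.
have [n4 n40 h4] := lc_vary fl2 e40.
exists (Num.min (Num.min n1 n2) (Num.min n3 n4)); split.
- by rewrite !lt_min n10 n20 n30.
- by rewrite !ge_min n11.
move=> u nu tu hu nu0; rewrite !le_min => /andP[/andP[m1 m2] /andP[m3 m4]].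
have [s1 s2] := H1_norm_small tu hu nu0.
have [b1 _ _ _] := h1 _ _ s1 m1; have [b2 _ _ _] := h2 _ _ s2 m2.
split => // t; have := h3 _ _ s1 m3 t; have := h4 _ _ s2 m4 t.
have -> : (z + u).1 = (fun s => z.1 s + u.1 s) by [].
have -> : (z + u).2 = (fun s => z.2 s + u.2 s) by [].
move: (lc (fun s => z.1 s + u.1 s) t) (lc (fun s => z.2 s + u.2 s) t) (lc z.1 t) (lc z.2 t).
clear => p q p' q'; have := sqr_ge0 ((p - p') + (q - q')); nra.
Qed.

Lemma Htilde_open z : Htilde_in z -> exists2 nu0 : R, 0 < nu0 &
  forall u nu, H1_twist u -> 2 * H1_norm u <= nu -> 0 < nu -> nu <= nu0 -> Htilde_in (z + u).
Proof.
move=> hz; have [m m0 hm] := gap_min hz.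
have [nu1 [n10 n11 hv]] := Htilde_vary hz ltr01.
have [tz n1 n2 _] := hz.
exists (Num.min nu1 (m ^+ 2 / 4)); first by rewrite lt_min n10 divr_gt0 ?exprn_gt0.
move=> u nu tu hu nu0; rewrite le_min => /andP[a1 a2].
have [b1 b2 b3] := hv u nu tu hu nu0 a1.
apply: Htilde_gapP; [exact: twist_add|by apply: lt_le_trans b1; apply: divr_gt0|by apply: lt_le_trans b2; apply: divr_gt0|].
move=> t; have := b3 t; have := hm t; rewrite -subr_gt0 mul1r.
move: (lc (z + u).1 t - lc (z + u).2 t) (lc z.1 t - lc z.2 t) a2; move: m0; clear => m0 p q a2 mq pq.
have : (p - q) ^+ 2 <= (m / 2) ^+ 2 by apply: le_trans pq (le_trans a2 _); rewrite expr_div_n; lra.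
rewrite -[X in X <= _](real_normK (num_real (p - q))) ler_sqr ?nnegrE //; last lra.
by rewrite ler_norml => /andP[]; lra.
Qed.

Lemma Kforce_cont r z : Htilde_in z -> continuous (Kforce r z).
Proof.
move=> /Htilde_nloops[tz fl1 fl2 q12].
apply: contD; last exact: cst_cont.
apply: contM; first exact: cst_cont.
apply: contV => [|t]; last by rewrite expf_neq0 // gt_eqF // subr_gt0.
by apply: cont_sqr; apply: contB; [exact: (lc_cont fl1)|exact: (lc_cont fl2)].
Qed.

Lemma Kforce_periodic r z t : Htilde_in z -> Kforce r z (t + 1) = Kforce r z t.
Proof.
move=> /Htilde_nloops[tz fl1 fl2 q12].
by rewrite /Kforce (lc_periodic fl1) (lc_periodic fl2).
Qed.

Lemma B_actE r z : B_act r z = actQ z.1 + actQ z.2 + r * actI z + (1 - r) * actA z.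
Proof. by rewrite /B_act /B_in /B_av; ring. Qed.

Lemma meanE f : mean f = oint f 0 1. Proof. by rewrite /mean pintE. Qed.

Lemma mean_sq h c : continuous h -> (forall t, h t ^+ 2 <= c) -> oint h 0 1 ^+ 2 <= c.
Proof.
move=> ch hc; have := CS ler01 (L2_cont (@cst_cont R 1)) (L2_cont ch).
have -> : (fun x => 1 * h x) = h by apply/funext => x; rewrite mul1r.
rewrite expr1n oint_cst mul1r subr0 mul1r => /le_trans; apply.
have -> : c = oint (fun=> c) 0 1 by rewrite oint_cst subr0 mulr1.
apply: le_oint => //; apply: continuous_Lloc; [exact: cont_sqr|exact: cst_cont].
Qed.

(** The interaction as a function of the two transforms. *)
Definition interaction r (a1 a2 : R -> R) : R :=
  - (r * oint (fun t => (a1 t - a2 t)^-1) 0 1 + (1 - r) * (oint a1 0 1 - oint a2 0 1)^-1).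

(** First order expansion: K is the derivative of the interaction with
    respect to q_1 - q_2, and the remainder is quadratic in the uniform norm. *)
Lemma interaction_vary r (a1 a2 b1 b2 K : R -> R) m c : 0 <= r -> r <= 1 ->
  continuous a1 -> continuous a2 -> continuous b1 -> continuous b2 -> continuous K ->
  0 < m -> (forall t, m <= a1 t - a2 t) ->
  (forall t, ((b1 t - b2 t) - (a1 t - a2 t)) ^+ 2 <= c) -> c <= (m / 2) ^+ 2 ->
  (forall t, K t = r / (a1 t - a2 t) ^+ 2 + (1 - r) / (oint a1 0 1 - oint a2 0 1) ^+ 2) ->
  `|interaction r b1 b2 - interaction r a1 a2 -
    (oint (fun t => b1 t * K t) 0 1 - oint (fun t => a1 t * K t) 0 1 -
     (oint (fun t => b2 t * K t) 0 1 - oint (fun t => a2 t * K t) 0 1))| <= 2 / m ^+ 3 * c.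
Proof.
move=> r0 r1 ca1 ca2 cb1 cb2 cK m0 hm hc cm eK.
pose p t := a1 t - a2 t; pose q t := b1 t - b2 t.
have cp : continuous p by exact: contB.
have cq : continuous q by exact: contB.
have m3 : 0 <= 2 / m ^+ 3 by rewrite divr_ge0 // exprn_ge0 // ltW.
have qm t : m / 2 <= q t.
  have : `|q t - p t| <= m / 2.
    rewrite -ler_sqr ?nnegrE ?divr_ge0 ?(ltW m0) // real_normK ?num_real //.
    exact: le_trans (hc t) cm.
  have := hm t; rewrite -/(p t) ler_norml; move: (q t) (p t); clear => x y ? /andP[]; lra.
have p0 t : p t != 0 by rewrite gt_eqF //; exact: lt_le_trans (hm t).
have q0 t : q t != 0 by rewrite gt_eqF //; apply: lt_le_trans (qm t); rewrite divr_gt0.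
have lp : forall h, continuous h -> Lloc h by exact: continuous_Lloc.
have lcst (k : R) : Lloc (fun _ : R => k) by apply: lp; exact: cst_cont.
set P := oint a1 0 1 - oint a2 0 1 in eK; pose Q := oint b1 0 1 - oint b2 0 1.
have eP : P = oint p 0 1 by rewrite (ointB 0 1 (lp _ ca1) (lp _ ca2)).
have eQ : Q = oint q 0 1 by rewrite (ointB 0 1 (lp _ cb1) (lp _ cb2)).
have mP : m <= P.
  have -> : m = oint (fun=> m) 0 1 by rewrite oint_cst subr0 mulr1.
  rewrite eP; exact: (le_oint ler01 (lcst m) (lp _ cp) (fun t _ => hm t)).
have mQ : m / 2 <= Q.
  have -> : m / 2 = oint (fun=> m / 2) 0 1 by rewrite oint_cst subr0 mulr1.
  rewrite eQ; exact: (le_oint ler01 (lcst (m / 2)) (lp _ cq) (fun t _ => qm t)).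
have cqp : continuous (fun t => q t - p t) by exact: contB.
have bQP : (Q - P) ^+ 2 <= c by rewrite eQ eP -(ointB 0 1 (lp _ cq) (lp _ cp)); exact: mean_sq.
have P0 : P != 0 by rewrite gt_eqF //; exact: lt_le_trans m0 mP.
pose S t := - (q t)^-1 + (p t)^-1 - (q t - p t) / p t ^+ 2.
have cqp2 : continuous (fun t => (q t - p t) / p t ^+ 2).
  by apply: contM => //; apply: contV; [exact: cont_sqr|move=> t; rewrite expf_neq0].
have cVq := contV cq q0; have cVp := contV cp p0.
have bS : `|oint S 0 1| <= 2 / m ^+ 3 * c.
  have lS : Lloc S by apply: lp; apply: contB => //; apply: contD => //; exact: contN.
  have := oint_bound lS (M := 2 / m ^+ 3 * c) (a := 0) (b := 1).
  rewrite subr0 normr1 mulr1; apply => t _.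
  apply: le_trans (inv_expand m0 (hm t) (qm t)) _.
  by apply: ler_wpM2l => //; exact: hc.
have bA : `|- Q^-1 + P^-1 - (Q - P) / P ^+ 2| <= 2 / m ^+ 3 * c.
  by apply: le_trans (inv_expand m0 mP mQ) _; apply: ler_wpM2l.
have eS : oint S 0 1 = - oint (fun t => (q t)^-1) 0 1 + oint (fun t => (p t)^-1) 0 1 - oint (fun t => (q t - p t) / p t ^+ 2) 0 1.
  rewrite (ointB 0 1 (LlocD (LlocN (lp _ cVq)) (lp _ cVp)) (lp _ cqp2)).
  by rewrite (ointD 0 1 (LlocN (lp _ cVq)) (lp _ cVp)) (ointN 0 1 (lp _ cVq)).
have eJ : oint (fun t => b1 t * K t) 0 1 - oint (fun t => a1 t * K t) 0 1 -
     (oint (fun t => b2 t * K t) 0 1 - oint (fun t => a2 t * K t) 0 1) =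
   r * oint (fun t => (q t - p t) / p t ^+ 2) 0 1 + (1 - r) * ((Q - P) / P ^+ 2).
  have l0 := lp _ cqp; have l2 := lp _ cqp2.
  have -> : (1 - r) * ((Q - P) / P ^+ 2) = ((1 - r) / P ^+ 2) * oint (fun t => q t - p t) 0 1.
    by rewrite (ointB 0 1 (lp _ cq) (lp _ cp)) -eQ -eP; ring.
  have l1 := lp _ (contM ca1 cK); have l3 := lp _ (contM ca2 cK).
  have l4 := lp _ (contM cb1 cK); have l5 := lp _ (contM cb2 cK).
  rewrite -(ointB 0 1 l4 l1) -(ointB 0 1 l5 l3) -(ointB 0 1 (LlocB l4 l1) (LlocB l5 l3)).
  rewrite -(ointZ r 0 1 l2) -(ointZ ((1 - r) / P ^+ 2) 0 1 l0).
  rewrite -(ointD 0 1 (LlocZ r l2) (LlocZ ((1 - r) / P ^+ 2) l0)).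
  congr oint; apply/funext => t; rewrite eK /q /p; field.
  by rewrite P0 -/(p t) p0.
rewrite eJ /interaction -/P -/Q.
have -> : 2 / m ^+ 3 * c = r * (2 / m ^+ 3 * c) + (1 - r) * (2 / m ^+ 3 * c) by ring.
have -> : - (r * oint (fun t => (b1 t - b2 t)^-1) 0 1 + (1 - r) / Q) - - (r * oint (fun t => (a1 t - a2 t)^-1) 0 1 + (1 - r) / P) -
    (r * oint (fun t => (q t - p t) / p t ^+ 2) 0 1 + (1 - r) * ((Q - P) / P ^+ 2)) =
    r * oint S 0 1 + (1 - r) * (- Q^-1 + P^-1 - (Q - P) / P ^+ 2) by rewrite eS /q /p; ring.
apply: (le_trans (ler_normD _ _)); rewrite !normrM (ger0_norm r0) (ger0_norm (_ : 0 <= 1 - r)) ?subr_ge0 //.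
by apply: lerD; apply: ler_wpM2l; rewrite ?subr_ge0.
Qed.

Lemma B_interaction r z : Htilde_in z ->
  B_act r z = actQ z.1 + actQ z.2 + interaction r (lc z.1) (lc z.2).
Proof.
move=> hz; have [tz n1 n2 _] := hz; have [_ _ _ q12] := Htilde_nloops hz.
rewrite B_actE (actIE tz n1 n2 q12) (actAE tz n1 n2) !meanE /interaction; ring.
Qed.

Lemma increment5 (x1 x2 y1 y2 i c1 c2 E : R) :
  `|x1| <= c1 -> `|x2| <= c2 -> c1 + c2 <= E -> `|y1| <= E -> `|y2| <= E -> `|i| <= E ->
  `|x1 + x2 + i + (y1 - y2)| <= 4 * E.
Proof.
rewrite !ler_norml => /andP[? ?] /andP[? ?] ? /andP[? ?] /andP[? ?] /andP[? ?].
by apply/andP; split; lra.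
Qed.

(** The error is quadratic for the kinetic part, o(nu) for the linear part of the
    interaction by [lc_integral_vary], and quadratic in the increment of the transforms,
    hence again o(nu), for the rest. *)
Lemma B_frechet r z : 0 <= r <= 1 -> Htilde_in z -> forall e, 0 < e ->
  exists2 nu0 : R, 0 < nu0 & forall u nu, H1_twist u -> 2 * H1_norm u <= nu -> 0 < nu -> nu <= nu0 ->
  `|B_act r (z + u) - B_act r z - Bdiff r z u| <= e * nu.
Proof.
move=> /andP[r0 r1] hz e e0.
have [tz fl1 fl2 q12] := Htilde_nloops hz.
have [_ n1 n2 _] := hz; have [h1 h2 _ _] := tz.
have [m m0 hm] := gap_min hz.
have cK : continuous (Kforce r z) by exact: Kforce_cont.
have Kp t : Kforce r z (t + 1) = Kforce r z t by exact: Kforce_periodic.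
have [C1 C10 hC1] := actQ_vary h1 n1; have [C2 C20 hC2] := actQ_vary h2 n2.
have e4 : 0 < e / 4 by lra.
have [nJ1 nJ10 hJ1] := lc_integral_vary fl1 cK Kp e4.
have [nJ2 nJ20 hJ2] := lc_integral_vary fl2 cK Kp e4.
have [nO nO0 hO] := Htilde_open hz.
pose e1 := e * m ^+ 3 / 8.
have m30 : 0 < m ^+ 3 by exact: exprn_gt0.
have e10 : 0 < e1 by rewrite /e1 divr_gt0 // mulr_gt0.
have [nV [nV0 nV1 hV]] := Htilde_vary hz e10.
pose nC := e / (4 * (C1 + C2 + 1)).
have C0 : 0 < C1 + C2 + 1 by rewrite ltr_wpDl // addr_ge0.
have nC0 : 0 < nC by rewrite divr_gt0 // mulr_gt0.
pose nm := m ^+ 2 / (4 * e1).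
have nm0 : 0 < nm by rewrite divr_gt0 ?exprn_gt0 // mulr_gt0.
exists (Num.min (Num.min nJ1 nJ2) (Num.min (Num.min nO nV) (Num.min nC nm))).
  by rewrite !lt_min nJ10 nJ20 nO0 nV0 nC0.
move=> u nu tu hu nu0; rewrite !le_min.
move=> /andP[/andP[lJ1 lJ2] /andP[/andP[lO lV] /andP[lC lm]]].
have hzu := hO u nu tu hu nu0 lO.
have [_ flu1 flu2 q12u] := Htilde_nloops hzu.
have [tzu nu1' nu2' _] := hzu.
have [b1 b2 b3] := hV u nu tu hu nu0 lV.
have [s1 s2] := H1_norm_small tu hu nu0.
have [H1u H2u _ _] := tu; have [a1 a2 _ _] := twistP tu.
have [k1 k2 k3 k4] := H1_norm_le hu.
have nule1 : nu <= 1 by exact: le_trans lV nV1.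
have eu1 : (z + u).1 = (fun s => z.1 s + u.1 s) by [].
have eu2 : (z + u).2 = (fun s => z.2 s + u.2 s) by [].
have X1 : `|actQ (z + u).1 - actQ z.1 - dQ z.1 u.1| <= C1 * nu ^+ 2.
  by move: b1; rewrite eu1 => b1; exact: (hC1 _ _ H1u nu0 nule1 k1 k2 b1).
have X2 : `|actQ (z + u).2 - actQ z.2 - dQ z.2 u.2| <= C2 * nu ^+ 2.
  by move: b2; rewrite eu2 => b2; exact: (hC2 _ _ H2u nu0 nule1 k3 k4 b2).
pose J f := oint (fun t => lc f t * Kforce r z t) 0 1.
have Y1 : `|J (z + u).1 - J z.1 - dlc z.1 (wderiv 2 z.1) (Kforce r z) u.1| <= e / 4 * nu.
  by rewrite /J eu1; exact: (hJ1 _ _ _ a1 s1 lJ1).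
have Y2 : `|J (z + u).2 - J z.2 - dlc z.2 (wderiv 2 z.2) (Kforce r z) u.2| <= e / 4 * nu.
  by rewrite /J eu2; exact: (hJ2 _ _ _ a2 s2 lJ2).
have [cz1 cz2] : continuous (lc z.1) /\ continuous (lc z.2) by split; [exact: (lc_cont fl1)|exact: (lc_cont fl2)].
have [cu1 cu2] : continuous (lc (z + u).1) /\ continuous (lc (z + u).2).
  by split; [exact: (lc_cont flu1)|exact: (lc_cont flu2)].
have cle : e1 * nu <= (m / 2) ^+ 2.
  move: lm; rewrite /nm ler_pdivlMr ?mulr_gt0 // expr_div_n.
  have -> : nu * (4 * e1) = 4 * (e1 * nu) by ring.
  by move: (e1 * nu) (m ^+ 2); clear => x y; lra.
have eK t : Kforce r z t = r / (lc z.1 t - lc z.2 t) ^+ 2 + (1 - r) / (oint (lc z.1) 0 1 - oint (lc z.2) 0 1) ^+ 2.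
  by rewrite /Kforce !meanE.
have bI : `|interaction r (lc (z + u).1) (lc (z + u).2) - interaction r (lc z.1) (lc z.2) -
    (J (z + u).1 - J z.1 - (J (z + u).2 - J z.2))| <= 2 / m ^+ 3 * (e1 * nu) := interaction_vary r0 r1 cz1 cz2 cu1 cu2 cK m0 hm b3 cle eK.
have ee1 : 2 / m ^+ 3 * (e1 * nu) = e / 4 * nu by rewrite /e1; field; rewrite gt_eqF.
rewrite ee1 in bI.
have bC : C1 * nu ^+ 2 + C2 * nu ^+ 2 <= e / 4 * nu.
  rewrite -mulrDl expr2 mulrA; apply: ler_wpM2r; first exact: ltW.
  have -> : e / 4 = (C1 + C2 + 1) * nC by rewrite /nC; field; rewrite gt_eqF.
  by apply: ler_pM => //; [exact: addr_ge0|exact: ltW|rewrite lerDl].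
have := increment5 X1 X2 bC Y1 Y2 bI.
have -> : 4 * (e / 4 * nu) = e * nu by field.
apply: le_trans; rewrite (B_interaction r hz) (B_interaction r hzu) /Bdiff.
move: (J _) (J _) (J _) (J _) (interaction _ _ _) (interaction _ _ _) (actQ _) (actQ _) (actQ _) (actQ _).
move: (dQ _ _) (dQ _ _) (dlc _ _ _ _) (dlc _ _ _ _); clear => *.
by rewrite le_eqVlt; apply/orP; left; apply/eqP; congr (`|_|); ring.
Qed.

(** The work done by the force K along the orbit up to the parameter s. *)
Definition Wint f g K s : R := oint (fun x => 2 * (f x * g x) * K (timechange f x)) 0 s.

(** The mean of the work with respect to the physical time T s. *)
Definition Wmean f g K : R := oint (fun s => Wint f g K s * f s ^+ 2) 0 1 / normsq f.

(** The multiplier that represents [dlc] after removal of the primitives of f v. *)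
Definition potent f g K s : R :=
  2 / normsq f * (f s ^+ 2 * K (timechange f s) + (Wint f g K s - Wmean f g K)).

Lemma Wint_abscont f g K : abscont f g -> 0 < normsq f -> sqloop f -> continuous K ->
  abscont (Wint f g K) (fun x => 2 * (f x * g x) * K (timechange f x)).
Proof.
move=> fg n0 fl cK; have cf := AC_cont fg; have [l2 _] := fg.
have l : L2 (fun x => 2 * (f x * g x) * K (timechange f x)).
  have -> : (fun x => 2 * (f x * g x) * K (timechange f x)) = (fun x => (2 * f x * K (timechange f x)) * g x).
    by apply/funext => x; ring.
  apply: L2_contM => //; apply: contM; first exact: contZ.
  by apply: cont_comp => //; exact: timechange_cont.
split => // x y; rewrite /Wint -(oint_chasles 0 x y (L2_Lloc l)); ring.
Qed.

(** Integration by parts transfers [dtime], a primitive of f v, to the work. *)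
Lemma dlcE sg f g K v : nloop sg f g -> continuous K -> continuous v ->
  dlc f g K v = oint (fun s => v s * (f s * potent f g K s)) 0 1.
Proof.
move=> [fg sg1 fs n0] cK cv; have fl := twist_sqloop fg sg1 fs n0.
have cf := AC_cont fg.
have aW := Wint_abscont fg n0 fl cK.
have cW := AC_cont aW.
have cT := timechange_cont fl.
have cKT : continuous (fun s => K (timechange f s)) by exact: cont_comp.
have cfv : continuous (fun s => f s * v s) by exact: contM.
have lfv := continuous_Lloc cfv.
have cf2 : continuous (fun s => f s ^+ 2) by exact: cont_sqr.
pose a1 := 2 * oint (fun x => f x * v x) 0 1.
pose dd s := (2 * (f s * v s) - f s ^+ 2 / normsq f * a1) / normsq f.
have cdd : continuous dd.
  apply: contM; last exact: cst_cont.
  apply: contB; first exact: contZ.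
  by apply: contM; [apply: contM => //; exact: cst_cont|exact: cst_cont].
have dder s : is_derive s 1 (dtime f v) (dd s).
  have dT := timechange_derive fl s.
  have dI : is_derive s 1 (oint (fun x => f x * v x) 0) (f s * v s) by apply: oint_derive => //; exact: cfv.
  have := dM (dB (dZ 2 dI) (dM dT (dC a1 s))) (dC (normsq f)^-1 s).
  by apply: eq_derive; rewrite /dd; ring.
have parts := AC_parts 0 1 (AC_C1 cdd dder) aW.
have d1 : dtime f v 1 = 0 by rewrite /dtime (timechange1 fl) mul1r subrr mul0r.
have d0 : dtime f v 0 = 0 by rewrite /dtime timechange0 oint_id mulr0 mul0r subrr mul0r.
rewrite d1 d0 !mul0r subrr sub0r in parts.
rewrite /dlc.
have -> : oint (fun s => 2 * (f s * g s) * (K (timechange f s) * dtime f v s)) 0 1 =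
   - oint (fun x => dd x * Wint f g K x) 0 1.
  by rewrite -parts; congr oint; apply/funext => s; ring.
have l1 : Lloc (fun s => 2 * (f s * v s) * (K (timechange f s) * (f s ^+ 2 / normsq f))).
  apply: continuous_Lloc; apply: contM; first exact: contZ.
  by apply: contM => //; apply: contM => //; exact: cst_cont.
have l2 : Lloc (fun x => 2 / normsq f * (f x * v x * Wint f g K x)).
  by apply: continuous_Lloc; apply: contZ; exact: contM.
have l3 : Lloc (fun x => a1 / normsq f ^+ 2 * (Wint f g K x * f x ^+ 2)).
  by apply: continuous_Lloc; apply: contZ; exact: contM.
have l4 : Lloc (fun x => (2 / normsq f * Wmean f g K) * (f x * v x)).
  by apply: continuous_Lloc; exact: contZ.
have -> : (fun s => v s * (f s * potent f g K s)) = (fun s => (2 * (f s * v s) * (K (timechange f s) * (f s ^+ 2 / normsq f))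
   + 2 / normsq f * (f s * v s * Wint f g K s)) - (2 / normsq f * Wmean f g K) * (f s * v s)).
  by apply/funext => s; rewrite /potent; ring.
have -> : (fun x => dd x * Wint f g K x) = (fun x => 2 / normsq f * (f x * v x * Wint f g K x) - a1 / normsq f ^+ 2 * (Wint f g K x * f x ^+ 2)).
  by apply/funext => s; rewrite /dd; field; rewrite gt_eqF.
rewrite (ointB 0 1 (LlocD l1 l2) l4) (ointD 0 1 l1 l2) (ointB 0 1 l2 l3).
rewrite [oint (fun x => a1 / _ * _) 0 1]ointZ; last by apply: continuous_Lloc; exact: contM.
rewrite (ointZ (2 / normsq f * Wmean f g K) 0 1 lfv) /a1 /Wmean.
move: (oint _ 0 1) (oint _ 0 1) (oint _ 0 1) (oint _ 0 1) => A B C D.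
by field; rewrite gt_eqF.
Qed.

End TotalDifferential.

(** * Critical points as zeroes of the differential *)

Section EulerLagrange.
Context {R : realType}.
Implicit Types (f g h v w K : R -> R) (a b c x y k M e d s t nu r sg eps : R) (z u : (R -> R) * (R -> R)).

Local Opaque normsq wderiv oint.

(** The coefficient of the Euler-Lagrange equation 4 N f'' = f c. *)
Definition ccoef eps f g K s : R :=
  4 * normsq g - 4 / normsq f ^+ 2 + eps * potent f g K s.

(** The differential of the action with respect to one component, as a form in the
    variation v and its weak derivative w; eps is the sign of the force. *)
Definition vform eps f g K v w : R :=
  4 * normsq f * oint (fun s => g s * w s) 0 1 +
  oint (fun s => v s * (f s * ccoef eps f g K s)) 0 1.

Lemma potent_cont sg f g K : nloop sg f g -> continuous K -> continuous (potent f g K).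
Proof.
move=> [fg sg1 fs n0] cK; have fl := twist_sqloop fg sg1 fs n0.
have cf := AC_cont fg; have cW := AC_cont (Wint_abscont fg n0 fl cK).
apply: contZ; apply: contD; last by apply: contB => //; exact: cst_cont.
by apply: contM; [exact: cont_sqr|apply: cont_comp => //; exact: timechange_cont].
Qed.

Lemma ccoef_cont sg eps f g K : nloop sg f g -> continuous K -> continuous (ccoef eps f g K).
Proof.
by move=> fl cK; apply: contD; [exact: cst_cont|apply: contZ; exact: potent_cont fl cK].
Qed.

Lemma dQ_dlc sg eps f K v : nloop sg f (wderiv 2 f) -> continuous K -> continuous v ->
  dQ f v + eps * dlc f (wderiv 2 f) K v = vform eps f (wderiv 2 f) K v (wderiv 2 v).
Proof.
move=> fl cK cv; rewrite (dlcE fl cK cv) /dQ /vform -addrA; congr (_ + _).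
have cf : continuous f by case: fl => /AC_cont.
have cp := potent_cont fl cK.
have l1 : Lloc (fun s => f s * v s) by apply: continuous_Lloc; exact: contM.
have l2 : Lloc (fun s => v s * (f s * potent f (wderiv 2 f) K s)).
  by apply: continuous_Lloc; apply: contM => //; exact: contM.
rewrite -(ointZ _ 0 1 l1) -(ointZ eps 0 1 l2) -(ointD 0 1 (LlocZ _ l1) (LlocZ eps l2)).
by congr oint; apply/funext => s; rewrite /ccoef; ring.
Qed.

Lemma BdiffE r z u : Htilde_in z -> H1_twist u -> Bdiff r z u =
  vform 1 z.1 (wderiv 2 z.1) (Kforce r z) u.1 (wderiv 2 u.1) +
  vform (-1) z.2 (wderiv 2 z.2) (Kforce r z) u.2 (wderiv 2 u.2).
Proof.
move=> hz tu; have [tz fl1 fl2 _] := Htilde_nloops hz; have [a1 a2 _ _] := twistP tu.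
have cK : continuous (Kforce r z) by exact: Kforce_cont.
have e1 := dQ_dlc 1 fl1 cK (AC_cont a1); have e2 := dQ_dlc (-1) fl2 cK (AC_cont a2).
rewrite -e1 -e2 /Bdiff; move: (dQ _ _) (dQ _ _) (dlc _ _ _ _) (dlc _ _ _ _); clear => *; ring.
Qed.

Lemma vform_deriv eps f g K v w w' : abscont f g -> abscont v w -> abscont v w' ->
  vform eps f g K v w = vform eps f g K v w'.
Proof.
move=> [l2 _] vw vw'; rewrite /vform; congr (_ * _ + _).
under eq_fun do rewrite mulrC; rewrite (AC_uniq 0 1 vw vw' l2).
by under eq_fun do rewrite mulrC.
Qed.

Lemma vformZ eps f g K k v w : abscont f g -> abscont v w -> Lloc (fun s => v s * (f s * ccoef eps f g K s)) ->
  vform eps f g K (fun s => k * v s) (fun s => k * w s) = k * vform eps f g K v w.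
Proof.
move=> [l2 _] [l2w _] l; rewrite /vform.
have -> : oint (fun s => k * v s * (f s * ccoef eps f g K s)) 0 1 =
    k * oint (fun s => v s * (f s * ccoef eps f g K s)) 0 1.
  by rewrite -(ointZ k 0 1 l); congr oint; apply/funext => s; ring.
have -> : oint (fun s => g s * (k * w s)) 0 1 = k * oint (fun s => g s * w s) 0 1.
  by rewrite -(ointZ k 0 1 (L2M l2 l2w)); congr oint; apply/funext => s; ring.
by move: (oint _ _ _) (oint _ _ _) (normsq f) => A B C; ring.
Qed.

Definition scale k u : (R -> R) * (R -> R) := (fun s => k * u.1 s, fun s => k * u.2 s).

Lemma H1_scale k f : H1 2 f -> H1 2 (fun s => k * f s).
Proof.
move=> hf; have t0 : 0 < (2 : R) by [].
have [p1 a1] := wderivP t0 hf; have [_ fp _] := hf.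
apply: (AC_H1 (g := fun s => k * wderiv 2 f s)) => //; last exact: AC_Z.
  by move=> s; rewrite fp.
by move=> s; rewrite p1.
Qed.

Lemma H1_twist_scale k u : H1_twist u -> H1_twist (scale k u).
Proof.
move=> [h1 h2 t1 t2]; split; [exact: H1_scale|exact: H1_scale| |] => s /=.
  by rewrite t1.
by rewrite t2 mulrN.
Qed.

Lemma normsqZ k f : L2 f -> normsq (fun s => k * f s) = k ^+ 2 * normsq f.
Proof.
move=> [_ l]; rewrite !normsqE -ointZ //; congr oint; apply/funext => s; ring.
Qed.

Lemma sqr_inj x y : 0 <= x -> 0 <= y -> x ^+ 2 = y ^+ 2 -> x = y.
Proof. by move=> x0 y0 /eqP; rewrite (@eqrXn2 R 2) // => /eqP. Qed.

Lemma H1_norm_scale k u : 0 <= k -> H1_twist u -> H1_norm (scale k u) = k * H1_norm u.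
Proof.
move=> k0 tu; have [a1 a2 _ _] := twistP tu; have [b1 b2 _ _] := twistP (H1_twist_scale k tu).
apply: sqr_inj; [exact: H1_norm_ge0|by apply: mulr_ge0 => //; exact: H1_norm_ge0|].
apply: (eq_trans (H1_norm_sq (scale k u))); rewrite exprMn (H1_norm_sq u) !mulrDr.
have e3 : normsq (scale k u).1 = k ^+ 2 * normsq u.1 by apply: normsqZ; apply: L2_cont; exact: AC_cont a1.
have e4 : normsq (scale k u).2 = k ^+ 2 * normsq u.2 by apply: normsqZ; apply: L2_cont; exact: AC_cont a2.
have L2g f g : abscont f g -> L2 g by case.
have e1 : normsq (wderiv 2 (scale k u).1) = k ^+ 2 * normsq (wderiv 2 u.1).
  by rewrite -(normsqZ k (L2g _ _ a1)) !normsqE; apply: AC_uniq_sq b1 _; exact: AC_Z.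
have e2 : normsq (wderiv 2 (scale k u).2) = k ^+ 2 * normsq (wderiv 2 u.2).
  by rewrite -(normsqZ k (L2g _ _ a2)) !normsqE; apply: AC_uniq_sq b2 _; exact: AC_Z.
by refine (congr2 _ (congr2 _ (congr2 _ e3 e1) e4) e2).
Qed.

Lemma Bdiff_scale r z k u : Htilde_in z -> H1_twist u -> Bdiff r z (scale k u) = k * Bdiff r z u.
Proof.
move=> hz tu; have [tz fl1 fl2 _] := Htilde_nloops hz; have [a1 a2 _ _] := twistP tu.
have tku := H1_twist_scale k tu; have [b1 b2 _ _] := twistP tku.
have cK : continuous (Kforce r z) by exact: Kforce_cont.
have [fg1 _ _ _] := fl1; have [fg2 _ _ _] := fl2.
rewrite (BdiffE r hz tku) (BdiffE r hz tu) /= mulrDr.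
rewrite (vform_deriv _ _ fg1 b1 (AC_Z k a1)) (vform_deriv _ _ fg2 b2 (AC_Z k a2)).
rewrite !vformZ //; apply: continuous_Lloc; apply: contM; try exact: AC_cont a1; try exact: AC_cont a2.
  by apply: contM; [exact: AC_cont fg2|exact: ccoef_cont fl2 cK].
by apply: contM; [exact: AC_cont fg1|exact: ccoef_cont fl1 cK].
Qed.

Let step_size k H d : 0 < k -> 0 <= H -> k * (2 * (H + 1)) <= d -> k * H < d.
Proof. nra. Qed.

(** A common criterion for the two spaces of loops.  If the differential did not
    vanish at u, a small multiple of u would contradict criticality; the converse is the
    Frechet expansion.  When u has norm 0 the expansion is used with arbitrarily small nu. *)
Lemma critical_Bdiff (X D : set ((R -> R) * (R -> R))) r z : 0 <= r <= 1 ->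
  X `<=` H1_twist -> (forall k u, X u -> X (scale k u)) -> D `<=` Htilde_in ->
  (forall u, D z -> X u -> Htilde_in (z + u) -> D (z + u)) ->
  critical X D (B_act r) z <-> D z /\ forall u, X u -> Bdiff r z u = 0.
Proof.
move=> hr XH Xs DH DX; split=> [[Dz crit]|[Dz dz]]; split => //; last first.
  move=> e e0; have e3 : 0 < e / 3 by lra.
  have [nu0 nu00 hB] := B_frechet hr (DH _ Dz) e3.
  exists (nu0 / 2); first lra.
  move=> u Xu Dzu hu; have h0 := H1_norm_ge0 u.
  have := fun nu => hB u nu (XH _ Xu); rewrite (dz u Xu) subr0.
  move: (H1_norm u) (`|_ - _|) h0 hu => h X0 h0 hu {}hB.
  have [hp|hn] := ltP 0 h.
    have := mulr_gt0 e0 hp; have := hB (2 * h) (lexx _) ltac:(lra) ltac:(lra); lra.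
  have -> : h = 0 by lra.
  rewrite mulr0 leNgt; apply/negP => Xp.
  (* the expansion holds for every nu above twice the norm, which is 0 *)
  pose nu := Num.min nu0 (X0 / e).
  have nup : 0 < nu by rewrite lt_min nu00 divr_gt0.
  have nu1 : nu <= nu0 by rewrite ge_min lexx.
  have nu2 : e * nu <= X0.
    have : nu <= X0 / e by rewrite ge_min lexx orbT.
    by rewrite ler_pdivlMr // mulrC.
  have := hB nu ltac:(lra) nup nu1; lra.
move=> u Xu; apply/eqP/negPn/negP => ne.
have np : 0 < `|Bdiff r z u| by rewrite normr_gt0.
have tu := XH _ Xu; have hz := DH _ Dz.
have h0 := H1_norm_ge0 u.
pose H := H1_norm u.
pose e := `|Bdiff r z u| / (2 * (3 * H + 1)).
have H1p : 0 < 3 * H + 1 by rewrite /H; lra.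
have e0 : 0 < e by rewrite divr_gt0 // mulr_gt0.
have [d d0 hd] := crit e e0.
have [n1 n10 hB] := B_frechet hr hz e0.
have [n2 n20 hO] := Htilde_open hz.
have H2p : 0 < 2 * H + 1 by rewrite /H; lra.
pose k := Num.min (d / (2 * (H + 1))) (Num.min n1 n2 / (2 * H + 1)).
have k0 : 0 < k.
  rewrite lt_min !divr_gt0 ?lt_min ?n10 // mulr_gt0 //; rewrite /H; lra.
have kd : k * H < d.
  have : k <= d / (2 * (H + 1)) by rewrite ge_min lexx.
  rewrite ler_pdivlMr; last by rewrite /H; lra.
  exact: step_size.
have kn : k * (2 * H + 1) <= Num.min n1 n2.
  have : k <= Num.min n1 n2 / (2 * H + 1) by rewrite ge_min lexx orbT.
  by rewrite ler_pdivlMr.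
have [kn1 kn2] : k * (2 * H + 1) <= n1 /\ k * (2 * H + 1) <= n2.
  by move: kn; rewrite le_min => /andP[].
have tku := H1_twist_scale k tu.
have hk := H1_norm_scale (ltW k0) tu.
have hk2 : 2 * H1_norm (scale k u) <= k * (2 * H + 1).
  rewrite hk -/H mulrDr mulr1 mulrCA lerDl; exact: ltW.
have nup : 0 < k * (2 * H + 1) by rewrite mulr_gt0.
have hzu := hO _ _ tku hk2 nup kn2.
have B1 := hB _ _ tku hk2 nup kn1.
have B2 := hd (scale k u) (Xs k u Xu) (DX _ Dz (Xs k u Xu) hzu) ltac:(by rewrite hk).
rewrite (Bdiff_scale r k hz tu) in B1; rewrite hk -/H in B2.
have : k * `|Bdiff r z u| <= e * (k * (2 * H + 1)) + e * (k * H).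
  rewrite -(gtr0_norm k0) -normrM (gtr0_norm k0).
  have := ler_normB (B_act r (z + scale k u) - B_act r z) (B_act r (z + scale k u) - B_act r z - k * Bdiff r z u).
  by rewrite opprB addrC subrK => /le_trans; apply; rewrite addrC; exact: lerD.
have -> : e * (k * (2 * H + 1)) + e * (k * H) = k * (e * (3 * H + 1)) by ring.
rewrite ler_pM2l // /e; have -> : `|Bdiff r z u| / (2 * (3 * H + 1)) * (3 * H + 1) = `|Bdiff r z u| / 2.
  by field; rewrite gt_eqF.
by move: np; move: `|_|; clear => x *; lra.
Qed.

End EulerLagrange.

(** * The Euler-Lagrange equation of a symmetric component *)

Section ComponentEquation.
Context {R : realType}.
Implicit Types (f g h p v w K E F G : R -> R) (a b c x y k M e d s t nu r sg eps : R).

Local Opaque normsq wderiv oint.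

Lemma AC_B f g F G : abscont f g -> abscont F G -> abscont (fun x => f x - F x) (fun x => g x - G x).
Proof.
move=> fg /(AC_Z (-1))/(AC_D fg).
have e X Y : (fun x => X x + -1 * Y x) = (fun x : R => X x - Y x :> R) by apply/funext => x; rewrite mulN1r.
by rewrite !e.
Qed.

Definition sym f := forall s, f (1 - s) = f s.

Definition refl_loop f s := f (1 - s).

Lemma normsq_reflect f : continuous f -> normsq (refl_loop f) = normsq f.
Proof.
move=> cf; rewrite !normsqE.
by have := oint_refl 1 0 1 (continuous_Lloc (cont_sqr cf)); rewrite subr0 subrr.
Qed.

Lemma sqloop_reflect f : sqloop f -> sqloop (refl_loop f).
Proof.
move=> [cf fp N0]; split; last by rewrite normsq_reflect.
  by apply: cont_comp => //; apply: contB; [exact: cst_cont|exact: id_cont].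
by move=> s; rewrite /refl_loop -fp; congr (f _ ^+ 2); ring.
Qed.

Lemma timechange_reflect f s : sqloop f -> timechange (refl_loop f) s = 1 - timechange f (1 - s).
Proof.
move=> fl; have [cf _ N0] := fl.
have e := oint_refl 1 0 s (continuous_Lloc (cont_sqr cf)).
rewrite subr0 in e; rewrite timechangeE (normsq_reflect cf) -{1}(timechange1 fl) (timechange_sub fl).
by apply: (congr2 _ e).
Qed.

Lemma lc_reflect f t : sqloop f -> lc (refl_loop f) t = lc f (1 - t).
Proof.
move=> fl; have [s <-] := timechange_onto (sqloop_reflect fl) t.
have := q_timechange (sqloop_reflect fl) s; rewrite /lc => ->.
by rewrite (timechange_reflect s fl) subKr; have := q_timechange fl (1 - s) => ->.
Qed.

Lemma reflect_sym f : sym f -> refl_loop f = f.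
Proof. by move=> fe; apply/funext => s; rewrite /refl_loop fe. Qed.

Lemma timechange_sym f s : sqloop f -> sym f -> timechange f (1 - s) = 1 - timechange f s.
Proof.
by move=> fl fe; have := timechange_reflect (1 - s) fl; rewrite (reflect_sym fe) subKr.
Qed.

Lemma lc_sym f : sqloop f -> sym f -> sym (lc f).
Proof. by move=> fl fe t; rewrite -(lc_reflect t fl) (reflect_sym fe). Qed.

Section Symmetric.
Variables (sg : R) (f g K : R -> R).
Hypotheses (fl : nloop sg f g) (fe : sym f).
Hypotheses (cK : continuous K) (Kp : forall t, K (t + 1) = K t) (Ke : sym K).

Let fg : abscont f g := let: And4 h _ _ _ := fl in h.
Let sq : sqloop f.
Proof. by have [h1 h2 h3 h4] := fl; exact: twist_sqloop h1 h2 h3 h4. Qed.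
Let T := timechange f.
Let k x := 2 * (f x * g x) * K (T x).
Let KT_cont : continuous (fun x => K (T x)).
Proof. by apply: cont_comp => //; exact: timechange_cont. Qed.
Let k_Lloc : Lloc k.
Proof. by have [] := Wint_abscont fg (let: And4 _ _ _ h := fl in h) sq cK => /L2_Lloc. Qed.
Let f2 : abscont (fun x => f x * f x) (fun x => f x * g x + g x * f x) := AC_mul fg fg.
Let kE x : k x = (f x * g x + g x * f x) * K (T x).
Proof. by rewrite /k; ring. Qed.

Let k_sym a b : oint k a b = oint k (1 - a) (1 - b).
Proof.
have f2' := AC_refl 1 f2.
have e : (fun x => f (1 - x) * f (1 - x)) = (fun x => f x * f x) by apply/funext => x; rewrite fe.
rewrite e in f2'.
have := AC_uniq a b f2 f2' (L2_cont KT_cont).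
have -> : (fun x => (f x * g x + g x * f x) * K (T x)) = k by apply/funext => x; rewrite kE.
move=> ->; have -> : (fun x => - (f (1 - x) * g (1 - x) + g (1 - x) * f (1 - x)) * K (T x)) = (fun x => - k (1 - x)).
  by apply/funext => x; rewrite kE /T timechange_sym // Ke mulNr.
by rewrite (ointN _ _ (Lloc_refl 1 k_Lloc)) (oint_refl 1 a b k_Lloc) oint_sym opprK.
Qed.

Let k_per a b : oint k a b = oint k (a + 1) (b + 1).
Proof.
have f2' := abscont_shift 1 f2.
have [_ f1 _] := sq.
have e : (fun x => f (x + 1) * f (x + 1)) = (fun x => f x * f x).
  by apply/funext => x; rewrite -!expr2 f1.
rewrite e in f2'.
have := AC_uniq a b f2 f2' (L2_cont KT_cont).
have -> : (fun x => (f x * g x + g x * f x) * K (T x)) = k by apply/funext => x; rewrite kE.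
move=> ->; have -> : (fun x => (f (x + 1) * g (x + 1) + g (x + 1) * f (x + 1)) * K (T x)) = (fun x => k (x + 1)).
  by apply/funext => x; rewrite kE /T timechangeS // Kp.
by rewrite (oint_shift 1 a b k_Lloc).
Qed.

Let W1 : Wint f g K 1 = 0.
Proof.
have := k_sym 0 1; rewrite subr0 subrr [RHS]oint_sym -/(Wint f g K 1) => h.
by have : Wint f g K 1 = - Wint f g K 1 by []; lra.
Qed.

(** For a symmetric loop the work over a period vanishes, because the power is odd. *)
Lemma Wint_sym : sym (Wint f g K).
Proof.
move=> s; have := k_sym 0 s; rewrite subr0 -/(Wint f g K s) => ->.
by have := oint_chasles 0 1 (1 - s) k_Lloc; rewrite -/(Wint f g K 1) W1 add0r.
Qed.

Lemma Wint_periodic s : Wint f g K (s + 1) = Wint f g K s.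
Proof.
have := k_per 0 s; rewrite add0r -/(Wint f g K s) => ->.
by have := oint_chasles 0 1 (s + 1) k_Lloc; rewrite -/(Wint f g K 1) W1 add0r.
Qed.

Lemma ccoef_sym eps : sym (ccoef eps f g K).
Proof. by move=> s; rewrite /ccoef /potent fe timechange_sym // Ke Wint_sym. Qed.

Lemma ccoef_periodic eps s : ccoef eps f g K (s + 1) = ccoef eps f g K s.
Proof. by have [_ f1 _] := sq; rewrite /ccoef /potent f1 timechangeS // Kp Wint_periodic. Qed.

Lemma derive0_cst h x y : (forall x, is_derive x 1 h 0) -> h x = h y.
Proof.
move=> dh; have := @oint_FTC R (fun=> 0) h y x (@cst_cont R 0) dh.
by rewrite oint_cst mul0r => /esym/eqP; rewrite subr_eq0 => /eqP.
Qed.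

(** With h a primitive of f c made odd about 1/2, and H a primitive of h, the variation
    v = 4 N f - H is even and has the twist of f.  Integrating by parts, the form at v is
    int v' ^+ 2, so v is constant on [0, 1].  For periodic loops h is periodic because
    the form vanishes at constants; for antiperiodic loops this is automatic. *)
Lemma component_equation eps :
  (forall v w, abscont v w -> twist sg v -> sym v -> periodic w 2 -> vform eps f g K v w = 0) ->
  periodic g 2 ->
  exists2 p, forall s, is_derive s 1 f (p s) &
    forall s, is_derive s 1 p (f s * ccoef eps f g K s / (4 * normsq f)).
Proof.
move=> crit gp; have [_ sg1 ft N0] := fl; have cf := AC_cont fg.
pose c := ccoef eps f g K; have cc : continuous c by exact: ccoef_cont fl cK.
pose phi s := f s * c s; have cphi : continuous phi by exact: contM.
have lphi := continuous_Lloc cphi.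
pose h := oint phi 0; have dh s : is_derive s 1 h (phi s) by apply: (oint_derive 0 lphi (cphi s)).
have sgE : sg = 1 \/ sg = -1.
  by move/eqP: sg1; rewrite sqrf_eq1 => /orP[]/eqP ->; [left|right].
have drefl (F : R -> R) l s : is_derive (1 - s) 1 F l -> is_derive s 1 (fun x => F (1 - x)) (- l).
  move=> dF; have := @chain_rule R F (fun x => 1 - x) s _ _ dF (dB (dC 1 s) (dI s)); apply: eq_derive; ring.
have dshift (F : R -> R) l s : is_derive (s + 1) 1 F l -> is_derive s 1 (fun x => F (x + 1)) l.
  move=> dF; have := @chain_rule R F (fun x => x + 1) s _ _ dF (dD (dI s) (dC 1 s)); apply: eq_derive; ring.
have h00 : h 0 = 0 by exact: oint_id.
have hsum s : h s + h (1 - s) = h 1.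
  rewrite -[RHS]add0r -[X in X + h 1]h00 -{2}[1]subr0; apply: (derive0_cst (h := fun s => h s + h (1 - s))) => x.
  by apply: eq_derive (dD (dh x) (drefl _ _ _ (dh _))); rewrite /phi /c fe ccoef_sym subrr.
have h1 : (1 + sg) * h 1 = 0.
  case: (sgE) => e; last by rewrite e subrr mul0r.
  suff : h 1 = 0 by move=> ->; rewrite mulr0.
  have t1 : twist sg (fun=> 1 : R) by move=> s; rewrite e mul1r.
  have := crit (fun=> 1) (fun=> 0) (AC_C1 (@cst_cont R 0) (dC 1)) t1 (fun=> erefl) (fun=> erefl).
  rewrite /vform -/c (_ : (fun s => g s * 0) = fun=> 0); last by apply/funext => x; rewrite mulr0.
  rewrite (_ : (fun s => 1 * (f s * c s)) = phi); last by apply/funext => x; rewrite mul1r.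
  by rewrite oint_cst mul0r mulr0 add0r.
(* the primitive of f c that is odd about 1/2 *)
pose ht s := h s - h 1 / 2.
have dht s : is_derive s 1 ht (phi s) by apply: eq_derive (dB (dh s) (dC _ s)); rewrite subr0.
have cht : continuous ht by exact: derive_cont dht.
pose H := oint ht 0; have dH s : is_derive s 1 H (ht s) by apply: (oint_derive 0 (continuous_Lloc cht) (cht s)).
have htw s : ht (s + 1) = sg * ht s.
  apply/eqP; rewrite -subr_eq0; apply/eqP.
  transitivity (ht (0 + 1) - sg * ht 0).
    apply: (derive0_cst (h := fun s => ht (s + 1) - sg * ht s)) => x.
    apply: eq_derive (dB (dshift _ _ _ (dht _)) (dZ sg (dht x))).
    by rewrite /phi /c ft ccoef_periodic; ring.
  rewrite /ht add0r h00; transitivity ((1 + sg) * h 1 / 2); last by rewrite h1 mul0r.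
  by field.
have hte s : ht (1 - s) = - ht s by have := hsum s; rewrite /ht; lra.
have He : sym H.
  move=> s; apply/eqP; rewrite -subr_eq0; apply/eqP.
  transitivity (H (1 - 2^-1) - H 2^-1).
    apply: (derive0_cst (h := fun s => H (1 - s) - H s)) => x.
    by apply: eq_derive (dB (drefl _ _ _ (dH _)) (dH x)); rewrite hte; ring.
  by rewrite (_ : 1 - 2^-1 = 2^-1 :> R) ?subrr //; lra.
have H0 : H 0 = 0 by exact: oint_id.
have Hw : twist sg H.
  move=> s; apply/eqP; rewrite -subr_eq0; apply/eqP.
  transitivity (H (0 + 1) - sg * H 0).
    apply: (derive0_cst (h := fun s => H (s + 1) - sg * H s)) => x.
    by apply: eq_derive (dB (dshift _ _ _ (dH _)) (dZ sg (dH x))); rewrite htw subrr.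
  by rewrite add0r -[X in H X](subr0 1) He H0 mulr0 subrr.
pose N := normsq f; pose v s := 4 * N * f s - H s; pose w s := 4 * N * g s - ht s.
have acH : abscont H ht by exact: AC_C1.
have vw : abscont v w.
  exact: AC_B (AC_Z (4 * N) fg) acH.
have vt : twist sg v by move=> s; rewrite /v ft Hw; ring.
have ve : sym v by move=> s; rewrite /v fe He.
have wp : periodic w 2.
  by move=> s; rewrite /w gp -[2]/(1 + 1) addrA !htw mulrA -expr2 sg1 mul1r.
have vf := crit v w vw vt ve wp.
have acht : abscont ht phi by exact: AC_C1.
have w0 : normsq w = 0.
  have := AC_parts 0 1 vw acht.
  have v1 : v 1 = sg * v 0 by rewrite -(vt 0) add0r.
  have ht1 : ht 1 = sg * ht 0 by rewrite -(htw 0) add0r.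
  rewrite (_ : v 1 * ht 1 - v 0 * ht 0 = 0); last first.
    by rewrite v1 ht1 mulrACA -expr2 sg1 mul1r subrr.
  rewrite sub0r => e; move: vf; rewrite /vform -/c -/N.
  have -> : (fun s => v s * (f s * c s)) = (fun s => v s * phi s) by [].
  rewrite e => e2; rewrite normsqE.
  have l2w : L2 w by case: vw.
  have l2g : L2 g by case: fg.
  have -> : (fun x => w x ^+ 2) = (fun x => 4 * N * (g x * w x) - w x * ht x).
    by apply/funext => x; rewrite {1}/w -/(w x) /w; ring.
  rewrite (ointB 0 1 (LlocZ _ (L2M l2g l2w)) (L2M l2w (L2_cont cht))) (ointZ _ 0 1 (L2M l2g l2w)).
  exact: e2.
have vcst s : v s = v 0.
  have v01 x : 0 <= x -> x <= 1 -> v x = v 0.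
    move=> x0 x1; have := abscont_diff vw (lexx 0) x0 x1; rewrite w0 => h2.
    have : (v x - v 0) ^+ 2 = 0 by apply/eqP; rewrite eq_le h2 sqr_ge0.
    by move/eqP; rewrite sqrf_eq0 subr_eq0 => /eqP.
  move: s; apply: per_reduce => [s|s s0 s1]; last by apply: v01 => //; exact: ltW.
  rewrite vt; case: sgE => e; first by rewrite e mul1r.
  have : v 1 = v 0 by exact: v01.
  rewrite -[X in v X = _]add0r (vt 0) e mulN1r => ?; have -> : v 0 = 0 by lra.
  rewrite mulN1r; split => ?; lra.
have N4 : 4 * N != 0 by rewrite gt_eqF // mulr_gt0.
exists (fun s => (4 * N)^-1 * ht s) => s; last first.
  by apply: eq_derive (dZ _ (dht s)); rewrite /phi /c mulrC.
have -> : f = fun s => (4 * N)^-1 * (v 0 + H s).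
  by apply/funext => x; rewrite -(vcst x) /v subrK mulrA mulVf // mul1r.
by apply: eq_derive (dZ _ (dD (dC (v 0) s) (dH s))); rewrite add0r.
Qed.

End Symmetric.
End ComponentEquation.

(** * Energy form of the equation and symmetric criticality *)

Section KeplerForm.
Context {R : realType}.
Implicit Types (f g h p v w K E : R -> R) (a b c x y k M e d s t nu r sg eps : R) (z u : (R -> R) * (R -> R)).

Local Opaque normsq wderiv oint.

Lemma derive_unique f x k c : is_derive x 1 f k -> is_derive x 1 f c -> k = c.
Proof. by move=> d1 d2; rewrite -(@derive_val _ _ _ _ _ _ _ d1) -(@derive_val _ _ _ _ _ _ _ d2). Qed.

(** The regularized equation of a component: p is the derivative of f and E the
    energy of the transform at time T s.  The last identity expresses the energy through f
    and p without a division by f. *)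
Definition kepler eps f p E K :=
  [/\ forall s, is_derive s 1 f (p s),
      forall s, is_derive s 1 p
        (f s * (E s + eps * (f s ^+ 2 * K (timechange f s))) / (2 * normsq f ^+ 2)),
      forall s, is_derive s 1 E (eps * (2 * (f s * p s) * K (timechange f s))) &
      forall s, E s * f s ^+ 2 = 2 * normsq f ^+ 2 * p s ^+ 2 - 2].

Lemma Wint_unique f g p K : abscont f g -> abscont f p -> sqloop f -> continuous K -> Wint f g K = Wint f p K.
Proof.
move=> fg fp fl cK; apply/funext => s; rewrite /Wint.
have cf := AC_cont fg; have cT : continuous (timechange f) by exact: timechange_cont.
have cX : continuous (fun x => 2 * f x * K (timechange f x)).
  by apply: contM; [exact: contZ|exact: cont_comp].
have := AC_uniq 0 s fg fp (L2_cont cX).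
have e q : (fun x => q x * (2 * f x * K (timechange f x))) = (fun x => 2 * (f x * q x) * K (timechange f x)).
  by apply/funext => x; ring.
by rewrite !e.
Qed.

Lemma ccoef_unique eps f g p K : abscont f g -> abscont f p -> sqloop f -> continuous K ->
  ccoef eps f g K = ccoef eps f p K.
Proof.
move=> fg fp fl cK; apply/funext => s.
by rewrite /ccoef /potent /Wmean (Wint_unique fg fp fl cK) !normsqE (AC_uniq_sq 0 1 fg fp).
Qed.

Lemma Wmean_int f g p K : abscont f g -> abscont f p -> sqloop f -> continuous K ->
  oint (fun s => Wint f g K s * f s ^+ 2) 0 1 = Wmean f p K * normsq f.
Proof.
move=> fg fp fl cK; have [_ _ N0] := fl.
rewrite (Wint_unique fg fp fl cK) /Wmean; move: (oint _ _ _) => A.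
by have n0 : normsq f != 0; [rewrite gt_eqF|rewrite (divfK n0)].
Qed.

(** The coefficient c is 2 / N (E + eps f ^+ 2 K), where E is the work
    up to a constant.  The function 2 N ^+ 2 p ^+ 2 - 2 - E f ^+ 2 has derivative 0, and
    the constant in E makes its integral vanish. *)
Lemma kepler_of_equation sg eps f g p K : nloop sg f g -> continuous K ->
  (forall s, is_derive s 1 f (p s)) ->
  (forall s, is_derive s 1 p (f s * ccoef eps f g K s / (4 * normsq f))) ->
  exists E, kepler eps f p E K.
Proof.
move=> fl cK df dp; have [fg sg1 ft N0] := fl; have sq := twist_sqloop fg sg1 ft N0.
have cp := derive_cont dp; have fp : abscont f p by exact: AC_C1 cp df.
have cf := AC_cont fp; rewrite (ccoef_unique eps fg fp sq cK) in dp.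
pose N := normsq f; pose W := Wint f p K; pose wm := Wmean f p K; pose D := normsq p.
have n0 : N != 0 by rewrite gt_eqF.
have cT : continuous (timechange f) by exact: timechange_cont.
have ck : continuous (fun x => 2 * (f x * p x) * K (timechange f x)).
  by apply: contM; [apply: contZ; exact: contM|exact: cont_comp].
have dW s : is_derive s 1 W (2 * (f s * p s) * K (timechange f s)).
  exact: (oint_derive 0 (continuous_Lloc ck) (ck s)).
pose E s := 2 * N * D - 2 / N + eps * (W s - wm).
have dE s : is_derive s 1 E (eps * (2 * (f s * p s) * K (timechange f s))).
  by apply: eq_derive (dD (dC _ s) (dZ eps (dB (dW s) (dC wm s)))); rewrite add0r subr0.
have dp' s : is_derive s 1 p (f s * (E s + eps * (f s ^+ 2 * K (timechange f s))) / (2 * N ^+ 2)).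
  apply: eq_derive (dp s); rewrite /ccoef /potent -/N -/W -/wm -/D /E.
  by move: (K _) (f s) (W s) => k x y; clear -n0 k x y eps wm D; field.
have cE := derive_cont dE.
pose P s := 2 * N ^+ 2 * p s ^+ 2 - 2 - E s * f s ^+ 2.
have dP s : is_derive s 1 P 0.
  apply: eq_derive (dB (dB (dZ (2 * N ^+ 2) (dsq (dp' s))) (dC 2 s)) (dM (dE s) (dsq (df s)))).
  by move: (K _) (f s) (E s) (p s) n0; clearbody N; clear => *; field.
have cW := derive_cont dW.
have l1 : Lloc (fun s => p s ^+ 2) by apply: continuous_Lloc; exact: cont_sqr.
have l2 : Lloc (fun s => f s ^+ 2) by apply: continuous_Lloc; exact: cont_sqr.
have l3 : Lloc (fun s => W s * f s ^+ 2) by apply: continuous_Lloc; apply: contM => //; exact: cont_sqr.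
have P0 : oint P 0 1 = 0.
  have -> : P = fun s => (2 * N ^+ 2) * p s ^+ 2 - 2 - ((2 * N * D - 2 / N - eps * wm) * f s ^+ 2 + eps * (W s * f s ^+ 2)).
    by apply/funext => s; rewrite /P /E; ring.
  have lc2 : Lloc (fun=> 2 : R) by apply: continuous_Lloc; exact: cst_cont.
  rewrite (ointB 0 1 (LlocB (LlocZ _ l1) lc2) (LlocD (LlocZ _ l2) (LlocZ eps l3))).
  rewrite (ointB 0 1 (LlocZ _ l1) lc2) (ointD 0 1 (LlocZ _ l2) (LlocZ eps l3)) (ointZ _ 0 1 l1) (ointZ _ 0 1 l2) (ointZ _ 0 1 l3).
  rewrite (Wmean_int fp fp sq cK) -/wm oint_cst -!normsqE -/N -/D.
  by clear -n0; field.
exists E; split => // s; apply/esym/eqP; rewrite -subr_eq0 -/N -/(P s); apply/eqP.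
have Pc x : P x = P s by exact: derive0_cst.
by move: P0; rewrite (_ : P = fun=> P s) ?oint_cst ?subr0 ?mulr1 //; apply/funext.
Qed.

(** The energy identity, integrated, determines the constant in E, so that the
    coefficient of the equation is that of [vform]; then the form at v is the boundary term
    4 N [p v], which vanishes as p and v have the same twist. *)
Lemma kepler_vform sg eps f g p E K : nloop sg f g -> continuous K -> kepler eps f p E K ->
  forall v w, abscont v w -> twist sg v -> vform eps f g K v w = 0.
Proof.
move=> fl cK [df dp dE EP]; have [fg sg1 ft N0] := fl; have sq := twist_sqloop fg sg1 ft N0.
have cp := derive_cont dp; have fp : abscont f p by exact: AC_C1 cp df.
have cf := AC_cont fp.
pose N := normsq f; pose W := Wint f p K; pose wm := Wmean f p K; pose D := normsq p.
have n0 : N != 0 by rewrite gt_eqF.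
have cT : continuous (timechange f) by exact: timechange_cont.
have ck : continuous (fun x => 2 * (f x * p x) * K (timechange f x)).
  by apply: contM; [apply: contZ; exact: contM|exact: cont_comp].
have dW s : is_derive s 1 W (2 * (f s * p s) * K (timechange f s)).
  exact: (oint_derive 0 (continuous_Lloc ck) (ck s)).
have cW := derive_cont dW.
have Ec s : E s = E 0 + eps * W s.
  have : E s - eps * W s = E 0 - eps * W 0.
    apply: (derive0_cst (h := fun s => E s - eps * W s)) => x.
    by apply: eq_derive (dB (dE x) (dZ eps (dW x))); rewrite subrr.
  by rewrite [W 0]oint_id mulr0 subr0 => <-; rewrite subrK.
have l1 : Lloc (fun s => p s ^+ 2) by apply: continuous_Lloc; exact: cont_sqr.
have l2 : Lloc (fun s => f s ^+ 2) by apply: continuous_Lloc; exact: cont_sqr.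
have l3 : Lloc (fun s => W s * f s ^+ 2) by apply: continuous_Lloc; apply: contM => //; exact: cont_sqr.
have E0 : E 0 = 2 * N * D - 2 / N - eps * wm.
  have : oint (fun s => E 0 * f s ^+ 2 + eps * (W s * f s ^+ 2)) 0 1 = oint (fun s => 2 * N ^+ 2 * p s ^+ 2 - 2) 0 1.
    by congr oint; apply/funext => s; rewrite -EP (Ec s); ring.
  have lc2 : Lloc (fun=> 2 : R) by apply: continuous_Lloc; exact: cst_cont.
  rewrite (ointD 0 1 (LlocZ _ l2) (LlocZ eps l3)) (ointB 0 1 (LlocZ _ l1) lc2) (ointZ _ 0 1 l1) (ointZ _ 0 1 l2) (ointZ _ 0 1 l3).
  rewrite (Wmean_int fp fp sq cK) -/wm oint_cst -!normsqE -/N -/D.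
  move=> h; apply: (mulIf n0); move: h; move: (E 0) wm D n0; clearbody N; clear => e wm D n0 h.
  have -> : (2 * N * D - 2 / N - eps * wm) * N = 2 * N ^+ 2 * D - 2 * (1 - 0) - eps * (wm * N) by field.
  by rewrite -h; ring.
have cE s : f s * ccoef eps f p K s = 4 * N * (f s * (E s + eps * (f s ^+ 2 * K (timechange f s))) / (2 * N ^+ 2)).
  rewrite /ccoef /potent -/N -/W -/wm -/D (Ec s) E0.
  by move: (K _) (f s) (W s) => k x y; clear -n0 k x y eps wm D; field.
move=> v w vw vt; rewrite /vform -/N (ccoef_unique eps fg fp sq cK).
have l2w : L2 w by case: vw.
rewrite (AC_uniq 0 1 fg fp l2w).
pose p' s := f s * (E s + eps * (f s ^+ 2 * K (timechange f s))) / (2 * N ^+ 2).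
have cp' : continuous p'.
  have -> : p' = fun s => (2 * N ^+ 2)^-1 * (f s * (E s + eps * (f s ^+ 2 * K (timechange f s)))).
    by apply/funext => s; rewrite /p' mulrC.
  apply: contZ; apply: contM => //; apply: contD; first exact: derive_cont dE.
  by apply: contZ; apply: contM; [exact: cont_sqr|exact: cont_comp].
have acp : abscont p p' by exact: AC_C1.
have -> : (fun s => v s * (f s * ccoef eps f p K s)) = (fun s => 4 * N * (v s * p' s)).
  by apply/funext => s; rewrite cE /p'; ring.
have l4 : Lloc (fun s => v s * p' s) by apply: continuous_Lloc; apply: contM => //; exact: AC_cont vw.
rewrite (ointZ _ 0 1 l4) -mulrDr (AC_parts 0 1 vw acp).
have pt s : p (s + 1) = sg * p s.
  apply: (@derive_unique (fun x => f (x + 1)) s).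
    by apply: eq_derive (@chain_rule R f (fun x => x + 1) s _ _ (df _) (dD (dI s) (dC 1 s))); rewrite addr0 mulr1.
  by rewrite (funext ft : (fun x => f (x + 1)) = fun x => sg * f x); exact: dZ.
have v1 : v 1 = sg * v 0 by rewrite -(vt 0) add0r.
have p1 : p 1 = sg * p 0 by rewrite -(pt 0) add0r.
rewrite (_ : v 1 * p 1 - v 0 * p 0 = 0); last by rewrite v1 p1 mulrACA -expr2 sg1 mul1r subrr.
rewrite (_ : (fun s => p s * w s) = fun s => w s * p s); last by apply/funext => s; rewrite mulrC.
by rewrite sub0r subrr mulr0.
Qed.


Lemma H1_sym_nloops z : Hhat_in z -> [/\ sym z.1, sym z.2 & Htilde_in z].
Proof.
move=> [[tz s1 s2] n1 n2 gp]; split; [by move=> s; rewrite -s1|by move=> s; rewrite -s2|by []].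
Qed.

Lemma Kforce_sym r z : Hhat_in z -> sym (Kforce r z).
Proof.
move=> /H1_sym_nloops[s1 s2 /Htilde_nloops[_ [h1 h2 h3 h4] [k1 k2 k3 k4] _]] t.
by rewrite /Kforce !lc_sym //; [exact: twist_sqloop k1 k2 k3 k4|exact: twist_sqloop h1 h2 h3 h4].
Qed.

Lemma H1_0 : H1 2 (fun=> 0 : R).
Proof.
by apply: (AC_H1 (g := fun=> 0)) => //; exact: AC_C1 (@cst_cont R 0) (dC 0).
Qed.

Lemma vform0 sg eps f g K w : nloop sg f g -> continuous K -> abscont (fun=> 0) w ->
  vform eps f g K (fun=> 0) w = 0.
Proof.
move=> fl cK vw; have [fg _ _ _] := fl.
rewrite (vform_deriv eps K fg vw (AC_C1 (@cst_cont R 0) (dC 0))) /vform.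
rewrite (_ : (fun s => g s * 0) = fun=> 0); last by apply/funext => s; rewrite mulr0.
rewrite (_ : (fun s => 0 * (f s * ccoef eps f g K s)) = fun=> 0); last by apply/funext => s; rewrite mul0r.
by rewrite oint_cst mul0r mulr0 addr0.
Qed.

Definition kepler_pair r z := exists p1 E1 p2 E2,
  kepler 1 z.1 p1 E1 (Kforce r z) /\ kepler (-1) z.2 p2 E2 (Kforce r z).

Lemma kepler_Bdiff r z u : Htilde_in z -> kepler_pair r z -> H1_twist u -> Bdiff r z u = 0.
Proof.
move=> hz [p1 [E1 [p2 [E2 [k1 k2]]]]] tu; have [_ fl1 fl2 _] := Htilde_nloops hz.
have [a1 a2 t1 t2] := twistP tu; have cK : continuous (Kforce r z) by exact: Kforce_cont.
by rewrite (BdiffE r hz tu) (kepler_vform fl1 cK k1 a1 t1) (kepler_vform fl2 cK k2 a2 t2) addr0.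
Qed.

(** Symmetric variations of a single component suffice. *)
Lemma Bdiff_kepler r z : Hhat_in z -> (forall u, H1_sym u -> Bdiff r z u = 0) -> kepler_pair r z.
Proof.
move=> hz crit; have [s1 s2 hz'] := H1_sym_nloops hz; have [tz fl1 fl2 _] := Htilde_nloops hz'.
have cK : continuous (Kforce r z) by exact: Kforce_cont.
have Kp t : Kforce r z (t + 1) = Kforce r z t by exact: Kforce_periodic.
have Ks := Kforce_sym r hz; have t0 : 0 < (2 : R) by [].
have [g1 g2] : periodic (wderiv 2 z.1) 2 /\ periodic (wderiv 2 z.2) 2.
  by have [h1 h2 _ _] := tz; have [? _] := wderivP t0 h1; have [? _] := wderivP t0 h2.
have H1v sg v w : sg ^+ 2 = 1 -> abscont v w -> twist sg v -> periodic w 2 -> H1 2 v.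
  move=> sg1 vw vt wp; apply: (AC_H1 t0 _ wp vw) => s.
  by rewrite -[2]/(1 + 1) addrA !vt mulrA -expr2 sg1 mul1r.
have a0 h : H1 2 h -> abscont h (wderiv 2 h) by move=> /(wderivP t0)[].
have c1 v w : abscont v w -> twist 1 v -> sym v -> periodic w 2 ->
    vform 1 z.1 (wderiv 2 z.1) (Kforce r z) v w = 0.
  move=> vw vt ve wp; have hv := H1v 1 v w (expr1n _ _) vw vt wp.
  have su : H1_sym (v, fun=> 0).
    split; [split => //=|by move=> s /=; rewrite ve|by []]; [exact: H1_0|by move=> s; rewrite vt mul1r|].
    by move=> s; rewrite oppr0.
  have := crit _ su; rewrite (BdiffE r hz' (let: And3 h _ _ := su in h)) /=.
  rewrite (vform0 _ fl2 cK (a0 _ H1_0)) addr0 => <-; have [fg _ _ _] := fl1.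
  exact: vform_deriv fg vw (a0 _ hv).
have c2 v w : abscont v w -> twist (-1) v -> sym v -> periodic w 2 ->
    vform (-1) z.2 (wderiv 2 z.2) (Kforce r z) v w = 0.
  move=> vw vt ve wp; have hv := H1v (-1) v w (sqrr_sign _ 1) vw vt wp.
  have su : H1_sym (fun=> 0, v).
    split; [split => //=|by []|by move=> s /=; rewrite ve]; [exact: H1_0|by move=> s; rewrite vt mulN1r].
  have := crit _ su; rewrite (BdiffE r hz' (let: And3 h _ _ := su in h)) /=.
  rewrite (vform0 _ fl1 cK (a0 _ H1_0)) add0r => <-; have [fg _ _ _] := fl2.
  exact: vform_deriv fg vw (a0 _ hv).
have [p1 d1 dd1] := component_equation fl1 s1 cK Kp Ks c1 g1.
have [p2 d2 dd2] := component_equation fl2 s2 cK Kp Ks c2 g2.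
have [E1 k1] := kepler_of_equation fl1 cK d1 dd1; have [E2 k2] := kepler_of_equation fl2 cK d2 dd2.
by exists p1, E1, p2, E2.
Qed.

Lemma critical_sym r z : 0 <= r <= 1 ->
  critical H1_sym Hhat_in (B_act r) z <-> Hhat_in z /\ kepler_pair r z.
Proof.
move=> hr; rewrite (critical_Bdiff (X := H1_sym) (D := Hhat_in) hr).
- split=> -[hz h]; first by split => //; exact: Bdiff_kepler.
  by split => // u [tu _ _]; have [_ _ hz'] := H1_sym_nloops hz; exact: kepler_Bdiff.
- by move=> u [].
- by move=> k u [tu s1 s2]; split; [exact: H1_twist_scale|move=> s /=; rewrite s1|move=> s /=; rewrite s2].
- by move=> u [[]].
- move=> u [[_ s1 s2] _ _ _] [tu u1 u2] [tzu n1 n2 g]; split => //; split => // s.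
    by rewrite -[LHS]/(z.1 s + u.1 s) s1 u1.
  by rewrite -[LHS]/(z.2 s + u.2 s) s2 u2.
Qed.

Lemma critical_twist r z : 0 <= r <= 1 ->
  critical H1_twist Htilde_in (B_act r) z <-> Htilde_in z /\ forall u, H1_twist u -> Bdiff r z u = 0.
Proof.
by move=> hr; apply: (critical_Bdiff hr) => // k u; exact: H1_twist_scale.
Qed.

Lemma fixed_sym : [set z : (R -> R) * (R -> R) | Htilde_in z /\ rho z = z] = Hhat_in.
Proof.
apply/seteqP; split => [z [[tz n1 n2 g] rz]|z [[tz s1 s2] n1 n2 g]].
  split => //; split => // s; first by rewrite -[in LHS]rz.
  by rewrite -[in LHS]rz.
by split; [split|rewrite [RHS]surjective_pairing; congr pair; apply/funext => s /=; rewrite -?s1 -?s2].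
Qed.

(** The equations of a critical point on symmetric loops kill all twisted variations. *)
Lemma fixed_critical r : 0 <= r <= 1 ->
  [set z : (R -> R) * (R -> R) | critical H1_twist Htilde_in (B_act r) z /\ rho z = z] =
  [set z | critical H1_sym Hhat_in (B_act r) z].
Proof.
move=> hr; apply/seteqP; split => z /=.
  move=> [[hz crit] rz]; have sz : Hhat_in z by rewrite -fixed_sym.
  split => // e e0; have [d d0 hd] := crit e e0; exists d => // v [tv _ _] [[tzv _ _] n1 n2 g].
  by apply: hd.
move=> /(critical_sym z hr)[hz kz]; have : [set z | Htilde_in z /\ rho z = z] z by rewrite fixed_sym.
move=> [hz' rz]; split => //; apply/(critical_twist z hr); split => // u; exact: kepler_Bdiff.
Qed.

Lemma reflect_loop sg f : sg ^+ 2 = 1 -> twist sg f -> twist sg (refl_loop f).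
Proof.
move=> sg1 ft s; rewrite /refl_loop (_ : 1 - s = 1 - (s + 1) + 1); last by ring.
by rewrite ft mulrA -expr2 sg1 mul1r.
Qed.

Lemma H1_reflect f : H1 2 f -> H1 2 (refl_loop f) /\
  normsq (wderiv 2 (refl_loop f)) = normsq (wderiv 2 f).
Proof.
move=> hf; have t0 : 0 < (2 : R) by []; have [gp fg] := wderivP t0 hf; have [_ fp _] := hf.
have rr := AC_refl 1 fg.
have perr h : periodic h 2 -> forall s, h (1 - (s + 2)) = h (1 - s) :> R.
  by move=> hp s; rewrite -[LHS]hp; congr h; ring.
have hr : H1 2 (refl_loop f).
  apply: (AC_H1 t0 _ _ rr) => s; first exact: perr.
  by rewrite perr.
split; first exact: hr.
have [_ rr'] := wderivP t0 hr.
rewrite !normsqE (AC_uniq_sq 0 1 rr' rr).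
have [_ l] : L2 (wderiv 2 f) by case: fg.
have := oint_refl 1 0 1 l; rewrite subr0 subrr => <-.
by congr oint; apply/funext => s; rewrite sqrrN.
Qed.

Lemma actQ_reflect f : H1 2 f -> actQ (refl_loop f) = actQ f.
Proof.
move=> hf; have [_ e] := H1_reflect hf; have [cf _ _] := hf.
by rewrite /actQ e (normsq_reflect cf).
Qed.

Lemma rho_invariant r z : Htilde_in z ->
  [/\ Htilde_in (rho z), rho (rho z) = z & B_act r (rho z) = B_act r z].
Proof.
move=> hz; have [tz fl1 fl2 gp] := Htilde_nloops hz.
have [a1 b1 t1 n1] := fl1; have [a2 b2 t2 n2] := fl2.
have q1 := twist_sqloop a1 b1 t1 n1; have q2 := twist_sqloop a2 b2 t2 n2.
have [h1 h2 _ _] := tz; have [r1 _] := H1_reflect h1; have [r2 _] := H1_reflect h2.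
have e1 : (rho z).1 = refl_loop z.1 by []. 
have e2 : (rho z).2 = refl_loop z.2 by [].
have trz : H1_twist (rho z).
  split => //= s.
    by have := reflect_loop b1 t1 s; rewrite /refl_loop mul1r.
  by have := reflect_loop b2 t2 s; rewrite /refl_loop mulN1r.
have l1 t : lc (rho z).1 t = lc z.1 (1 - t) by rewrite e1 lc_reflect.
have l2 t : lc (rho z).2 t = lc z.2 (1 - t) by rewrite e2 lc_reflect.
have hrz : Htilde_in (rho z).
  apply: Htilde_gapP => //; last by move=> t; rewrite l1 l2.
    by rewrite e1 normsq_reflect //; exact: AC_cont a1.
  by rewrite e2 normsq_reflect //; exact: AC_cont a2.
split => //.
  by rewrite [RHS]surjective_pairing; congr pair; apply/funext => s /=; rewrite subKr.
rewrite (B_interaction r hrz) (B_interaction r hz) e1 e2 (actQ_reflect h1) (actQ_reflect h2) -e1 -e2.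
congr (_ + _); rewrite /interaction.
have refl h : continuous h -> oint (fun t => h (1 - t)) 0 1 = oint h 0 1.
  by move=> ch; have := oint_refl 1 0 1 (continuous_Lloc ch); rewrite subr0 subrr.
have c1 := lc_cont fl1; have c2 := lc_cont fl2.
have -> : lc (rho z).1 = fun t => lc z.1 (1 - t) by apply/funext.
have -> : lc (rho z).2 = fun t => lc z.2 (1 - t) by apply/funext.
rewrite (refl _ c1) (refl _ c2) (refl (fun t => (lc z.1 t - lc z.2 t)^-1)) //.
apply: contV; first exact: contB.
by move=> t; rewrite gt_eqF // subr_gt0.
Qed.

End KeplerForm.

(** * Functions with isolated singularities, zeroes and smoothness *)

Section IsolatedPoints.
Context {R : realType}.
Implicit Types (f g h q F G : R -> R) (a b c x y k M e d s t : R).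

(** P holds away from a closed discrete set. *)
Definition punctured (P : R -> Prop) :=
  forall x, exists2 d : R, 0 < d & forall y, 0 < `|y - x| < d -> P y.

Lemma derive_cont_at f x k : is_derive x 1 f k -> {for x, continuous f}.
Proof. by move=> df; apply: differentiable_continuous; apply/derivable1_diffP; case: df. Qed.

Lemma derive0_segment F a b : continuous F -> a <= b -> (forall y, a < y < b -> is_derive y 1 F 0) -> F a = F b.
Proof.
move=> cF; rewrite le_eqVlt => /predU1P[->//|ab] dF.
have dF' y : y \in `]a, b[ -> is_derive y 1 F 0 by rewrite in_itv /=; exact: dF.
have [c _ e] := @MVT R F (fun=> 0) a b ab dF' (continuous_subspaceT cF).
by apply/esym/eqP; rewrite -subr_eq0 e mul0r.
Qed.

(** The mean value theorem on both sides of each exceptional point. *)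
Lemma punctured_cst F : continuous F -> punctured (fun y => is_derive y 1 F 0) -> forall x y, F x = F y.
Proof.
move=> cF dF; suff h x y : x <= y -> F x = F y.
  by move=> x y; have [/h//|/ltW/h//] := leP x y.
move=> xy; apply: (cousin (P := fun u w => F u = F w) xy) => [u w z _ _ -> //|s].
have [d d0 hd] := dF s; exists d => // u w du us sw wd.
transitivity (F s); apply: derive0_segment => // z /andP[z1 z2]; apply: hd.
  by rewrite ltr0_norm; [apply/andP; split|]; lra.
by rewrite gtr0_norm; [apply/andP; split|]; lra.
Qed.

Lemma punctured_int F g : continuous F -> Lloc g -> punctured (fun y => is_derive y 1 F (g y) /\ {for y, continuous g}) ->
  forall x y, F y - F x = oint g x y.
Proof.
move=> cF lg dF x y.
have e : F y - oint g x y = F x - oint g x x.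
  apply: (punctured_cst (F := fun y => F y - oint g x y)) => [|s].
    by apply: contB => //; exact: oint_continuous.
  have [d d0 hd] := dF s; exists d => // t /hd[dt ct].
  by apply: eq_derive (dB dt (oint_derive x lg ct)); rewrite subrr.
by rewrite oint_id subr0 in e; rewrite -e; ring.
Qed.

(** By [punctured_int] F is a primitive of g, and g is continuous. *)
Lemma punctured_derive F g : continuous F -> continuous g -> punctured (fun y => is_derive y 1 F (g y)) ->
  forall x, is_derive x 1 F (g x).
Proof.
move=> cF cg dF x.
have -> : F = fun y => F 0 + oint g 0 y.
  apply/funext => y.
  have pF : punctured (fun y => is_derive y 1 F (g y) /\ {for y, continuous g}).
    by move=> s; have [d d0 hd] := dF s; exists d => // t /hd dt; split => //; exact: cg.
  by rewrite -(punctured_int cF (continuous_Lloc cg) pF 0 y) addrC subrK.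
by apply: eq_derive (dD (dC (F 0) x) (oint_derive 0 (continuous_Lloc cg) (cg x))); rewrite add0r.
Qed.

(** By compactness of a period. *)
Lemma finite_zeroes f : punctured (fun y => f y != 0) -> finite_set (zeroes f).
Proof.
move=> h; apply: (@sub_finite_set _ _ ([set t | 0 <= t <= 1] `&` [set t | f t = 0])).
  by move=> t [/=]; rewrite in_itv /= => /andP[t0 t1] ft; split => //=; rewrite t0 ltW.
apply: (cousin (P := fun u w => finite_set ([set t : R | u <= t <= w] `&` [set t | f t = 0])) ler01).
  move=> x y z xy yz fx fy; apply: (@sub_finite_set _ _ _ _ (_ : finite_set (_ `|` _))); last by rewrite finite_setU; split; [exact: fx|exact: fy].
  move=> t [/= /andP[t1 t2] ft]; have [ty|/ltW ty] := leP t y; [left|right]; split => //=; apply/andP; split => //.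
move=> x; have [d d0 hd] := h x; exists d => // u w du ux xw wd.
apply: (@sub_finite_set _ _ [set x]); last exact: finite_set1.
move=> t [/= /andP[t1 t2] ft]; apply/eqP; rewrite -subr_eq0 -normr_eq0 eq_le normr_ge0 andbT leNgt; apply/negP => tx.
suff /hd : 0 < `|t - x| < d by rewrite ft eqxx.
by rewrite tx /= ltr_norml; apply/andP; split; lra.
Qed.

(** The involution t |-> 1 - t pairs the zeroes in (0, 1/2) with those in (1/2, 1). *)
Lemma zeroes_parity q n : periodic q 1 -> (forall t, q (1 - t) = q t) -> (zeroes q #= `I_n)%card ->
  odd n = (q 0 == 0) (+) (q 2^-1 == 0).
Proof.
move=> qp qs cn; have fz : finite_set (zeroes q) by exists n.
pose s := finmap.enum_fset (fset_set (zeroes q)).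
have us : uniq s by exact: finmap.fset_uniq.
have ms x : (x \in s) = (0 <= x < 1) && (q x == 0).
  transitivity (x \in zeroes q); first exact: in_fset_set.
  apply/idP/idP; rewrite inE /zeroes /= in_itv /=; first by case=> -> ->; rewrite eqxx.
  by move=> /andP[-> /eqP ->].
rewrite -(card_fset_set cn) -/s.
pose a := [seq t <- s | 0 < t < 2^-1].
pose s' := [seq 1 - t | t <- a] ++ a ++ nseq (q 0 == 0) 0 ++ nseq (q 2^-1 == 0) 2^-1.
have ma x : (x \in a) = (0 < x < 2^-1) && (q x == 0).
  rewrite mem_filter ms; apply/idP/idP; first by move=> /andP[-> /andP[_ ->]].
  by move=> /andP[/andP[x0 x1] ->]; rewrite x0 x1 (ltW x0) /= andbT; lra.
have ma' x : (x \in [seq 1 - t | t <- a]) = (2^-1 < x < 1) && (q x == 0).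
  apply/mapP/idP => [[y]|/andP[/andP[x0 x1] qx]].
    by rewrite ma => /andP[/andP[y0 y1] qy] ->; rewrite qs qy andbT; apply/andP; split; lra.
  by exists (1 - x); rewrite ?subKr // ma qs qx andbT; apply/andP; split; lra.
have mn (b : bool) x y : (x \in nseq b y) = b && (x == y).
  by rewrite mem_nseq; case: b.
have pe : perm_eq s s'.
  apply: uniq_perm => //.
    rewrite /s' !cat_uniq; apply/and5P; split.
    - by rewrite map_inj_uniq ?filter_uniq // => x y; lra.
    - apply/hasPn => x; rewrite !mem_cat ma ma' !mn => /or3P[/andP[/andP[x1 x2] _]|/andP[_ /eqP ->]|/andP[_ /eqP ->]];
        apply/negP => /andP[/andP[x3 x4] _]; lra.
    - exact: filter_uniq.
    - apply/hasPn => x; rewrite !mem_cat ma !mn => /orP[/andP[_ /eqP ->]|/andP[_ /eqP ->]];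
        apply/negP => /andP[/andP[x3 x4] _]; lra.
    - apply/and3P; split; [by case: (q 0 == 0)| |by case: (q 2^-1 == 0)].
      apply/hasPn => x; rewrite !mn => /andP[_ /eqP ->]; apply/negP => /andP[_ /eqP]; lra.
  move=> x; rewrite ms /s' !mem_cat ma ma' !mn.
  apply/idP/idP => [/andP[/andP[x0 x1] qx]|].
    have q0 : x = 0 -> q 0 == 0 by move: qx => /[swap] ->.
    have [/q0 ->|n0] := eqVneq x 0; first by rewrite !orbT.
    have q2 : x = 2^-1 -> q 2^-1 == 0 by move: qx => /[swap] ->.
    have [/q2 ->|n1] := eqVneq x 2^-1; first by rewrite !orbT.
    rewrite qx !andbF !andbT /= !orbF x1 andbT.
    have xp : 0 < x by rewrite lt_neqAle eq_sym n0.
    by rewrite xp /=; case: ltgtP n1 => //.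
  case/or4P => [/andP[/andP[x0 x1] ->]|/andP[/andP[x0 x1] ->]|/andP[qx /eqP ->]|/andP[qx /eqP ->]];
   rewrite ?qx andbT; apply/andP; split; lra.
rewrite (perm_size pe) /s' !size_cat !size_nseq size_map addnA !oddD addbb /=.
by case: (_ == _); case: (_ == _).
Qed.

Definition near_open (U : set R) := forall x, U x -> exists2 d : R, 0 < d & forall y, `|y - x| < d -> U y.

Lemma derive1_near (U : set R) h h' g : near_open U -> (forall t, U t -> h t = g t) ->
  (forall t, U t -> is_derive t 1 g (h' t)) -> forall t, U t -> is_derive t 1 h (h' t).
Proof.
move=> oU e dk t Ut; have [d d0 hd] := oU t Ut.
by apply: (near_derive d0 _ (dk t Ut)) => y /hd/e.
Qed.

(** Membership in a family closed under derivation on U propagates to all iterated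
    derivatives, without formulas for them. *)
Lemma smooth_closed (U : set R) (A : (R -> R) -> Prop) h : near_open U ->
  (forall g, A g -> exists2 g', A g' & forall t, U t -> is_derive t 1 g (g' t)) ->
  A h -> smooth_on U h.
Proof.
move=> oU cl Ah n.
suff [k Ak e] : exists2 g, A g & forall t, U t -> derive1n n h t = g t.
  move=> t Ut; have [k' _ dk] := cl k Ak.
  by have := derive1_near oU e dk Ut; case.
elim: n => [|n [k Ak e]]; first by exists h.
have [k' Ak' dk] := cl k Ak; exists k' => // t Ut.
by rewrite derive1nS derive1E; exact: (@derive_val _ _ _ _ _ _ _ (derive1_near oU e dk Ut)).
Qed.

End IsolatedPoints.

Section MonotoneLimit.
Context {R : realType}.
Local Notation mu := (@lebesgue_measure R).
Implicit Types (a b M t : R).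

(** Monotone convergence. *)
Lemma Lloc_monotone (h : nat -> R -> R) (H : R -> R) :
  (forall n, continuous (h n)) -> (forall n t, 0 <= h n t) ->
  (forall t, {homo h^~ t : n m / (n <= m)%N >-> n <= m}) -> (forall t, h^~ t @ \oo --> H t) ->
  (forall a b, a <= b -> exists M, forall n, oint (h n) a b <= M) -> Lloc H.
Proof.
move=> ch h0 hm hH hM a b; have [ab|ba] := leP a b; last first.
  by rewrite set_itv_ge ?bnd_simp -?ltNge //; exact: integrable_set0.
have [M bM] := hM a b ab.
have mh n : measurable_fun `[a, b] (EFin \o h n).
  by apply/measurable_EFinP; apply: measurable_funTS; exact: continuous_meas.
have limE t : limn (fun n => (h n t)%:E) = (H t)%:E.
  by apply/cvg_lim => //; apply: cvg_EFin; [exact: nearW|exact: hH].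
have H0 t : 0 <= H t.
  by rewrite -(cvg_lim _ (hH t)) //; apply: limr_ge; [apply/cvg_ex; exists (H t); exact: hH|exact: nearW].
have mH : measurable_fun `[a, b] (EFin \o H).
  apply/measurable_EFinP; apply: (measurable_fun_cvg (h := h)) => // n.
  by apply: measurable_funTS; exact: continuous_meas.
apply/integrableP; split => //.
rewrite (_ : (fun t => `|(EFin \o H) t|%E) = (fun t => limn (fun n => (EFin \o h n) t))); last first.
  by apply/funext => t /=; rewrite limE ger0_norm.
have h0' n t : `[a, b]%classic t -> (0 <= (EFin \o h n) t)%E by rewrite lee_fin.
have hm' t : `[a, b]%classic t -> {homo (fun n => (EFin \o h n) t) : n m / (n <= m)%N >-> (n <= m)%E}.
  by move=> _ n m nm; rewrite lee_fin; exact: hm.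
have cv := @cvg_monotone_convergence _ _ R mu _ (measurable_itv `[a, b]) (fun n => EFin \o h n) mh h0' hm'.
rewrite -(cvg_lim _ cv) //; apply: (@le_lt_trans _ _ M%:E); last exact: ltry.
apply: lime_le; first by apply/cvg_ex; exists (\int[mu]_(x in `[a, b]) limn (fun n => (EFin \o h n) x))%E.
apply: nearW => n; have := bM n; rewrite (ointE _ ab) /Rintegral -lee_fin fineK //.
by apply: integrable_fin_num => //; exact: (continuous_Lloc (ch n)).
Qed.

End MonotoneLimit.

(** * Increasing changes of time *)

Section Monotone.
Context {R : realType}.
Implicit Types (f g h q F G T tau : R -> R) (a b c x y k M e d s t : R).

Definition strict_incr T := forall s t, s < t -> T s < T t.

Lemma increasing_lt T s t : strict_incr T -> T s < T t -> s < t.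
Proof. by move=> iT; apply: contraTT; rewrite -!leNgt le_eqVlt => /predU1P[->//|/iT/ltW]. Qed.

Lemma increasing_inj T : strict_incr T -> injective T.
Proof. by move=> iT s t; case: (ltgtP s t) => // /iT + e; rewrite e ltxx. Qed.

Lemma increasing_inverse_cont T tau : strict_incr T -> (forall t, T (tau t) = t) -> continuous tau.
Proof.
move=> iT K t; apply/contP => e e0; set s := tau t.
have ts : t = T s by rewrite K.
have h1 : T (s - e) < t by rewrite ts; apply: iT; lra.
have h2 : t < T (s + e) by rewrite ts; apply: iT; lra.
exists (Num.min (t - T (s - e)) (T (s + e) - t)); first by rewrite lt_min !subr_gt0 h1.
move=> u; rewrite lt_min !ltr_norml => /andP[/andP[u1 _] /andP[_ u2]].
have h3 : s - e < tau u by apply: (increasing_lt iT); rewrite K; lra.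
have h4 : tau u < s + e by apply: (increasing_lt iT); rewrite K; lra.
by apply/andP; split; lra.
Qed.

Lemma increasing_inverse_derive T tau s k : strict_incr T -> continuous T -> (forall t, T (tau t) = t) ->
  is_derive s 1 T k -> k != 0 -> is_derive (T s) 1 tau k^-1.
Proof.
move=> iT cT K dT k0; apply: (is_derive_inverse (f := T)) => //.
  apply/nbhs_ballP; exists 1 => [|x _]; first exact: ltr01.
  by apply: (increasing_inj iT); rewrite K.
apply/nbhs_ballP; exists 1 => [|x _]; first exact: ltr01.
exact: cT.
Qed.

Lemma punctured_comp (P : R -> Prop) h : continuous h -> injective h -> punctured P -> punctured (fun y => P (h y)).
Proof.
move=> ch ih hP x; have [d d0 hd] := hP (h x); have /contP/(_ _ d0)[d' d'0 hd'] := ch x.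
exists d' => // y /andP[y0 yd]; apply: hd; rewrite hd' // andbT normr_gt0 subr_eq0.
by apply: contraTneq y0 => /ih ->; rewrite subrr normr0 ltxx.
Qed.

Lemma cont_neq0 f x : {for x, continuous f} -> f x != 0 -> exists2 d : R, 0 < d & forall y, `|y - x| < d -> f y != 0.
Proof.
move=> /contP cf fx; have h : 0 < `|f x| by rewrite normr_gt0.
have [d d0 hd] := cf _ h; exists d => // y /hd; apply: contraTneq => ->.
by rewrite sub0r normrN ltxx.
Qed.

Lemma derive_neq0 f x k : is_derive x 1 f k -> f x = 0 -> k != 0 ->
  exists2 d : R, 0 < d & forall y, 0 < `|y - x| < d -> f y != 0.
Proof.
move=> /is_deriveP df fx k0; have h : 0 < `|k| / 2 by rewrite divr_gt0 // normr_gt0.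
have [d d0 hd] := df _ h; exists d => // y /andP[y0 yd].
have := hd (y - x) yd; rewrite (addrC x) subrK fx subr0; apply: contraTneq => ->.
by rewrite sub0r normrN normrM -ltNge ltr_pM2r //; move: h; lra.
Qed.

(** The functions q / (q ^+ 2 + 1 / n) are continuous, vanish with q, and increase
    to 1 / q, with the value 0 at zeroes of q. *)
Lemma Lloc_inv q : continuous q -> (forall t, 0 <= q t) ->
  (forall a b, a <= b -> exists M, forall n, oint (fun t => q t / (q t ^+ 2 + n.+1%:R^-1)) a b <= M) ->
  Lloc (fun t => (q t)^-1).
Proof.
move=> cq q0; pose h n t := q t / (q t ^+ 2 + n.+1%:R^-1) => hM.
have den n t : 0 < q t ^+ 2 + n.+1%:R^-1 :> R by rewrite ltr_wpDl ?sqr_ge0 // invr_gt0.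
have hc n : continuous (h n).
  apply: contM => //; apply: contV => [|t]; last by rewrite gt_eqF.
  by apply: contD; [exact: cont_sqr|exact: cst_cont].
apply: (Lloc_monotone (h := h)) => // [n t|t n m nm|t].
- by apply: divr_ge0 => //; exact: ltW.
- rewrite /h ler_wpM2l // lef_pV2 ?posrE // lerD2l lef_pV2 ?posrE // ler_nat //.
have [qt|qt] := eqVneq (q t) 0.
  rewrite /h qt invr0; under eq_fun do rewrite mul0r; exact: cvg_cst.
have -> : (q t)^-1 = q t / (q t ^+ 2 + 0) by rewrite addr0; field.
apply: cvgM; first exact: cvg_cst.
apply: cvgV; first by rewrite addr0 sqrf_eq0.
by apply: cvgD; [exact: cvg_cst|exact: cvg_harmonic].
Qed.

End Monotone.

(** * The transform of a regularized orbit *)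

Section KeplerOrbit.
Context {R : realType}.
Implicit Types (h q F G : R -> R) (a b c x y k M e d s t : R).
Variables (sg eps : R) (f g p E K : R -> R).
Hypotheses (fl : nloop sg f g) (cK : continuous K) (Kp : forall t, K (t + 1) = K t).
Hypothesis kp : kepler eps f p E K.

Local Opaque normsq wderiv oint.

Let sg1 : sg ^+ 2 = 1 := let: And4 _ h _ _ := fl in h.
Let ft : twist sg f := let: And4 _ _ h _ := fl in h.
Let N0 : 0 < normsq f := let: And4 _ _ _ h := fl in h.
Let sq : sqloop f.
Proof. by have [h1 h2 h3 h4] := fl; exact: twist_sqloop h1 h2 h3 h4. Qed.
Let df : forall s, is_derive s 1 f (p s) := let: And4 h _ _ _ := kp in h.
Let dp : forall s, is_derive s 1 p
        (f s * (E s + eps * (f s ^+ 2 * K (timechange f s))) / (2 * normsq f ^+ 2)) := let: And4 _ h _ _ := kp in h.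
Let dE : forall s, is_derive s 1 E (eps * (2 * (f s * p s) * K (timechange f s))) := let: And4 _ _ h _ := kp in h.
Let EP : forall s, E s * f s ^+ 2 = 2 * normsq f ^+ 2 * p s ^+ 2 - 2 := let: And4 _ _ _ h := kp in h.
Let cf : continuous f := derive_cont df.
Let cp : continuous p := derive_cont dp.
Let cE : continuous E := derive_cont dE.
Local Notation N := (normsq f).
Local Notation T := (timechange f).
Local Notation tau := (invtime f).
Local Notation q := (lc f).
Let n0 : N != 0. Proof. by rewrite gt_eqF. Qed.

Lemma kepler_simple s : f s = 0 -> p s != 0.
Proof.
by move=> fs; have := EP s; rewrite fs expr0n mulr0 => h; apply/eqP => ps; move: h; rewrite ps expr0n mulr0; lra.
Qed.

Lemma kepler_isolated : punctured (fun s => f s != 0).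
Proof.
move=> x; have [fx|fx] := eqVneq (f x) 0; first by exact: derive_neq0 (df x) fx (kepler_simple fx).
by have [d d0 hd] := cont_neq0 (@cf x) fx; exists d => // y /andP[_ /hd].
Qed.

(** Were T constant on an interval, f and then p would vanish inside it. *)
Lemma timechange_incr : strict_incr T.
Proof.
move=> s t st; rewrite lt_neqAle (timechange_mono sq (ltW st)) andbT; apply/eqP => e.
have z x : s < x < t -> f x = 0.
  move=> /andP[sx xt]; have d0 : 0 < Num.min (x - s) (t - x) by rewrite lt_min !subr_gt0 sx.
  have : is_derive x 1 T 0.
    apply: (near_derive d0 _ (dC (T s) x)) => y; rewrite lt_min !ltr_norml => /andP[/andP[y1 _] /andP[_ y2]].
    apply/eqP; rewrite eq_le (timechange_mono sq) ?e ?(timechange_mono sq) //; lra.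
  move=> /(derive_unique (timechange_derive sq x))/eqP.
  by rewrite mulf_eq0 invr_eq0 (negbTE n0) orbF sqrf_eq0 => /eqP.
pose m := (s + t) / 2; have d0 : 0 < (t - s) / 2 by lra.
have fm : f m = 0 by apply: z; rewrite /m; apply/andP; split; lra.
have : is_derive m 1 f 0.
  apply: (near_derive d0 _ (dC 0 m)) => y; rewrite ltr_norml /m => /andP[y1 y2].
  by rewrite z //; apply/andP; split; lra.
by move=> /(derive_unique (df m)) pm; have := kepler_simple fm; rewrite pm eqxx.
Qed.

Lemma timechangeK s : tau (T s) = s.
Proof. by apply: (increasing_inj timechange_incr); rewrite (timechange_invtime sq). Qed.

Lemma invtime_cont : continuous tau.
Proof. exact: increasing_inverse_cont timechange_incr (timechange_invtime sq). Qed.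

Lemma invtimeS t : tau (t + 1) = tau t + 1.
Proof. by rewrite -[in LHS](timechange_invtime sq t) -(timechangeS sq) timechangeK. Qed.

Lemma lc_isolated : punctured (fun t => q t != 0).
Proof.
have inj : injective tau by move=> t u e; rewrite -(timechange_invtime sq t) e (timechange_invtime sq).
move=> x; have [d d0 hd] := punctured_comp invtime_cont inj kepler_isolated x.
by exists d => // y /hd; rewrite /lc sqrf_eq0.
Qed.

Lemma invtime_derive t : q t != 0 -> is_derive t 1 tau (N / q t).
Proof.
move=> qt; have := increasing_inverse_derive timechange_incr (timechange_cont sq) (timechange_invtime sq) (timechange_derive sq (tau t)).
rewrite (timechange_invtime sq) invf_div => h; apply: h.
by rewrite mulf_eq0 invr_eq0 (negbTE n0) orbF.
Qed.

(** The derivative of the transform away from collisions; it is 0 at collisions since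
    a division by 0 gives 0. *)
Definition velocity t := 2 * N * p (tau t) / f (tau t).

Let fn0 t : q t != 0 -> f (tau t) != 0. Proof. by rewrite /lc sqrf_eq0. Qed.

Lemma lc_derive t : q t != 0 -> is_derive t 1 q (velocity t).
Proof.
move=> qt; have := dsq (@chain_rule R f tau t _ _ (df _) (invtime_derive qt)).
apply: eq_derive; rewrite /velocity /lc; have := fn0 qt; move: (f _) (p _) (n0); by move=> x y _ x0; field.
Qed.

(** The Newton equation: the energy identity cancels the terms in E. *)
Lemma velocity_derive t : q t != 0 -> is_derive t 1 velocity (- (2 / q t ^+ 2) + eps * K t).
Proof.
move=> qt; have dt := invtime_derive qt; have f0 := fn0 qt.
have d1 := dZ (2 * N) (@chain_rule R p tau t _ _ (dp _) dt).
have d2 := dV f0 (@chain_rule R f tau t _ _ (df _) dt).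
apply: eq_derive (dM d1 d2).
rewrite (timechange_invtime sq) /lc; have := EP (tau t).
move: (f _) (p _) (E _) (K t) f0 (n0); move: (normsq f) => n x y a b x0 n1 h.
transitivity (- (2 / (x ^+ 2) ^+ 2) + eps * b + (a * x ^+ 2 - (2 * n ^+ 2 * y ^+ 2 - 2)) / x ^+ 4); last by rewrite h subrr mul0r addr0.
by field; rewrite x0.
Qed.

Lemma lc_energy t : q t != 0 -> E (tau t) = velocity t ^+ 2 / 2 - 2 / q t.
Proof.
move=> qt; have := EP (tau t); have := fn0 qt; rewrite /velocity /lc.
move: (f _) (p _) (E _) (normsq f) => x y a n x0 h.
apply: (mulIf (_ : x ^+ 2 != 0)); first by rewrite sqrf_eq0.
by rewrite h; field.
Qed.

Lemma kepler_p_twist s : p (s + 1) = sg * p s.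
Proof.
apply: (@derive_unique R (fun x => f (x + 1)) s).
  by apply: eq_derive (@chain_rule R f (fun x => x + 1) s _ _ (df _) (dD (dI s) (dC 1 s))); rewrite addr0 mulr1.
by rewrite (funext ft : (fun x => f (x + 1)) = fun x => sg * f x); exact: dZ.
Qed.

(** E (s + 1) - E s is a constant, which the energy identity annihilates at a
    parameter where f does not vanish. *)
Lemma energy_periodic s : E (s + 1) = E s.
Proof.
have c x y : E (x + 1) - E x = E (y + 1) - E y.
  apply: (derive0_cst (h := fun x => E (x + 1) - E x)) => z.
  apply: eq_derive (dB (@chain_rule R E (fun x => x + 1) z _ _ (dE _) (dD (dI z) (dC 1 z))) (dE z)).
  rewrite ft kepler_p_twist (timechangeS sq) Kp mulrACA -expr2 sg1; ring.
have [d d0 hd] := kepler_isolated 0.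
have fs : f (d / 2) != 0.
  by apply: hd; rewrite subr0 gtr0_norm ?divr_gt0 //; apply/andP; split; lra.
apply/eqP; rewrite -subr_eq0 (c s (d / 2)); apply/eqP; apply: (mulIf (_ : f (d / 2) ^+ 2 != 0)).
  by rewrite sqrf_eq0.
have [_ f1 _] := sq; have := EP (d / 2 + 1).
by rewrite f1 kepler_p_twist exprMn sg1 mul1r -EP mulrBl mul0r => ->; rewrite subrr.
Qed.

Lemma velocity_periodic t : velocity (t + 1) = velocity t.
Proof.
rewrite /velocity invtimeS kepler_p_twist ft.
have : sg != 0 by apply/eqP => h; move: sg1; rewrite h expr0n => /eqP; rewrite eq_sym oner_eq0.
move=> s0; have [->|f0] := eqVneq (f (tau t)) 0; first by rewrite mulr0 !invr0 !mulr0.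
by field; rewrite ?s0 ?f0.
Qed.

(** In the parameter s the measure dt / q is ds / N. *)
Lemma Lloc_inv_lc : Lloc (fun t => (q t)^-1).
Proof.
have cq : continuous q := lc_cont fl.
apply: Lloc_inv => // [t|a b ab]; first exact: sqr_ge0.
pose h n t := q t / (q t ^+ 2 + n.+1%:R^-1).
have hc n : continuous (h n).
  apply: contM => //; apply: contV => [|t]; last by rewrite gt_eqF // ltr_wpDl ?sqr_ge0 // invr_gt0.
  by apply: contD; [exact: cont_sqr|exact: cst_cont].
exists ((tau b - tau a) / N) => n.
have := q_substitution sq (tau a) (tau b) (hc n); rewrite !(timechange_invtime sq) => <-.
have tab : tau a <= tau b.
  by rewrite leNgt; apply/negP => /timechange_incr; rewrite !(timechange_invtime sq) ltNge ab.
rewrite mulrC -(oint_cst N^-1); apply: le_oint => //.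
- apply: continuous_Lloc; apply: contM; first by apply: cont_comp => //; exact: timechange_cont.
  by under eq_fun do rewrite mulrC; apply: contZ; exact: cont_sqr.
- by apply: continuous_Lloc; exact: cst_cont.
move=> x _; rewrite /h (lc_timechange fl) mulrA ler_piMl ?invr_ge0 ?(ltW N0) //.
have h0 : 0 < (f x ^+ 2) ^+ 2 + n.+1%:R^-1 :> R by rewrite ltr_wpDl ?sqr_ge0 // invr_gt0.
by rewrite mulrAC ler_pdivrMr // mul1r -expr2 lerDl invr_ge0.
Qed.

Lemma velocity_L2 : L2 velocity.
Proof.
have cpt : continuous (fun t => p (tau t)) by apply: cont_comp => //; exact: invtime_cont.
have cft : continuous (fun t => f (tau t)) by apply: cont_comp => //; exact: invtime_cont.
split.
  have -> : velocity = fun t => (2 * N * p (tau t) * f (tau t)) * (q t)^-1.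
    apply/funext => t; rewrite /velocity /lc; have [->|f0] := eqVneq (f (tau t)) 0; last by field.
    by rewrite invr0 !mulr0 mul0r.
  apply: measurable_funM; last exact: Lloc_meas Lloc_inv_lc.
  by apply: continuous_meas; apply: contM => //; exact: contZ.
have -> : (fun t => velocity t ^+ 2) = fun t => (4 * N ^+ 2 * p (tau t) ^+ 2) * (q t)^-1.
  by apply/funext => t; rewrite /velocity /lc exprMn -exprVn !exprMn; ring.
by apply: Lloc_contM; [apply: contZ; exact: cont_sqr|exact: Lloc_inv_lc].
Qed.

(** The transform is C^1 off the collisions, so it is a primitive of its velocity. *)
Lemma lc_abscont : abscont q velocity.
Proof.
split; first exact: velocity_L2.
apply: punctured_int; [exact: lc_cont fl|exact: L2_Lloc velocity_L2|].
move=> x; have [d d0 hd] := lc_isolated x; exists d => // y /hd qy.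
by split; [exact: lc_derive|exact: derive_cont_at (velocity_derive qy)].
Qed.

Lemma lc_H1 : H1 1 q.
Proof. by apply: (AC_H1 ltr01 _ _ lc_abscont) => t; [exact: lc_periodic fl _|exact: velocity_periodic]. Qed.

Lemma lc_open : near_open [set t | q t != 0].
Proof. by move=> t qt; apply: cont_neq0 => //; exact: lc_cont fl _. Qed.

Lemma derive1_lc t : q t != 0 -> derive1 q t = velocity t.
Proof. by move=> qt; rewrite derive1E (@derive_val _ _ _ _ _ _ _ (lc_derive qt)). Qed.

Lemma derive2_lc t : q t != 0 -> is_derive t 1 (derive1 q) (- (2 / q t ^+ 2) + eps * K t).
Proof.
move=> qt.
exact: (derive1_near lc_open (g := velocity) (h' := fun t => - (2 / q t ^+ 2) + eps * K t) derive1_lc velocity_derive qt).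
Qed.

Lemma derive1n2_lc t : q t != 0 -> derive1n 2 q t = - (2 / q t ^+ 2) + eps * K t.
Proof. by move=> qt; rewrite derive1nS derive1E (@derive_val _ _ _ _ _ _ _ (derive2_lc qt)). Qed.

Lemma lc_C2 : C2_on [set t | q t != 0] q.
Proof.
move=> t qt; split; [by case: (lc_derive qt)|by case: (derive2_lc qt)|].
have [d d0 hd] := lc_open qt.
have c : {for t, continuous (fun t => - (2 / q t ^+ 2) + eps * K t)}.
  apply: cvgD; last by apply: cvgM; [exact: cvg_cst|exact: cK].
  apply: cvgN; apply: cvgM; first exact: cvg_cst.
  by apply: cvgV; [rewrite sqrf_eq0|exact: cont_sqr (lc_cont fl) t].
apply/contP => e e0; have /contP/(_ _ e0)[d' d'0 hd'] := c.
exists (Num.min d d'); first by rewrite lt_min d0.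
by move=> y; rewrite lt_min => /andP[/hd qy /hd']; rewrite !derive1n2_lc.
Qed.

Lemma lc_energy_extends : energy_extends q.
Proof.
exists (fun t => E (tau t)); split.
- by apply: cont_comp => //; exact: invtime_cont.
- by move=> t; rewrite invtimeS energy_periodic.
- by move=> t qt; rewrite derive1_lc // lc_energy.
Qed.

End KeplerOrbit.

(** * Smoothness and the orbit of a critical point *)

Section Smoothness.
Context {R : realType}.
Implicit Types (f g h q F G : R -> R) (a b c x y k M e d s t r : R).

(** Finite sums of products of elements of G. *)
Inductive ring_span (G : (R -> R) -> Prop) : (R -> R) -> Prop :=
| span_gen h of G h : ring_span G h
| span_add g h of ring_span G g & ring_span G h : ring_span G (fun t => g t + h t)
| span_mul g h of ring_span G g & ring_span G h : ring_span G (fun t => g t * h t).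

Lemma span_closed (G : (R -> R) -> Prop) (U : set R) :
  (forall g, G g -> exists2 g', ring_span G g' & forall t, U t -> is_derive t 1 g (g' t)) ->
  forall g, ring_span G g -> exists2 g', ring_span G g' & forall t, U t -> is_derive t 1 g (g' t).
Proof.
move=> cl g; elim=> {g} [g /cl//|g h sg [g' sg' dg] sh [h' sh' dh]|g h sg [g' sg' dg] sh [h' sh' dh]].
  exists (fun t => g' t + h' t); first exact: span_add.
  by move=> t Ut; apply: dD; [exact: dg|exact: dh].
exists (fun t => g' t * h t + g t * h' t); first by apply: span_add; apply: span_mul.
by move=> t Ut; apply: dM; [exact: dg|exact: dh].
Qed.

Variables (q1 q2 v1 v2 : R -> R) (r kap : R).
Let U := [set t : R | q1 t != 0 /\ q2 t != 0].

(** On the set where q_1 and q_2 do not vanish the Newton equations express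
    the derivatives of these functions as polynomials in them. *)
Inductive orbit_gen : (R -> R) -> Prop :=
| gen_cst c : orbit_gen (fun=> c)
| gen_q1 : orbit_gen q1
| gen_q2 : orbit_gen q2
| gen_v1 : orbit_gen v1
| gen_v2 : orbit_gen v2
| gen_i1 : orbit_gen (fun t => (q1 t)^-1)
| gen_i2 : orbit_gen (fun t => (q2 t)^-1)
| gen_i12 : orbit_gen (fun t => (q1 t - q2 t)^-1).

Hypothesis q12 : forall t, q2 t < q1 t.
Hypothesis dq1 : forall t, q1 t != 0 -> is_derive t 1 q1 (v1 t).
Hypothesis dq2 : forall t, q2 t != 0 -> is_derive t 1 q2 (v2 t).
Hypothesis dv1 : forall t, q1 t != 0 -> is_derive t 1 v1 (- (2 / q1 t ^+ 2) + (r / (q1 t - q2 t) ^+ 2 + kap)).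
Hypothesis dv2 : forall t, q2 t != 0 -> is_derive t 1 v2 (- (2 / q2 t ^+ 2) - (r / (q1 t - q2 t) ^+ 2 + kap)).
Hypotheses (cq1 : continuous q1) (cq2 : continuous q2).

Lemma orbit_closed g : orbit_gen g ->
  exists2 g', ring_span orbit_gen g' & forall t, U t -> is_derive t 1 g (g' t).
Proof.
have sq h : ring_span orbit_gen h -> ring_span orbit_gen (fun t => h t * h t) by move=> ?; exact: span_mul.
have sZ c h : ring_span orbit_gen h -> ring_span orbit_gen (fun t => c * h t).
  by move=> ?; apply: (@span_mul _ (fun=> c)) => //; apply: span_gen; exact: gen_cst.
have s1 := span_gen gen_q1; have s2 := span_gen gen_q2; have s3 := span_gen gen_v1; have s4 := span_gen gen_v2.
have s5 := span_gen gen_i1; have s6 := span_gen gen_i2; have s7 := span_gen gen_i12.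
case.
- by move=> c; exists (fun=> 0); [apply: span_gen; exact: gen_cst|move=> t _; exact: dC].
- by exists v1 => // t [n1 _]; exact: dq1.
- by exists v2 => // t [_ n2]; exact: dq2.
- exists (fun t => (-2) * ((q1 t)^-1 * (q1 t)^-1) + (r * ((q1 t - q2 t)^-1 * (q1 t - q2 t)^-1) + kap)).
    apply: span_add; first exact: (sZ _ _ (sq _ s5)).
    by apply: (@span_add _ _ (fun=> kap)); [exact: (sZ _ _ (sq _ s7))|apply: span_gen; exact: gen_cst].
  by move=> t [n1 _]; apply: eq_derive (dv1 n1); rewrite -!exprVn -!expr2 mulNr.
- exists (fun t => (-2) * ((q2 t)^-1 * (q2 t)^-1) + ((- r) * ((q1 t - q2 t)^-1 * (q1 t - q2 t)^-1) + - kap)).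
    apply: span_add; first exact: (sZ _ _ (sq _ s6)).
    by apply: (@span_add _ _ (fun=> - kap)); [exact: (sZ _ _ (sq _ s7))|apply: span_gen; exact: gen_cst].
  by move=> t [_ n2]; apply: eq_derive (dv2 n2); rewrite -!exprVn -!expr2 !mulNr opprD.
- exists (fun t => (-1) * (v1 t * ((q1 t)^-1 * (q1 t)^-1))).
    by apply: sZ; apply: span_mul => //; exact: sq.
  by move=> t [n1 _]; apply: eq_derive (dV n1 (dq1 n1)); rewrite -!exprVn -!expr2 mulN1r mulNr.
- exists (fun t => (-1) * (v2 t * ((q2 t)^-1 * (q2 t)^-1))).
    by apply: sZ; apply: span_mul => //; exact: sq.
  by move=> t [_ n2]; apply: eq_derive (dV n2 (dq2 n2)); rewrite -!exprVn -!expr2 mulN1r mulNr.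
exists (fun t => (-1) * ((v1 t + (-1) * v2 t) * ((q1 t - q2 t)^-1 * (q1 t - q2 t)^-1))).
  apply: (sZ _ _); apply: span_mul; last exact: sq.
  by apply: span_add => //; exact: sZ.
move=> t [n1 n2]; have n12 : q1 t - q2 t != 0 by rewrite gt_eqF // subr_gt0.
by apply: eq_derive (@dV R (fun t => q1 t - q2 t) t _ n12 (dB (dq1 n1) (dq2 n2))); rewrite -!exprVn -!expr2 !mulN1r mulNr.
Qed.

Lemma orbit_smooth h : orbit_gen h -> smooth_on U h.
Proof.
move=> Gh; apply: (smooth_closed (A := ring_span orbit_gen)); last exact: span_gen.
  move=> t [n1 n2]; have [d1 d10 h1] := cont_neq0 (@cq1 t) n1; have [d2 d20 h2] := cont_neq0 (@cq2 t) n2.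
  exists (Num.min d1 d2); first by rewrite lt_min d10.
  by move=> y; rewrite lt_min => /andP[/h1 ? /h2].
by apply: span_closed; exact: orbit_closed.
Qed.

End Smoothness.

Section LeviCivitaSolution.
Context {R : realType}.
Implicit Types (z : (R -> R) * (R -> R)) (r t : R).

Local Opaque normsq wderiv oint.

(** z_2 is even and antiperiodic, so it vanishes at 0; its derivative vanishes at 1/2,
    where it therefore has no transversal zero. *)
Lemma critical_solution r z : Hhat_in z -> kepler_pair r z ->
  [/\ (forall t : R, (levi_civita z).1 t != 0 ->
         is_derive t 1 (invtime z.1) (normsq z.1 / (levi_civita z).1 t)),
      (forall t : R, (levi_civita z).2 t != 0 ->
         is_derive t 1 (invtime z.2) (normsq z.2 / (levi_civita z).2 t)),
      symmetric_frozen_planet r (levi_civita z) &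
      (levi_civita z).2 0 = 0].
Proof.
move=> hz [p1 [E1 [p2 [E2 [k1 k2]]]]]; have [s1 s2 hz'] := H1_sym_nloops hz.
have [tz fl1 fl2 gp] := Htilde_nloops hz'.
have cK : continuous (Kforce r z) by exact: Kforce_cont.
have Kp t : Kforce r z (t + 1) = Kforce r z t by exact: Kforce_periodic.
have [a1 b1 t1 n1] := fl1; have [a2 b2 t2 n2] := fl2.
have sq1 := twist_sqloop a1 b1 t1 n1; have sq2 := twist_sqloop a2 b2 t2 n2.
have q10 t : lc z.1 t != 0 by rewrite gt_eqF // (le_lt_trans _ (gp t)) // sqr_ge0.
have z0 : zeroes (lc z.1) = set0 by apply/seteqP; split => // t [_ /= h]; have := q10 t; rewrite h eqxx.
have f0 : z.2 0 = 0.
  by have := s2 0; rewrite subr0 -[X in z.2 X]add0r t2; lra.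
have q20 : lc z.2 0 = 0 by have := lc_timechange fl2 0; rewrite timechange0 f0 expr0n.
have T2 : timechange z.2 2^-1 = 2^-1.
  have := timechange_sym 2^-1 sq2 s2; rewrite (_ : 1 - 2^-1 = 2^-1 :> R); lra.
have df2 : forall s : R, is_derive s 1 z.2 (p2 s) by case: k2.
have p2h : p2 2^-1 = 0.
  have h2 : (1 - 2^-1 : R) = 2^-1 by lra.
  have := @chain_rule R z.2 (fun s => 1 - s) 2^-1 _ _ (df2 _) (dB (dC 1 _) (dI _)).
  rewrite (_ : (fun s => z.2 (1 - s)) = z.2); last by apply/funext.
  by move=> /(derive_unique (df2 _)); rewrite h2; lra.
have q2h : lc z.2 2^-1 != 0.
  rewrite -T2 (lc_timechange fl2) sqrf_eq0; apply/eqP => /(kepler_simple k2).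
  by rewrite p2h eqxx.
have fz2 : finite_set (zeroes (lc z.2)) by apply: finite_zeroes; exact: lc_isolated fl2 k2.
have ly1 := @lc_derive _ _ _ _ _ _ _ _ fl1 k1; have ly2 := @lc_derive _ _ _ _ _ _ _ _ fl2 k2.
pose kap := (1 - r) / (mean (lc z.1) - mean (lc z.2)) ^+ 2.
have dv1 t : lc z.1 t != 0 -> is_derive t 1 (velocity z.1 p1) (- (2 / lc z.1 t ^+ 2) + (r / (lc z.1 t - lc z.2 t) ^+ 2 + kap)).
  by move=> qt; apply: eq_derive (velocity_derive fl1 k1 qt); rewrite mul1r.
have dv2 t : lc z.2 t != 0 -> is_derive t 1 (velocity z.2 p2) (- (2 / lc z.2 t ^+ 2) - (r / (lc z.1 t - lc z.2 t) ^+ 2 + kap)).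
  by move=> qt; apply: eq_derive (velocity_derive fl2 k2 qt); rewrite mulN1r.
have sm := orbit_smooth gp ly1 ly2 dv1 dv2 (lc_cont fl1) (lc_cont fl2).
have ls1 := lc_sym sq1 s1; have ls2 := lc_sym sq2 s2.
rewrite (_ : levi_civita z = (lc z.1, lc z.2)); last by [].
split.
- by move=> t qt; exact: (invtime_derive fl1 k1 qt).
- by move=> t qt; exact: (invtime_derive fl2 k2 qt).
- split.
  + split.
    * split; [exact: lc_H1 fl1 k1|exact: lc_H1 fl2 k2|by move=> t; exact: sqr_ge0|by move=> t; exact: sqr_ge0].
    * exact: gp.
    * by rewrite /= z0; split; [exact: finite_set0|exact: fz2].
    * rewrite /=; split; [exact: lc_C2 fl1 cK k1|exact: lc_C2 fl2 cK k2|exact: sm (gen_q1 _ _ _ _)|exact: sm (gen_q2 _ _ _ _)].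
    * split.
      - by move=> t qt; have := derive1n2_lc fl1 k1 qt; rewrite mul1r addrA.
      - by move=> t qt; have := derive1n2_lc fl2 k2 qt; rewrite mulN1r opprD addrA.
      - exact: lc_energy_extends fl1 Kp k1.
      - exact: lc_energy_extends fl2 Kp k2.
  + by split => t; apply/esym; [exact: ls1|exact: ls2].
  + by exists 0%N => //; rewrite /= z0 II0.
  + have [n cn] := fz2; exists n => //.
    by rewrite (zeroes_parity (lc_periodic fl2) ls2 cn) q20 eqxx (negbTE q2h).
- exact: q20.
Qed.

End LeviCivitaSolution.

(** * A sign that flips at the collisions *)

Section SignFunction.
Context {R : realType}.
Implicit Types (f g h q : R -> R) (a b c x y d s t : R) (l : seq R).

Lemma list_gap l x : exists2 d : R, 0 < d & forall y, y \in l -> y != x -> d <= `|y - x|.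
Proof.
elim: l => [|a l [d d0 hd]]; first by exists 1.
have [->|ax] := eqVneq a x.
  by exists d => // y; rewrite inE => /predU1P[->|]; [rewrite eqxx|exact: hd].
exists (Num.min d `|a - x|); first by rewrite lt_min d0 normr_gt0 subr_eq0.
move=> y; rewrite inE ge_min => /predU1P[-> _|yl yx]; first by rewrite lexx orbT.
by rewrite hd.
Qed.

Definition count_le l t := count (fun y => y <= t) l.

Definition count_lt l t := count (fun y => y < t) l.

Lemma count_le_local l x : exists d : R, [/\ 0 < d,
  forall t, x <= t -> t < x + d -> count_le l t = count_le l x &
  forall t, x - d < t -> t < x -> count_le l t = count_lt l x].
Proof.
have [d d0 hd] := list_gap l x; exists d; split => // t t1 t2; apply: eq_in_count => y yl /=.
  apply/idP/idP => [yt|/le_trans -> //]; rewrite leNgt; apply/negP => xy.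
  have := hd y yl; rewrite gt_eqF // => /(_ isT); rewrite gtr0_norm; lra.
apply/idP/idP => [/le_lt_trans -> //|yx]; rewrite leNgt; apply/negP => ty.
have := hd y yl; rewrite lt_eqF // => /(_ isT); rewrite ltr0_norm; lra.
Qed.

Lemma count_le_split l x : uniq l -> count_le l x = (count_lt l x + (x \in l))%N.
Proof.
move=> ul; rewrite -(count_uniq_mem x ul) /count_le.
rewrite -(count_predUI (fun y => y < x) (pred1 x)).
rewrite [X in (_ + X)%N](_ : _ = 0%N); last first.
  by apply/eqP; rewrite -leqn0 leqNgt -has_count -all_predC; apply/allP => y _ /=; case: ltgtP.
by rewrite addn0; apply: eq_count => y /=; rewrite le_eqVlt orbC.
Qed.

Lemma zeroes_list q : finite_set (zeroes q) -> exists2 l, uniq l & forall x, (x \in l) = (0 <= x < 1) && (q x == 0).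
Proof.
move=> fz; exists (finmap.enum_fset (fset_set (zeroes q))); first exact: finmap.fset_uniq.
move=> x; transitivity (x \in zeroes q); first exact: in_fset_set.
apply/idP/idP; rewrite inE /zeroes /= in_itv /=; first by case=> -> ->; rewrite eqxx.
by move=> /andP[-> /eqP ->].
Qed.

(** sig is a right continuous sign, constant between zeroes of q, that changes at each
    zero. *)
Definition flips q (sig : R -> R) := (forall t, sig t ^+ 2 = 1) /\
  forall x, exists d : R, [/\ 0 < d, forall t, x <= t -> t < x + d -> sig t = sig x &
    forall t, x - d < t -> t < x -> sig t = (if q x == 0 then -1 else 1) * sig x].

(** The parity of the number of zeroes in (0, t], up to a shift: the zeroes of a period
    contribute n for each unit of time, and the list l those of the current period. *)
Lemma flips_exists q : periodic q 1 -> finite_set (zeroes q) -> exists sig, flips q sig.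
Proof.
move=> qp /zeroes_list[l ul ml].
(* a period contributes the factor c to the sign *)
pose c : R := (-1) ^+ size l.
have c2 : c ^+ 2 = 1 by exact: sqrr_sign.
have c0 : c != 0 by rewrite -sqrf_eq0 c2 oner_eq0.
pose sig t : R := c ^ (Num.floor t) * (-1) ^+ count_le l (t - (Num.floor t)%:~R).
have sig1 t : sig (t + 1) = c * sig t.
  rewrite /sig (_ : Num.floor (t + 1) = Num.floor t + 1); last by rewrite floorDrz ?floor1 // int_num1.
  by rewrite exprzDr ?unitfE // expr1z rmorphD /= opprD addrACA subrr addr0; ring.
have sigE t : 0 <= t -> t < 1 -> sig t = (-1) ^+ count_le l t.
  move=> t0 t1; rewrite /sig (_ : Num.floor t = 0) ?expr0z ?mul1r ?subr0 //.
  by apply/eqP; rewrite floor_eq t0 add0r t1.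
clearbody sig; exists sig; split.
  apply: (@per_reduce R (fun t => sig t ^+ 2 = 1)) => t; first by rewrite sig1 exprMn c2 mul1r.
  by move=> t0 t1; rewrite sigE // sqrr_sign.
apply: (@per_reduce R (fun x => _)) => x.
  split=> -[d [d0 h1 h2]]; exists d; split => // t t1 t2.
  - by apply: (mulfI c0); rewrite -!sig1; apply: h1; lra.
  - by apply: (mulfI c0); rewrite mulrCA -!sig1 (h2 (t + 1)) ?qp //; lra.
  - by rewrite -(subrK 1 t) (sig1 (t - 1)) (sig1 x) (h1 (t - 1)) //; lra.
  - by rewrite -(subrK 1 t) (sig1 (t - 1)) (sig1 x) qp (h2 (t - 1)); [ring|lra|lra].
move=> x0 x1; have [d [d0 h1 h2]] := count_le_local l x.
have right t : x <= t -> t < x + d -> t < 1 -> sig t = sig x.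
  by move=> xt td t1; rewrite !sigE // ?h1 //; exact: le_trans xt.
have sigx : (if q x == 0 then -1 else 1) * sig x = (-1) ^+ count_lt l x.
  rewrite (sigE x x0 x1) (count_le_split x ul) ml x0 x1 exprD /=.
  by case: (q x == 0); ring.
have [xp|xn] := ltP 0 x.
  exists (Num.min d (Num.min x (1 - x))); split.
  - by rewrite !lt_min d0 xp subr_gt0.
  - move=> t xt; rewrite -ltrBlDl !lt_min => /and3P[t1 _ t2]; apply: right => //; lra.
  - move=> t; rewrite ltrBlDr -ltrBlDl !lt_min => /and3P[t1 t2 _] tx.
    by rewrite sigx sigE ?h2 //; lra.
have xz : x = 0 by apply/eqP; rewrite eq_le xn x0.
rewrite {}xz in right sigx x0 x1 *.
(* to the left of 0 all zeroes of the previous period have been passed *)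
have [d' d'0 hd'] := list_gap l 1.
have l0 : count_lt l 0 = 0%N.
  apply/eqP; rewrite -leqn0 leqNgt -has_count -all_predC; apply/allP => y.
  by rewrite ml /= => /andP[/andP[y0 _] _]; rewrite -leNgt.
exists (Num.min d (Num.min d' 1)); split.
- by rewrite !lt_min d0 d'0 ltr01.
- by move=> t t0; rewrite add0r !lt_min => /and3P[t1 _ t2]; apply: right; rewrite ?add0r.
move=> t; rewrite sub0r ltrNl !lt_min => /and3P[t1 t2 t3] t0; rewrite sigx l0 expr0.
apply: (mulfI c0); rewrite -sig1 mulr1 sigE; [|lra|lra].
congr (_ ^+ _); apply/eqP; rewrite -all_count; apply/allP => y yl.
have /andP[/andP[y0 y1] _] : (0 <= y < 1) && (q y == 0) by rewrite -ml.
have := hd' y yl; rewrite lt_eqF // => /(_ isT); rewrite ltr0_norm; lra.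
Qed.

Lemma finite_punctured q : periodic q 1 -> finite_set (zeroes q) -> punctured (fun t => q t != 0).
Proof.
move=> qp /zeroes_list[l ul ml]; apply: (@per_reduce R (fun x => _)) => x.
  split=> -[d d0 hd]; exists d => // y.
    by have := hd (y + 1); rewrite qp (_ : y + 1 - (x + 1) = y - x) //; ring.
  by have := hd (y - 1); rewrite -(qp (y - 1)) subrK (_ : y - 1 - x = y - (x + 1)) //; ring.
(* a punctured neighbourhood of x in [0, 1) may meet the two adjacent periods *)
move=> x0 x1; pose l' := l ++ [seq y - 1 | y <- l] ++ [seq y + 1 | y <- l].
have [d d0 hd] := list_gap l' x; exists (Num.min d 1); first by rewrite lt_min d0 ltr01.
move=> y; rewrite lt_min => /and3P[y0 yd y1]; apply/eqP => qy.
suff yl : y \in l'.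
  have yx : y != x by rewrite -subr_eq0 -normr_gt0.
  by have := hd y yl yx; rewrite leNgt yd.
move: y1; rewrite ltr_norml => /andP[y1 y2]; rewrite !mem_cat.
have [yn|yp] := ltP y 0.
  apply/or3P/Or32/mapP; exists (y + 1); last by rewrite addrK.
  by rewrite ml qp qy eqxx andbT; apply/andP; split; lra.
have [y3|y3] := ltP y 1; first by rewrite ml yp y3 qy eqxx.
apply/or3P/Or33/mapP; exists (y - 1); last by rewrite subrK.
by rewrite ml -(qp (y - 1)) subrK qy eqxx andbT; apply/andP; split; lra.
Qed.

End SignFunction.

(** * Lifting a Newton orbit through its collisions *)

Section NewtonOrbit.
Context {R : realType}.
Implicit Types (f h F G T : R -> R) (a b c x y d s t : R).

(** One component of a generalized solution in a fixed force K, with velocity v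
    and energy e; the data are stable under translations of time. *)
Definition newton_orbit eps (q v e K : R -> R) :=
  [/\ [/\ continuous q, forall t, 0 <= q t, forall t, q (t + 1) = q t & sym q],
      punctured (fun t => q t != 0),
      [/\ forall t, q t != 0 -> is_derive t 1 q (v t),
          forall t, q t != 0 -> is_derive t 1 v (- (2 / q t ^+ 2) + eps * K t) &
          forall t, q t != 0 -> e t = v t ^+ 2 / 2 - 2 / q t],
      continuous e & (exists g, abscont q g) /\ (exists sig, flips q sig)].

Variables (eps : R) (q v e K g sig : R -> R).
Hypothesis (cq : continuous q).
Hypothesis (q0 : forall t, 0 <= q t).
Hypothesis (qp : forall t, q (t + 1) = q t).
Hypothesis (qs : sym q).
Hypothesis (nz : punctured (fun t => q t != 0)).
Hypothesis (dq : forall t, q t != 0 -> is_derive t 1 q (v t)).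
Hypothesis (dv : forall t, q t != 0 -> is_derive t 1 v (- (2 / q t ^+ 2) + eps * K t)).
Hypothesis (ev : forall t, q t != 0 -> e t = v t ^+ 2 / 2 - 2 / q t).
Hypothesis (ce : continuous e).
Hypothesis (cK : continuous K).
Hypothesis (qg : abscont q g).
Hypothesis (fs : flips q sig).

Lemma qv_sq t : (q t * v t) ^+ 2 = 4 * q t + 2 * e t * q t ^+ 2.
Proof.
have [->|qt] := eqVneq (q t) 0; first by rewrite mul0r expr0n /= !mulr0 addr0.
by rewrite ev //; field.
Qed.

Let neq_near t : q t != 0 -> exists2 d : R, 0 < d & forall y, `|y - t| < d -> q y != 0.
Proof. by move=> qt; apply: cont_neq0 => //; exact: cq. Qed.

(** (q v) ^+ 2 = 4 q + 2 e q ^+ 2 tends to 0 at collisions. *)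
Lemma qv_cont : continuous (fun t => q t * v t).
Proof.
move=> t; have [qt|qt] := eqVneq (q t) 0; last first.
  by apply: cvgM; [exact: cq|exact: derive_cont_at (dv qt)].
have ch : continuous (fun t => 4 * q t + 2 * e t * q t ^+ 2).
  by apply: contD; [exact: contZ|apply: contM; [exact: contZ|exact: cont_sqr]].
apply/contP => eps' e0; have [d d0 hd] := (contP _ _).1 (ch t) _ (exprn_gt0 2 e0).
exists d => // y /hd; rewrite qt mul0r expr0n /= !mulr0 addr0 !subr0 -qv_sq normrX.
by rewrite ltr_pXn2r // ?nnegrE // ltW.
Qed.

Lemma dq2 t : is_derive t 1 (fun t => q t ^+ 2) (2 * (q t * v t)).
Proof.
apply: (punctured_derive (F := fun t => q t ^+ 2) (g := fun t => 2 * (q t * v t))) => [||x].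
- exact: cont_sqr.
- by apply: contZ; exact: qv_cont.
have [d d0 hd] := nz x; exists d => // y /hd qy.
by apply: eq_derive (dsq (dq qy)); ring.
Qed.

(** q ^+ 2 has the weak derivative 2 q g and the continuous derivative 2 q v.
    As g is not known to equal v, they are compared in two steps under the integral. *)
Lemma energy_balance h a b : continuous h ->
  oint (fun t => h t * (2 * q t * g t) ^+ 2) a b = oint (fun t => h t * (2 * (q t * v t)) ^+ 2) a b.
Proof.
move=> ch; pose G t := 2 * q t * g t; pose V t := 2 * (q t * v t).
have cV : continuous V by apply: contZ; exact: qv_cont.
have aV : abscont (fun t => q t * q t) V.
  by apply: AC_C1 => // t; have := dq2 t; under eq_fun do rewrite expr2.
have aG : abscont (fun t => q t * q t) G.
  by have := AC_mul qg qg; congr abscont; apply/funext => t; rewrite /G; ring.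
have lG : L2 G by case: aG.
have e1 := AC_uniq a b aG aV (L2_contM ch lG).
have e2 := AC_uniq a b aG aV (L2_cont (contM ch cV)).
transitivity (oint (fun t => G t * (h t * G t)) a b); first by congr oint; apply/funext => t; rewrite /G; ring.
rewrite e1; transitivity (oint (fun t => G t * (h t * V t)) a b); first by congr oint; apply/funext => t; ring.
by rewrite e2; congr oint; apply/funext => t; rewrite /V; ring.
Qed.

(** With h = 1 / (q ^+ 2 + 1 / n) in [energy_balance], the energy turns q ^+ 2 v ^+ 2
    into 4 q + 2 e q ^+ 2; so 16 q / (q ^+ 2 + 1 / n) has integral at most that of
    4 g ^+ 2 + 8 `|e|, uniformly in n. *)
Lemma Lloc_inv_orbit : Lloc (fun t => (q t)^-1).
Proof.
apply: Lloc_inv => // a b ab.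
have [_ lg2] : L2 g by case: qg.
have ce1 : continuous (fun t => 8 * e t) by exact: contZ.
exists ((oint (fun t => 4 * g t ^+ 2) a b + oint (fun t => `|8 * e t|) a b) / 16) => n.
pose den t := q t ^+ 2 + n.+1%:R^-1.
have dp t : 0 < den t by rewrite ltr_wpDl ?sqr_ge0 // invr_gt0.
have cd : continuous (fun t => (den t)^-1).
  apply: contV => [|t]; last by rewrite gt_eqF.
  by apply: contD; [exact: cont_sqr|exact: cst_cont].
have qd t : 0 <= q t ^+ 2 / den t <= 1.
  rewrite divr_ge0 ?sqr_ge0 ?(ltW (dp t)) //= ler_pdivrMr // mul1r lerDl invr_ge0 //.
have cqd : continuous (fun t => q t ^+ 2 / den t) by apply: contM => //; exact: cont_sqr.
have lh : Lloc (fun t => q t / den t) by apply: continuous_Lloc; exact: contM.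
have lk : Lloc (fun t => (8 * e t) * (q t ^+ 2 / den t)) by apply: continuous_Lloc; exact: contM.
have lG : Lloc (fun t => (q t ^+ 2 / den t) * (4 * g t ^+ 2)) by apply: Lloc_contM => //; exact: LlocZ.
have E := energy_balance a b cd.
have eG : (fun t => (den t)^-1 * (2 * q t * g t) ^+ 2) = (fun t => (q t ^+ 2 / den t) * (4 * g t ^+ 2)).
  by apply/funext => t; ring.
have eV : (fun t => (den t)^-1 * (2 * (q t * v t)) ^+ 2) = (fun t => 16 * (q t / den t) + (8 * e t) * (q t ^+ 2 / den t)).
  by apply/funext => t; rewrite exprMn qv_sq; ring.
rewrite eG eV (ointD a b (LlocZ 16 lh) lk) (ointZ 16 a b lh) in E.
have i1 : oint (fun t => (q t ^+ 2 / den t) * (4 * g t ^+ 2)) a b <= oint (fun t => 4 * g t ^+ 2) a b.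
  apply: le_oint => //; first exact: LlocZ.
  by move=> t _; have /andP[_ h1] := qd t; rewrite ler_piMl // mulr_ge0 // sqr_ge0.
have i2 : - oint (fun t => (8 * e t) * (q t ^+ 2 / den t)) a b <= oint (fun t => `|8 * e t|) a b.
  have lk' := LlocN lk; rewrite -(ointN a b lk); apply: le_oint => //.
    by apply: Lloc_abs; exact: continuous_Lloc.
  move=> t _; apply: (le_trans (ler_norm _)); rewrite normrN normrM.
  by have /andP[h0 h1] := qd t; rewrite (ger0_norm h0) ler_piMr.
rewrite ler_pdivlMr // mulrC -/den; move: E i1 i2.
by move: (oint _ _ _) (oint _ _ _) (oint _ _ _) (oint _ _ _) (oint _ _ _) => A B C D F *; lra.
Qed.

Let S := oint (fun t => (q t)^-1) 0.

Let cS : continuous S. Proof. by apply: oint_continuous; exact: Lloc_inv_orbit. Qed.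

Let dS t : q t != 0 -> is_derive t 1 S (q t)^-1.
Proof. by move=> qt; apply: (oint_derive 0 Lloc_inv_orbit); apply: cvgV => //; exact: cq. Qed.

Let S_sub s t : S t - S s = oint (fun t => (q t)^-1) s t.
Proof. by rewrite /S -(oint_chasles 0 s t Lloc_inv_orbit) addrAC subrr add0r. Qed.

Let S_incr : strict_incr S.
Proof.
have mono s t : s <= t -> S s <= S t.
  by move=> st; rewrite -subr_ge0 S_sub; apply: oint_ge0 => // x _; rewrite invr_ge0.
move=> s t st; rewrite lt_neqAle (mono _ _ (ltW st)) andbT; apply/eqP => est.
pose m := (s + t) / 2; have [d d0 hd] := nz m.
pose k := Num.min d ((t - s) / 2) / 2.
have k0 : 0 < k by rewrite /k divr_gt0 // lt_min d0 /=; lra.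
have [kd kt] : k < d /\ k < (t - s) / 2.
  have : 2 * k <= Num.min d ((t - s) / 2) by rewrite /k mulrC divfK.
  by rewrite le_min => /andP[]; lra.
have qy : q (m + k) != 0 by apply: hd; rewrite addrC addKr gtr0_norm // k0.
have d1 : 0 < (t - s) / 2 - k by lra.
have := near_derive (g := S) (x := m + k) d1 _ (dC (S s) _).
have cst y : `|y - (m + k)| < (t - s) / 2 - k -> S s = S y.
  rewrite ltr_norml /m => /andP[y1 y2].
  by apply/eqP; rewrite eq_le mono ?est ?mono //; lra.
move=> /(_ cst)/(derive_unique (dS qy))/eqP.
by rewrite invr_eq0 (negbTE qy).
Qed.

Let S0 : S 0 = 0. Proof. exact: oint_id. Qed.
Let S1 := S 1.
Let S1_gt0 : 0 < S1. Proof. by rewrite -S0; apply: S_incr. Qed.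

Let Sp t : S (t + 1) = S t + S1.
Proof.
apply/eqP; rewrite -subr_eq [X in _ - X](_ : _ = S (0 + 1)); last by rewrite add0r.
rewrite S_sub -(oint_shift 1 0 t Lloc_inv_orbit) /S; apply/eqP; congr oint.
by apply/funext => x; rewrite qp.
Qed.

Let Ss t : S (1 - t) = S1 - S t.
Proof.
rewrite [RHS]S_sub; have := oint_refl 1 t 1 Lloc_inv_orbit; rewrite subrr.
under eq_fun do rewrite qs; move=> ->; by [].
Qed.

(** k is the integral of 1 / q over a period and T the inverse of the normalised
    primitive of 1 / q.  That T is differentiable at collisions as well, with T' = k q (T) = 0,
    follows from [punctured_derive]. *)
Lemma lift_time : exists k T, [/\ 0 < k, T 0 = 0, forall s, T (s + 1) = T s + 1 /\ T (1 - s) = 1 - T s,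
   strict_incr T & forall s, is_derive s 1 T (k * q (T s))].
Proof.
pose Sig t := S1^-1 * S t; have s1 : S1 != 0 by rewrite gt_eqF.
have SigS t : Sig (t + 1) = Sig t + 1 by rewrite /Sig Sp mulrDr mulVf.
have Sigs t : Sig (1 - t) = 1 - Sig t by rewrite /Sig Ss mulrBr mulVf.
have iSig : strict_incr Sig by move=> s t st; rewrite ltr_pM2l ?invr_gt0 //; exact: S_incr.
have cSig : continuous Sig by exact: contZ.
have Sig0 : Sig 0 = 0 by rewrite /Sig S0 mulr0.
have cD : continuous (fun t => Sig t - t) by apply: contB => //; exact: id_cont.
have pD t : Sig (t + 1) - (t + 1) = Sig t - t by rewrite SigS; ring.
have [M M0 hM] := per_bound cD pD.
have onto s : exists t, Sig t = s.
  have := hM (s - M); have := hM (s + M); rewrite !ler_norml => /andP[h1 h2] /andP[h3 h4].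
  have [||| x [_ _ <- _]] := @last_point R Sig (s - M) (s + M) s cSig; [lra|lra|lra|by exists x].
have [T TK] := choice onto; have inj := increasing_inj iSig.
have KT t : T (Sig t) = t by apply: inj; rewrite TK.
have iT : strict_incr T by move=> s t st; apply: (increasing_lt iSig); rewrite !TK.
have cT : continuous T by exact: increasing_inverse_cont iSig TK.
exists S1, T; split => //.
- by apply: inj; rewrite TK Sig0.
- by move=> s; split; apply: inj; rewrite ?SigS ?Sigs !TK.
move=> s; apply: (punctured_derive (F := T) (g := fun s => S1 * q (T s))) => // [|x].
  by apply: contZ; exact: cont_comp.
have [d d0 hd] := punctured_comp cT (increasing_inj iT) nz x; exists d => // y /hd qy.
have dSig : is_derive (T y) 1 Sig (S1^-1 * (q (T y))^-1) by exact: dZ (dS qy).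
have k0 : S1^-1 * (q (T y))^-1 != 0 by rewrite mulf_neq0 ?invr_eq0.
by have := increasing_inverse_derive iSig cSig TK dSig k0; rewrite TK invfM !invrK.
Qed.

Section Lift.
Variables (k : R) (T : R -> R).
Hypotheses (k0 : 0 < k) (T0 : T 0 = 0) (TS : forall s, T (s + 1) = T s + 1 /\ T (1 - s) = 1 - T s).
Hypotheses (iT : strict_incr T) (dT : forall s, is_derive s 1 T (k * q (T s))).

Let cT : continuous T := derive_cont dT.
Let sig2 t : sig t ^+ 2 = 1 := fs.1 t.
Let sig_abs t : `|sig t| = 1.
Proof. by apply/eqP; rewrite -(@eqrXn2 R 2) // real_normK ?num_real // sig2 expr1n. Qed.

Let sig_near t : q t != 0 -> exists2 d : R, 0 < d & forall y, `|y - t| < d -> sig y = sig t.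
Proof.
move=> qt; have [d [d0 h1 h2]] := fs.2 t; exists d => // y; rewrite ltr_norml => /andP[y1 y2].
by have [ty|yt] := leP t y; [apply: h1; lra|rewrite h2 ?(negbTE qt) ?mul1r; lra].
Qed.

Definition lift_loop t := sig t * Num.sqrt (q t).
Local Notation zz := lift_loop.

Let zz_sq t : zz t ^+ 2 = q t.
Proof. by rewrite exprMn sig2 mul1r sqr_sqrtr. Qed.

Let sqrt_cont : continuous (fun t => Num.sqrt (q t)).
Proof. by apply: cont_comp => //; exact: sqrt_continuous. Qed.

Let zz_cont : continuous zz.
Proof.
move=> t; apply/contP => eps' e0; have [qt|qt] := eqVneq (q t) 0.
  have [d d0 hd] := (contP _ _).1 (@cq t) _ (exprn_gt0 2 e0); exists d => // y /hd.
  have -> : zz t = 0 by rewrite /zz qt sqrtr0 mulr0.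
  rewrite qt !subr0 -zz_sq normrX.
  by rewrite ltr_pXn2r // ?nnegrE // ltW.
have [d d0 hd] := (contP _ _).1 (@sqrt_cont t) _ e0; have [d' d'0 hd'] := sig_near qt.
exists (Num.min d d'); first by rewrite lt_min d0.
move=> y; rewrite lt_min => /andP[/hd h1 /hd' h2].
by rewrite /zz h2 -mulrBr normrM sig_abs mul1r.
Qed.

Let zz_derive t : q t != 0 -> is_derive t 1 zz (zz t * v t / (2 * q t)).
Proof.
move=> qt; have [d d0 hd] := sig_near qt; have qt0 : 0 < q t by rewrite lt_neqAle eq_sym qt q0.
have := dZ (sig t) (@chain_rule R Num.sqrt q t _ _ (is_derive1_sqrt qt0) (dq qt)).
have r0 : Num.sqrt (q t) != 0 by rewrite sqrtr_eq0 -ltNge.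
move=> /(near_derive d0 (g := zz)) h; apply: eq_derive (h _).
  by rewrite /zz -{3}(sqr_sqrtr (q0 t)); field.
by move=> y /hd e'; rewrite /zz e'.
Qed.

(** The derivative of the lift with respect to the parameter, up to the factor k.  Its
    square is 1 + e q / 2, which prescribes the values +- 1 at collisions. *)
Definition lift_speed t := if q t == 0 then sig t else 2^-1 * (zz t * v t).
Local Notation w := lift_speed.

Let w_sq t : w t ^+ 2 = 1 + e t * q t / 2.
Proof.
rewrite /w; have [->|qt] := eqVneq (q t) 0; first by rewrite sig2 mulr0 mul0r addr0.
by rewrite exprMn [(zz t * v t) ^+ 2]exprMn zz_sq ev //; field.
Qed.

Let w_near t : q t != 0 -> exists2 d : R, 0 < d & forall y, `|y - t| < d -> 2^-1 * (zz y * v y) = w y.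
Proof. by move=> /neq_near[d d0 hd]; exists d => // y /hd qy; rewrite /w (negbTE qy). Qed.

Let w_derive t : q t != 0 -> is_derive t 1 w (zz t * (e t + eps * (q t * K t)) / (2 * q t)).
Proof.
move=> qt; have [d d0 hd] := w_near qt.
apply: (near_derive d0 hd); apply: eq_derive (dZ _ (dM (zz_derive qt) (dv qt))).
by rewrite ev //; field.
Qed.

(** At a collision q v vanishes, and its derivative 2 / q + 2 e + eps q K is positive near
    it: the particle approaches the collision before and leaves it afterwards. *)
Lemma qv_sign t : q t = 0 -> exists2 d : R, 0 < d & forall y, 0 < `|y - t| < d -> 0 < (y - t) * (q y * v y).
Proof.
(* q times the derivative of q v *)
move=> qt; pose h y := 2 + q y * (2 * e y + eps * (q y * K y)).
have ch : continuous h.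
  apply: contD; first exact: cst_cont.
  by apply: contM => //; apply: contD; [exact: contZ|apply: contZ; exact: contM].
have [d1 d10 h1] := (contP _ _).1 (ch t) _ (ltr0n _ 1).
have [d2 d20 h2] := nz t.
have dF y : 0 < `|y - t| < Num.min d1 d2 -> exists2 l : R, 0 < l & is_derive y 1 (fun y => q y * v y) l.
  rewrite lt_min => /and3P[y0 /h1 y1 y2]; have qy : q y != 0 by apply: h2; rewrite y0.
  exists (h y / q y); last by apply: eq_derive (dM (dq qy) (dv qy)); rewrite /h ev //; field.
  rewrite divr_gt0 // ?(lt_neqAle 0) 1?eq_sym ?qy ?q0 //.
  by move: y1; rewrite {2}/h qt mul0r addr0 ltr_norml => /andP[y1 _]; lra.
exists (Num.min d1 d2); first by rewrite lt_min d10.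
move=> y /andP[y0 yd]; have cF := continuous_subspaceT qv_cont.
pose F y := q y * v y; rewrite -/(F y).
have dF' x : 0 < `|x - t| < Num.min d1 d2 -> 0 < derive1 F x /\ is_derive x 1 F (derive1 F x).
  by move=> /dF[l l0 dl]; rewrite derive1E (@derive_val _ _ _ _ _ _ _ dl).
have Ft : F t = 0 by rewrite /F qt mul0r.
have MV a b : a < b -> (forall x, a < x < b -> 0 < `|x - t| < Num.min d1 d2) -> F a < F b.
  move=> ab hx; have hd x : x \in `]a, b[ -> is_derive x 1 F (derive1 F x) by rewrite in_itv => /hx/dF'[].
  have [c c1 ec] := MVT ab hd (cF _); rewrite in_itv /= in c1.
  by rewrite -subr_gt0 ec mulr_gt0 ?subr_gt0 //; have [] := dF' c (hx c c1).
have [yt|ty] := ltP y t.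
  have := MV y t yt; rewrite Ft => h0; rewrite nmulr_rgt0 ?subr_lt0 //; apply: h0.
  move=> x /andP[x1 x2]; rewrite ltr0_norm ?subr_lt0 //; move: yd; rewrite ltr0_norm ?subr_lt0 // => yd.
  by apply/andP; split; [lra|apply: le_lt_trans yd; lra].
have ty' : t < y by rewrite lt_neqAle ty andbT; apply: contraTneq y0 => ->; rewrite subrr normr0 ltxx.
have := MV t y ty'; rewrite Ft => h0; rewrite pmulr_rgt0 ?subr_gt0 //; apply: h0.
move=> x /andP[x1 x2]; rewrite gtr0_norm ?subr_gt0 //; move: yd; rewrite gtr0_norm ?subr_gt0 // => yd.
by apply/andP; split; [lra|apply: le_lt_trans yd; lra].
Qed.

Let w_sign t : q t = 0 -> exists2 d : R, 0 < d & forall y, `|y - t| < d -> 0 < sig t * w y.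
Proof.
move=> qt; have [d1 d10 h1] := qv_sign qt; have [d2 [d20 h2 h3]] := fs.2 t; have [d3 d30 h4] := nz t.
exists (Num.min d1 (Num.min d2 d3)); first by rewrite !lt_min d10 d20.
move=> y; rewrite !lt_min => /and3P[y1 y2 y3].
have [->|yt] := eqVneq y t; first by rewrite /w qt eqxx -expr2 sig2.
have y0 : 0 < `|y - t| by rewrite normr_gt0 subr_eq0.
have qy : q y != 0 by apply: h4; rewrite y0.
have qy0 : 0 < q y by rewrite lt_neqAle eq_sym qy q0.
have ry : 0 < Num.sqrt (q y) by rewrite sqrtr_gt0.
have := h1 y; rewrite y0 => /(_ y1) sg'; rewrite /w (negbTE qy) /zz.
move: y2; rewrite ltr_norml => /andP[y4 y5].
have [ty|yt'] := ltP t y.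
  have -> : sig y = sig t by apply: h2; [exact: ltW|lra].
  have -> : sig t * (2^-1 * (sig t * Num.sqrt (q y) * v y)) = sig t ^+ 2 * (2^-1 * Num.sqrt (q y) * v y) by ring.
  rewrite sig2 mul1r pmulr_rgt0; last by rewrite mulr_gt0.
  by move: sg'; rewrite pmulr_rgt0 ?subr_gt0 // pmulr_rgt0.
have yt'' : y < t by rewrite lt_neqAle yt.
have -> : sig y = -1 * sig t by rewrite h3 ?qt ?eqxx //; lra.
have -> : sig t * (2^-1 * (-1 * sig t * Num.sqrt (q y) * v y)) = - (sig t ^+ 2 * (2^-1 * Num.sqrt (q y) * v y)) by ring.
rewrite sig2 mul1r oppr_gt0 pmulr_rlt0; last by rewrite mulr_gt0.
by move: sg'; rewrite nmulr_rgt0 ?subr_lt0 // pmulr_rlt0.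
Qed.

Let w_cont : continuous w.
Proof.
move=> t; have [qt|qt] := eqVneq (q t) 0; last exact: derive_cont_at (w_derive qt).
apply/contP => eps' e0.
have ch : continuous (fun t => 1 + e t * q t / 2).
  apply: contD; first exact: cst_cont.
  by under eq_fun do rewrite mulrC; apply: contZ; exact: contM.
have [d1 d10 h1] := (contP _ _).1 (ch t) _ e0; have [d2 d20 h2] := w_sign qt.
exists (Num.min d1 d2); first by rewrite lt_min d10.
move=> y; rewrite lt_min => /andP[/h1 y1 /h2 y2].
rewrite {2}/w qt eqxx; apply: le_lt_trans y1.
rewrite qt mulr0 mul0r addr0 -w_sq -(sig2 t).
have -> : w y ^+ 2 - sig t ^+ 2 = (w y - sig t) * (sig t * (sig t * w y + sig t ^+ 2)).
  by transitivity (sig t ^+ 2 * (w y ^+ 2 - sig t ^+ 2)); [rewrite [X in X * _]sig2 mul1r|ring].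
rewrite !normrM sig_abs mul1r sig2 ler_peMr // ger0_norm; first lra.
by rewrite addr_ge0 // ltW.
Qed.

Let q_comp_nz : punctured (fun s => q (T s) != 0) := punctured_comp cT (increasing_inj iT) nz.

Let z s := zz (T s).
Let p s := k * w (T s).

Let dz s : is_derive s 1 z (p s).
Proof.
apply: (punctured_derive (F := z) (g := p)) => [||x].
- exact: cont_comp.
- by apply: contZ; exact: cont_comp.
have [d d0 hd] := q_comp_nz x; exists d => // y /hd qy.
apply: eq_derive (@chain_rule R zz T y _ _ (zz_derive qy) (dT y)).
by rewrite /p /w (negbTE qy); field.
Qed.

Let dp s : is_derive s 1 p (k ^+ 2 / 2 * (z s * (e (T s) + eps * (q (T s) * K (T s))))).
Proof.
apply: (punctured_derive (F := p) (g := fun s => k ^+ 2 / 2 * (z s * (e (T s) + eps * (q (T s) * K (T s)))))) => [||x].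
- by apply: contZ; exact: cont_comp.
- apply: contZ; apply: contM; first exact: cont_comp.
  apply: contD; first exact: cont_comp.
  by apply: contZ; apply: contM; exact: cont_comp.
have [d d0 hd] := q_comp_nz x; exists d => // y /hd qy.
apply: eq_derive (dZ k (@chain_rule R w T y _ _ (w_derive qy) (dT y))).
by rewrite /z; field.
Qed.

Let dE s : is_derive s 1 (fun s => e (T s)) (eps * (2 * (z s * p s) * K (T s))).
Proof.
apply: (punctured_derive (F := fun s => e (T s)) (g := fun s => eps * (2 * (z s * p s) * K (T s)))) => [||x].
- exact: cont_comp.
- apply: contZ; apply: contM; last exact: cont_comp.
  by apply: contZ; apply: contM; [exact: cont_comp|apply: contZ; exact: cont_comp].
have [d d0 hd] := q_comp_nz x; exists d => // y /hd qy.
have de : is_derive (T y) 1 e (eps * K (T y) * v (T y)).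
  have [d' d'0 hd'] := neq_near qy.
  apply: (near_derive d'0 (f := fun t => 2^-1 * v t ^+ 2 - 2 * (q t)^-1)).
    by move=> t /hd' qt; rewrite ev // mulrC.
  by apply: eq_derive (dB (dZ _ (dsq (dv qy))) (dZ _ (dV qy (dq qy)))); field.
apply: eq_derive (@chain_rule R e T y _ _ de (dT y)).
rewrite /p /w (negbTE qy) /z.
have -> : eps * (2 * (zz (T y) * (k * (2^-1 * (zz (T y) * v (T y))))) * K (T y)) = eps * (2 * 2^-1) * zz (T y) ^+ 2 * k * v (T y) * K (T y) by ring.
by rewrite zz_sq; field.
Qed.

Let z_normsq : normsq z = k^-1.
Proof.
have c1 : continuous (fun s => k * q (T s)) by apply: contZ; exact: cont_comp.
have := oint_FTC (f := fun s => k * q (T s)) (F := T) 0 1 c1 dT.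
rewrite T0 subr0 -[X in T X](add0r 1) (TS 0).1 T0 add0r.
rewrite ointZ; last by apply: continuous_Lloc; exact: cont_comp.
rewrite normsqE (_ : (fun s => z s ^+ 2) = fun s => q (T s)); last by apply/funext => s; rewrite zz_sq.
by move=> h; apply: (mulfI (lt0r_neq0 k0)); rewrite h divff // lt0r_neq0.
Qed.

Let z_timechange s : timechange z s = T s.
Proof.
have c1 : continuous (fun s => k * q (T s)) by apply: contZ; exact: cont_comp.
have := oint_FTC (f := fun s => k * q (T s)) (F := T) 0 s c1 dT.
rewrite T0 subr0 ointZ; last by apply: continuous_Lloc; exact: cont_comp.
rewrite timechangeE z_normsq invrK (_ : (fun s => z s ^+ 2) = fun s => q (T s)); last by apply/funext => x; rewrite zz_sq.
by rewrite mulrC.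
Qed.

(** The equations hold off the collisions by the chain rule; all functions involved are
    continuous, so they hold everywhere. *)
Lemma lift_kepler : exists z p E, [/\ 0 < normsq z, kepler eps z p E K, continuous p,
  forall s, z s ^+ 2 = q (timechange z s) & forall s, timechange z s = T s].
Proof.
exists z, p, (fun s => e (T s)); split.
- by rewrite z_normsq invr_gt0.
- have kn : k != 0 by rewrite lt0r_neq0.
  split => // s.
  + apply: eq_derive (dp s); rewrite z_timechange z_normsq zz_sq; field.
    exact: kn.
  + by rewrite z_timechange; exact: dE.
  rewrite z_normsq zz_sq exprMn w_sq; field.
  exact: kn.
- by apply: contZ; exact: cont_comp.
- by move=> s; rewrite z_timechange zz_sq.
- exact: z_timechange.
Qed.

End Lift.
End NewtonOrbit.

(** * Uniqueness of lifts *)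

Section LoopUniqueness.
Context {R : realType}.
Implicit Types (f g h p q v e w K z E T : R -> R) (a b c x y d s t eps sg k : R).

Local Opaque normsq wderiv oint.

Lemma punctured_eq f g (P : R -> Prop) : continuous f -> continuous g -> punctured P ->
  (forall y, P y -> f y = g y) -> forall y, f y = g y.
Proof.
move=> cf cg hP fg; have /(_ _ 0) h : forall x y, f x - g x = f y - g y.
  apply: (punctured_cst (F := fun x => f x - g x)); first exact: contB.
  move=> x; have [d d0 hd] := hP x; exists d => // y yx.
  have [d' d'0 hd'] : exists2 d' : R, 0 < d' & forall u, `|u - y| < d' -> 0 < `|u - x| < d.
    have /andP[y0 yd] := yx.
    exists (Num.min `|y - x| (d - `|y - x|)); first by rewrite lt_min y0 subr_gt0.
    move=> u; rewrite lt_min => /andP[u1 u2].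
    have e1 := ler_distD y u x; have e2 := ler_distD u y x; rewrite (distrC y u) in e2.
    by apply/andP; split; lra.
  by apply: (near_derive d'0 _ (dC 0 y)) => u /hd'/hd/fg ->; rewrite subrr.
have [d d0 hd] := hP 0; move=> y; apply/eqP; rewrite -subr_eq0 (h y).
have e : f (d / 2) = g (d / 2).
  by apply: fg; apply: hd; rewrite subr0 gtr0_norm ?divr_gt0 //; apply/andP; split; lra.
by rewrite -(h (d / 2)) e subrr.
Qed.

Lemma sign_valued_cst f : continuous f -> (forall s, f s ^+ 2 = 1) -> forall x y, f x = f y.
Proof.
move=> cf f2; have f1 s : f s = 1 \/ f s = -1.
  by have /eqP := f2 s; rewrite sqrf_eq1 => /orP[]/eqP; [left|right].
suff h x y : x <= y -> f x = f y.
  by move=> x y; have [/h//|/ltW/h//] := leP x y.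
move=> xy; apply: (cousin (P := fun x y => f x = f y) xy) => [a b c' _ _ -> //|s].
have [d d0 hd] := (contP _ _).1 (cf s) _ (ltr01 : 0 < (1 : R)).
have near u : `|u - s| < d -> f u = f s.
  by move=> /hd; case: (f1 u) (f1 s) => -> [] -> //; rewrite ltr_norml => /andP[]; lra.
by exists d => // a b us su sw wd; rewrite !near // ltr_norml; apply/andP; split; lra.
Qed.

(** From z z' = w w' and z' ^+ 2 = w' ^+ 2 the function
    (z w + z' w') / (w ^+ 2 + w' ^+ 2) has square 1.  It is continuous, hence constant, and it
    is the ratio z / w, also at zeroes of w. *)
Lemma square_root_unique z p w v : (forall s, is_derive s 1 z (p s)) -> (forall s, is_derive s 1 w (v s)) ->
  continuous p -> continuous v -> (forall s, z s ^+ 2 = w s ^+ 2) -> (forall s, w s = 0 -> v s != 0) ->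
  exists2 c, c ^+ 2 = 1 & forall s, z s = c * w s /\ p s = c * v s.
Proof.
move=> dz dw cp cv zw simple; have cz := derive_cont dz; have cw := derive_cont dw.
have nzw : punctured (fun s => w s != 0).
  move=> x; have [wx|wx] := eqVneq (w x) 0; first exact: derive_neq0 (dw x) wx (simple x wx).
  by have [d d0 hd] := cont_neq0 (@cw x) wx; exists d => // y /andP[_ /hd].
have zp s : z s * p s = w s * v s.
  have := dsq (dz s); rewrite (funext zw : (fun s => z s ^+ 2) = fun s => w s ^+ 2).
  move=> /(derive_unique (dsq (dw s))); rewrite -!mulrA => h.
  by apply: (mulfI (_ : (2 : R) != 0)).
have pv : forall s, p s ^+ 2 = v s ^+ 2.
  apply: (punctured_eq _ _ nzw); [exact: cont_sqr|exact: cont_sqr|move=> s ws].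
  have w2 : w s ^+ 2 != 0 by rewrite sqrf_eq0.
  by apply: (mulfI w2); rewrite -{1}zw -!exprMn zp.
pose m s := w s ^+ 2 + v s ^+ 2.
have m0 s : m s != 0.
  rewrite /m paddr_eq0 ?sqr_ge0 // !sqrf_eq0; apply/negP => /andP[/eqP/simple/negbTE -> //].
have cm : continuous m by apply: contD; exact: cont_sqr.
pose c s := (z s * w s + p s * v s) / m s.
have cc : continuous c by apply: contM; [apply: contD; exact: contM|exact: contV].
have c2 s : c s ^+ 2 = 1.
  rewrite /c expr_div_n; apply/eqP; rewrite -(inj_eq (mulIf (_ : m s ^+ 2 != 0))) ?divfK ?sqrf_eq0 // mul1r.
  have -> : (z s * w s + p s * v s) ^+ 2 = z s ^+ 2 * w s ^+ 2 + p s ^+ 2 * v s ^+ 2 + 2 * (z s * p s) * (w s * v s) by ring.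
  by rewrite zp zw pv; apply/eqP; rewrite /m; ring.
have cst s : c s = c 0 by exact: (sign_valued_cst cc c2).
exists (c 0) => // s; rewrite -(cst s) /c; split; apply: (mulIf (m0 s)); rewrite mulrAC divfK // /m.
  have -> : (z s * w s + p s * v s) * w s = z s * w s ^+ 2 + p s * (w s * v s) by ring.
  by rewrite -zp -pv; ring.
have -> : (z s * w s + p s * v s) * v s = z s * (w s * v s) + p s * v s ^+ 2 by ring.
by rewrite -zp -zw; ring.
Qed.

(** The reflection of the lift is c z with a sign c, which is 1 because z does not vanish
    at 1/2.  So z' is odd about 1/2, and the sign b in z (s + 1) = b z s follows by
    comparing at s = 0 the values of z, or those of z' if z 0 = 0. *)
Lemma newton_lift eps q v e K : newton_orbit eps q v e K -> continuous K -> q 2^-1 != 0 ->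
  exists z p E, [/\ nloop (if q 0 == 0 then -1 else 1) z p, kepler eps z p E K, sym z, periodic p 2 & lc z = q].
Proof.
move=> [[cq q0 qp qs] nz [dq dv ev] ce [[g qg] [sig fs]]] cK q2.
have [k [T [k0 T0 TS iT dT]]] := lift_time cq q0 qp qs nz dq dv ev ce qg.
have [z [p [E [N0 kp cp z2 zT]]]] := lift_kepler cq q0 nz dq dv ev ce cK fs k0 T0 TS iT dT.
exists z, p, E.
have [dz _ _ _] := kp; have cz := derive_cont dz.
have simple := kepler_simple kp.
have z2' s : z s ^+ 2 = q (T s) by rewrite z2 zT.
have dzs s : is_derive s 1 (fun s => z (1 - s)) (- p (1 - s)).
  by apply: eq_derive (@chain_rule R z (fun s => 1 - s) s _ _ (dz _) (dB (dC 1 s) (dI s))); ring.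
have dzt s : is_derive s 1 (fun s => z (s + 1)) (p (s + 1)).
  by apply: eq_derive (@chain_rule R z (fun s => s + 1) s _ _ (dz _) (dD (dI s) (dC 1 s))); ring.
have cps : continuous (fun s => - p (1 - s)).
  by apply: contN; apply: cont_comp => //; apply: contB; [exact: cst_cont|exact: id_cont].
have cpt : continuous (fun s => p (s + 1)).
  by apply: cont_comp => //; apply: contD; [exact: id_cont|exact: cst_cont].
have [c c2 hc] : exists2 c, c ^+ 2 = 1 & forall s, z (1 - s) = c * z s /\ - p (1 - s) = c * p s.
  apply: (square_root_unique dzs dz cps cp _ simple) => s.
  by rewrite !z2' (TS s).2 qs.
have [b b2 hb] : exists2 b, b ^+ 2 = 1 & forall s, z (s + 1) = b * z s /\ p (s + 1) = b * p s.
  apply: (square_root_unique dzt dz cpt cp _ simple) => s.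
  by rewrite !z2' (TS s).1 qp.
have h2 : 1 - 2^-1 = 2^-1 :> R by lra.
have T2 : T 2^-1 = 2^-1 by have := (TS 2^-1).2; rewrite h2; lra.
have zn2 : z 2^-1 != 0 by rewrite -sqrf_eq0 z2' T2.
have c1 : c = 1.
  by have := (hc 2^-1).1; rewrite h2 => h; apply: (mulIf zn2); rewrite -h mul1r.
have zs : sym z by move=> s; rewrite (hc s).1 c1 mul1r.
have ps s : p (1 - s) = - p s by have := (hc s).2; rewrite c1 mul1r => <-; rewrite opprK.
have b1 : b = if q 0 == 0 then -1 else 1.
  have [z1 p1] := hb 0; rewrite add0r -[X in z X]subr0 zs in z1; rewrite add0r -[X in p X]subr0 ps in p1.
  case: eqP => q00.
    have z0 : z 0 = 0 by apply/eqP; rewrite -sqrf_eq0 z2' T0 q00.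
    by apply: (mulIf (simple 0 z0)); rewrite -p1 mulN1r.
  have z0 : z 0 != 0 by rewrite -sqrf_eq0 z2' T0; apply/eqP.
  by apply: (mulIf z0); rewrite -z1 mul1r.
have fl : nloop b z p.
  by split => //; [exact: AC_C1|move=> s; exact: (hb s).1].
split => //; first by rewrite -b1.
  by move=> s; rewrite -[2]/(1 + 1) addrA (hb _).2 (hb _).2 mulrA -expr2 b2 mul1r.
apply/funext => t; have [h1 _ h3 h4] := fl; have [s <-] := timechange_onto (twist_sqloop h1 b2 h3 h4) t.
by rewrite (lc_timechange fl) z2.
Qed.

(** The inverse time changes have derivatives N / q and N' / q, and both map 0, 1
    to 0, 1; hence N = N' and the time changes agree. *)
Lemma lc_determines sg sg' eps eps' f f' g g' p p' E E' K K' :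
  nloop sg f g -> kepler eps f p E K -> nloop sg' f' g' -> kepler eps' f' p' E' K' ->
  lc f = lc f' -> forall s, f s ^+ 2 = f' s ^+ 2.
Proof.
move=> fl kp fl' kp' e s.
have [a1 a2 a3 N0] := fl; have sq := twist_sqloop a1 a2 a3 N0.
have [b1 b2 b3 N0'] := fl'; have sq' := twist_sqloop b1 b2 b3 N0'.
have n0 : normsq f != 0 by rewrite gt_eqF. have n0' : normsq f' != 0 by rewrite gt_eqF.
pose D t := (normsq f)^-1 * invtime f t - (normsq f')^-1 * invtime f' t.
have cD : continuous D.
  by apply: contB; apply: contZ; [exact: invtime_cont fl kp|exact: invtime_cont fl' kp'].
have dD' : punctured (fun t => is_derive t 1 D 0).
  move=> x; have [d d0 hd] := lc_isolated fl kp x; exists d => // y /hd qy.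
  have d1 := invtime_derive fl kp qy; rewrite e in qy; have d2 := invtime_derive fl' kp' qy.
  apply: eq_derive (dB (dZ (normsq f)^-1 d1) (dZ (normsq f')^-1 d2)).
  by rewrite e !mulrA !mulVf // subrr.
have Dc := punctured_cst cD dD'.
have t0 : invtime f 0 = 0 /\ invtime f' 0 = 0.
  by split; [have := timechangeK fl kp 0|have := timechangeK fl' kp' 0]; rewrite timechange0.
have t1 : invtime f 1 = 1 /\ invtime f' 1 = 1.
  by split; [have := timechangeK fl kp 1; rewrite (timechange1 sq)|have := timechangeK fl' kp' 1; rewrite (timechange1 sq')].
have NN : (normsq f)^-1 = (normsq f')^-1.
  by have := Dc 1 0; rewrite /D t0.1 t0.2 t1.1 t1.2 !mulr0 !mulr1 subrr => /eqP; rewrite subr_eq0 => /eqP.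
have tau t : invtime f t = invtime f' t.
  have := Dc t 0; rewrite /D t0.1 t0.2 !mulr0 subrr NN -mulrBr => /eqP.
  by rewrite mulf_eq0 invr_eq0 (negbTE n0') /= subr_eq0 => /eqP.
have tc : timechange f s = timechange f' s.
  by rewrite -[LHS](timechange_invtime sq') -tau (timechangeK fl kp).
by rewrite -(lc_timechange fl) -(lc_timechange fl') tc e.
Qed.

End LoopUniqueness.

(** * The four lifts of a symmetric frozen planet orbit *)

Section OrbitLifts.
Context {R : realType}.
Implicit Types (f g h p v w e K E : R -> R) (a b c x y d s t r eps sg : R) (q z : (R -> R) * (R -> R)).

Local Opaque normsq wderiv oint.

Definition Kpair r q t := r / (q.1 t - q.2 t) ^+ 2 + (1 - r) / (mean q.1 - mean q.2) ^+ 2.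

Lemma component_orbit eps f K : H1 1 f -> (forall t, 0 <= f t) -> sym f -> finite_set (zeroes f) ->
  C2_on [set t | f t != 0] f -> energy_extends f ->
  (forall t, f t != 0 -> derive1n 2 f t = - (2 / f t ^+ 2) + eps * K t) ->
  exists e, newton_orbit eps f (derive1 f) e K.
Proof.
move=> hf f0 fs fz c2 [e [ce _ ev]] eqn; have [cf fp _] := hf; exists e; split => //.
- exact: finite_punctured.
- split => // t ft; have [d1 d2 _] := c2 t ft.
    by apply: (DeriveDef d1); rewrite derive1E.
  by apply: (DeriveDef d2); rewrite -(eqn t ft) derive1nS derive1E.
have p1 : 0 < (1 : R) by [].
have [_ a1] := @wderivP R 1 f p1 hf.
split; [by exists (wderiv 1 f)|exact: flips_exists fp fz].
Qed.

Lemma solution_orbits r q : generalized_solution r q -> Defs.symmetric q ->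
  (exists e, newton_orbit 1 q.1 (derive1 q.1) e (Kpair r q)) /\
  (exists e, newton_orbit (-1) q.2 (derive1 q.2) e (Kpair r q)).
Proof.
move=> [[h1 h2 p1 p2] _ [z1 z2] [c1 c2 _ _] [e1 e2 n1 n2]] [s1 s2].
split; apply: component_orbit => //.
- by move=> t qt; rewrite e1 // mul1r addrA.
- by move=> t qt; rewrite e2 // mulN1r opprD addrA.
Qed.

Lemma newton_shift eps f v e K : newton_orbit eps f v e K ->
  newton_orbit eps (fun t => f (t + 2^-1)) (fun t => v (t + 2^-1)) (fun t => e (t + 2^-1)) (fun t => K (t + 2^-1)).
Proof.
move=> [[cf f0 fp fs] nz [df dv ev] ce [[g fg] [sig [s1 s2]]]].
have csh : continuous (fun t => t + 2^-1 : R) by apply: contD; [exact: id_cont|exact: cst_cont].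
have dsh h l t : is_derive (t + 2^-1) 1 h l -> is_derive t 1 (fun t => h (t + 2^-1)) l.
  move=> dh; apply: eq_derive (@chain_rule R h (fun t => t + 2^-1) t _ _ dh (dD (dI t) (dC 2^-1 t))).
  by rewrite addr0 mulr1.
split.
- split; [exact: cont_comp|by move=> t; exact: f0| |].
    by move=> t; rewrite addrAC fp.
  move=> t; rewrite (_ : 1 - t + 2^-1 = 1 - (t - 2^-1)); last by ring.
  by rewrite fs -fp; congr f; lra.
- by apply: (punctured_comp (P := fun t => f t != 0)) => //; exact: addIr.
- by split => t ft; [apply: dsh; exact: df|apply: dsh; exact: dv|exact: ev].
- exact: cont_comp.
split; first by exists (fun t => g (t + 2^-1)); exact: abscont_shift.
exists (fun t => sig (t + 2^-1)); split => [t|x]; first exact: s1.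
have [d [d0 h1 h2]] := s2 (x + 2^-1); exists d; split => // t t1 t2; [apply: h1|apply: h2]; lra.
Qed.

(** By parity q_2 vanishes at exactly one of the times 0 and 1/2. *)
Lemma collision_orbits r q : symmetric_frozen_planet r q ->
  exists v1 e1 v2 e2, [/\ newton_orbit 1 (collision_at_0 q).1 v1 e1 (Kpair r (collision_at_0 q)),
    newton_orbit (-1) (collision_at_0 q).2 v2 e2 (Kpair r (collision_at_0 q)),
    forall t, (collision_at_0 q).2 t < (collision_at_0 q).1 t,
    (collision_at_0 q).2 0 = 0 & (collision_at_0 q).2 2^-1 != 0].
Proof.
move=> [gs sq _ [n on cn]]; have [[e1 o1] [e2 o2]] := solution_orbits gs sq.
have [_ gp _ _ _] := gs; have [s1 s2] := sq.
have [[cf1 _ p1 _] _ _ _ _] := o1; have [[cf2 _ p2 fs2] _ _ _ _] := o2.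
have par := zeroes_parity p2 fs2 cn; rewrite on in par.
rewrite /collision_at_0; case: eqP par => [q0|q0] /=.
  by move=> /esym qh; exists (derive1 q.1), e1, (derive1 q.2), e2.
move=> /esym/eqP qh.
exists (fun t => derive1 q.1 (t + 2^-1)), (fun t => e1 (t + 2^-1)), (fun t => derive1 q.2 (t + 2^-1)), (fun t => e2 (t + 2^-1)).
have mE f : continuous f -> (forall t, f (t + 1) = f t) -> mean (fun t => f (t + 2^-1)) = mean f.
  move=> cf fp; rewrite !meanE (oint_shift 2^-1 0 1 (continuous_Lloc cf)) [1 + _]addrC [0 + _]addrC addr0.
  by rewrite (oint_period 2^-1 0 (continuous_Lloc cf) fp) add0r.
have KE : Kpair r (fun t => q.1 (t + 2^-1), fun t => q.2 (t + 2^-1)) = fun t => Kpair r q (t + 2^-1).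
  by apply/funext => t; rewrite /Kpair /= !mE.
rewrite KE; split => //=; [exact: newton_shift|exact: newton_shift|by rewrite add0r|].
by rewrite (_ : 2^-1 + 2^-1 = 0 + 1 :> R); [rewrite p2; apply/eqP|lra].
Qed.

Definition lifts r q f1 p1 E1 f2 p2 E2 :=
  [/\ [/\ nloop 1 f1 p1, kepler 1 f1 p1 E1 (Kpair r q), sym f1, periodic p1 2 & lc f1 = q.1] &
      [/\ nloop (-1) f2 p2, kepler (-1) f2 p2 E2 (Kpair r q), sym f2, periodic p2 2 & lc f2 = q.2]].

Lemma lift_exists r q : symmetric_frozen_planet r q ->
  exists f1 p1 E1 f2 p2 E2, lifts r (collision_at_0 q) f1 p1 E1 f2 p2 E2.
Proof.
move=> sp; have [v1 [e1 [v2 [e2 []]]]] := collision_orbits sp.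
move: (collision_at_0 q) => u o1 o2 gp u0 uh.
have [[c1 _ _ _] _ _ _ _] := o1; have [[c2 c2_ge0 _ _] _ _ _ _] := o2.
have u1 t : u.1 t != 0 by rewrite gt_eqF // (le_lt_trans (c2_ge0 t)).
have cK : continuous (Kpair r u).
  apply: contD; last exact: cst_cont.
  apply: contZ; apply: contV => [|t]; first by apply: cont_sqr; exact: contB.
  by rewrite sqrf_eq0 gt_eqF // subr_gt0.
have [f1 [p1 [E1 [a1 b1 d1 g1 l1]]]] := newton_lift o1 cK (u1 _).
have [f2 [p2 [E2 [a2 b2 d2 g2 l2]]]] := newton_lift o2 cK uh.
rewrite (negbTE (u1 0)) in a1; rewrite u0 eqxx in a2.
by exists f1, p1, E1, f2, p2, E2.
Qed.

Lemma nloop_H1 sg f p : nloop sg f p -> periodic p 2 -> H1 2 f.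
Proof.
move=> [fp sg1 ft _] pp; apply: (AC_H1 _ _ pp fp); first exact: ltr0n.
by move=> s; rewrite -[2]/(1 + 1) addrA !ft mulrA -expr2 sg1 mul1r.
Qed.

Lemma lifts_critical r q f1 p1 E1 f2 p2 E2 : 0 <= r <= 1 -> (forall t, q.2 t < q.1 t) ->
  lifts r q f1 p1 E1 f2 p2 E2 ->
  critical H1_sym Hhat_in (B_act r) (f1, f2) /\ levi_civita (f1, f2) = q.
Proof.
move=> hr gp [[a1 b1 d1 g1 l1] [a2 b2 d2 g2 l2]].
have [_ _ t1 n1] := a1; have [_ _ t2 n2] := a2.
have tz : H1_twist (f1, f2).
  split => /=; [exact: nloop_H1 a1 g1|exact: nloop_H1 a2 g2| |] => s.
    by rewrite t1 mul1r.
  by rewrite t2 mulN1r.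
have hz : Htilde_in (f1, f2) by apply: Htilde_gapP => //= t; rewrite l1 l2.
split; last by rewrite [RHS]surjective_pairing -l1 -l2.
apply/(critical_sym _ hr); split.
  by have [_ _ _ gz] := hz; split => //; split.
exists p1, E1, p2, E2.
by rewrite (_ : Kforce r (f1, f2) = Kpair r q) //; apply/funext => t; rewrite /Kforce /Kpair /= l1 l2.
Qed.

Section SameSquare.
Variables (f g : R -> R).
Hypothesis fg : forall s, f s ^+ 2 = g s ^+ 2.
Let e : (fun s => f s ^+ 2) = (fun s => g s ^+ 2) := funext fg.

Lemma same_normsq : normsq f = normsq g.
Proof. by rewrite !normsqE e. Qed.

Lemma same_timechange : timechange f = timechange g.
Proof. by apply/funext => s; rewrite !timechangeE e same_normsq. Qed.

Lemma same_lc : lc f = lc g.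
Proof. by apply/funext => t; rewrite /lc /invtime same_timechange fg. Qed.
End SameSquare.

Let sign_sq (b : bool) f : forall s, ((-1) ^+ b * f s) ^+ 2 = f s ^+ 2.
Proof. by move=> s; rewrite exprMn sqrr_sign mul1r. Qed.

Lemma kepler_sign (b : bool) eps f p E K : kepler eps f p E K ->
  kepler eps (fun s => (-1) ^+ b * f s) (fun s => (-1) ^+ b * p s) E K.
Proof.
move=> [df dp dE EP]; have e := sign_sq b f.
rewrite /kepler (same_normsq e) (same_timechange e); split => s.
- exact: dZ.
- by apply: eq_derive (dZ _ (dp s)); rewrite e; ring.
- apply: eq_derive (dE s).
  have -> : (-1) ^+ b * f s * ((-1) ^+ b * p s) = ((-1) ^+ b) ^+ 2 * (f s * p s) by ring.
  by rewrite sqrr_sign mul1r.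
by rewrite e [((-1) ^+ b * p s) ^+ 2]exprMn sqrr_sign mul1r.
Qed.

Lemma nloop_sign (b : bool) sg f p : nloop sg f p ->
  nloop sg (fun s => (-1) ^+ b * f s) (fun s => (-1) ^+ b * p s).
Proof.
move=> [fp sg1 ft n0]; split => //; [exact: AC_Z|by move=> s; rewrite ft mulrCA|].
by rewrite (same_normsq (sign_sq b f)).
Qed.

Lemma lifts_sign (b1 b2 : bool) r q f1 p1 E1 f2 p2 E2 : lifts r q f1 p1 E1 f2 p2 E2 ->
  lifts r q (fun s => (-1) ^+ b1 * f1 s) (fun s => (-1) ^+ b1 * p1 s) E1
            (fun s => (-1) ^+ b2 * f2 s) (fun s => (-1) ^+ b2 * p2 s) E2.
Proof.
move=> [[a1 k1 d1 g1 l1] [a2 k2 d2 g2 l2]]; split.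
  split; [exact: nloop_sign|exact: kepler_sign|by move=> s; rewrite d1|by move=> s; rewrite g1|].
  by rewrite (same_lc (sign_sq b1 f1)).
split; [exact: nloop_sign|exact: kepler_sign|by move=> s; rewrite d2|by move=> s; rewrite g2|].
by rewrite (same_lc (sign_sq b2 f2)).
Qed.

Lemma component_unique sg sg' eps eps' f f' g p p' E E' K K' :
  nloop sg f g -> kepler eps f p E K -> nloop sg' f' p' -> kepler eps' f' p' E' K' -> 
  continuous K -> continuous p' -> lc f = lc f' ->
  exists b : bool, f = fun s => (-1) ^+ b * f' s.
Proof.
move=> fl kp fl' kp' cK cp' e; have sqe := lc_determines fl kp fl' kp' e.
have [df dp _ _] := kp; have [df' _ _ _] := kp'.
have [c c2 hc] := square_root_unique df df' (derive_cont dp) cp' sqe (kepler_simple kp').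
have /eqP := c2; rewrite sqrf_eq1 => /orP[]/eqP ce.
  by exists false; apply/funext => s; rewrite (hc s).1 ce.
by exists true; apply/funext => s; rewrite (hc s).1 ce.
Qed.

(** Bits of n < 4 encode the two signs. *)
Lemma four_lifts r q : 0 <= r <= 1 -> symmetric_frozen_planet r q ->
  ([set z | critical H1_sym Hhat_in (B_act r) z /\ levi_civita z = collision_at_0 q] #= `I_4)%card.
Proof.
move=> hr sp; have [f1 [p1 [E1 [f2 [p2 [E2 lf]]]]]] := lift_exists sp.
have [_ [_ [_ [_ [_ _ gp _ _]]]]] := collision_orbits sp.
move: (collision_at_0 q) lf gp => u lf gp.
have [[a1 k1 d1 g1 l1] [a2 k2 d2 g2 l2]] := lf.
pose F (b1 b2 : bool) : (R -> R) * (R -> R) := (fun s => (-1) ^+ b1 * f1 s, fun s => (-1) ^+ b2 * f2 s).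
have -> : [set z | critical H1_sym Hhat_in (B_act r) z /\ levi_civita z = u] =
    [set F (1 < n)%N (odd n) | n in `I_4].
  apply/seteqP; split => z /=; last first.
    by move=> [n _ <-]; apply: lifts_critical hr gp (lifts_sign _ _ lf).
  move=> [/(critical_sym _ hr)[hz [p1' [E1' [p2' [E2' [k1' k2']]]]]] lz].
  have [_ _ hz'] := H1_sym_nloops hz; have [_ fl1 fl2 _] := Htilde_nloops hz'.
  have cK : continuous (Kforce r z) by exact: Kforce_cont.
  have c1 : continuous p1 by case: k1 => _ dp _ _; exact: derive_cont dp.
  have c2 : continuous p2 by case: k2 => _ dp _ _; exact: derive_cont dp.
  have [b1 e1] := component_unique fl1 k1' a1 k1 cK c1 (etrans (congr1 fst lz) (esym l1)).
  have [b2 e2] := component_unique fl2 k2' a2 k2 cK c2 (etrans (congr1 snd lz) (esym l2)).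
  exists (2 * b1 + b2)%N; first by case: (b1); case: (b2).
  by rewrite [RHS]surjective_pairing e1 e2; case: (b1); case: (b2).
apply: inj_card_eq => n m; rewrite !inE /= => n4 m4 e.
have nz f p E eps sg : nloop sg f p -> exists s, f s != 0.
  move=> [_ _ _ n0]; apply: contrapT => h; move: n0; rewrite normsqE (_ : (fun s => f s ^+ 2) = fun=> 0).
    by rewrite oint_cst mul0r ltxx.
  by apply/funext => s; have [->|fs] := eqVneq (f s) 0; [rewrite expr0n|case: h; exists s].
have sg_inj (b b' : bool) f p E eps sg : nloop sg f p ->
    (fun s => (-1) ^+ b * f s) = (fun s => (-1) ^+ b' * f s) -> b = b'.
  move=> /(nz f p E eps)[s fs] /(congr1 (fun h => h s))/(mulIf fs).
  by case: b b' => [] [] //= /eqP; rewrite ?expr1 ?expr0; [rewrite eq_sym|]; rewrite -subr_eq0 opprK => /eqP; lra.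
have h1 := sg_inj _ _ _ _ E1 0 _ a1 (congr1 fst e).
have h2 := sg_inj _ _ _ _ E2 0 _ a2 (congr1 snd e).
by move: n m n4 m4 h1 h2 {e} => [|[|[|[|n]]]] [|[|[|[|m]]]].
Qed.

End OrbitLifts.

Unset Implicit Arguments.

Theorem theoremB (R : realType) (r : R) (hr : 0 <= r <= 1) :
  [/\ forall z : (R -> R) * (R -> R), Htilde_in z ->
        [/\ Htilde_in (rho z), rho (rho z) = z & B_act r (rho z) = B_act r z],
      [set z : (R -> R) * (R -> R) | Htilde_in z /\ rho z = z] = Hhat_in,
      [set z : (R -> R) * (R -> R) |
         critical H1_twist Htilde_in (B_act r) z /\ rho z = z] =
      [set z | critical H1_sym Hhat_in (B_act r) z],
      forall z : (R -> R) * (R -> R), critical H1_sym Hhat_in (B_act r) z ->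
        [/\ (forall t : R, (levi_civita z).1 t != 0 ->
               is_derive t 1 (invtime z.1) (normsq z.1 / (levi_civita z).1 t)),
            (forall t : R, (levi_civita z).2 t != 0 ->
               is_derive t 1 (invtime z.2) (normsq z.2 / (levi_civita z).2 t)),
            symmetric_frozen_planet r (levi_civita z) &
            (levi_civita z).2 0 = 0] &
      forall q : (R -> R) * (R -> R), symmetric_frozen_planet r q ->
        ([set z | critical H1_sym Hhat_in (B_act r) z /\
                 levi_civita z = collision_at_0 q] #= `I_4)%card].
Proof.
split.
- by move=> z; exact: rho_invariant.
- exact: fixed_sym.
- exact: fixed_critical.
- by move=> z /(critical_sym z hr)[hz kp]; exact: critical_solution.
- by move=> q; exact: four_lifts.
Qed.
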